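(* Let $(x,y),(x',y')\in\operatorname{Int}\Delta_W$ with $x+2y=x'+2y'=1$. If $L(x,y)$ is Hamiltonian isotopic to $L(x',y')$ in $\mathbb{CP}^2(\sqrt2)$, then $(x,y)=(x',y')$.
   Context: $\mathbb{CP}^2(\sqrt2)$ denotes the symplectic (coisotropic) reduction by the diagonal circle action of the sphere $\{|z_0|^2+|z_1|^2+|z_2|^2=2\}\subset\mathbb{C}^3$ with the standard form $\frac{i}{2}\sum_j dz_j\wedge d\bar z_j$. Its symplectic form is the Fubini--Study form $\omega_{\mathrm{FS}}$ normalized by $\int_{\mathbb{CP}^1}\omega_{\mathrm{FS}}=2\pi$. Homogeneous coordinates $[z_0:z_1:z_2]$ are always normalized by $|z_0|^2+|z_1|^2+|z_2|^2=2$. Let $\Delta_W=\{(x,y)\in\mathbb{R}^2: 0\le x\le 2,\ 0\le y\le\frac12-\frac14x\}$. The symplectic toric orbifold $F_4(0)$ with moment polytope $\Delta_W$ has one singular point, over $(0,\frac12)$. Replacing a neighborhood of this point with a neighborhood of the zero section of $T^*\mathbb{R}P^2$ gives a manifold $\widehat F_4(0)$ with a map $\mu_W:\widehat F_4(0)\to\Delta_W$, and for $(x,y)\in\operatorname{Int}\Delta_W$ one sets $L(x,y)=\mu_W^{-1}(x,y)$. $\widehat F_4(0)$ is identified with $\mathbb{CP}^2(\sqrt2)$ by the explicit Oakley--Usher symplectomorphism, under which, for $(x,y)\in\operatorname{Int}\Delta_W$, $$L(x,y)=\left\{[z_0:z_1:z_2]\in\mathbb{CP}^2(\sqrt2): |z_0^2+z_1^2+z_2^2|=4\sqrt{y(1-y)},\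 \operatorname{Im}(\bar z_1z_2)=x+2y-1\right\},$$ a Lagrangian torus; this may be taken as the definition of $L(x,y)$. Two Lagrangian tori are Hamiltonian isotopic if some Hamiltonian diffeomorphism of $\mathbb{CP}^2(\sqrt2)$ maps one onto the other. *)

(* Defs.v *)
From HB Require Import structures.
From mathcomp Require Import all_boot all_order all_algebra.
From mathcomp Require Import generic_quotient.
From mathcomp Require Import all_classical all_reals all_analysis.
From mathcomp Require Import complex.
Import Order.TTheory GRing.Theory Num.Theory.
Import numFieldNormedType.Exports.

Set Implicit Arguments.
Unset Strict Implicit.
Unset Printing Implicit Defensive.

Local Open Scope classical_set_scope.
Local Open Scope ring_scope.
Local Open Scope quotient_scope.
Local Open Scope complex_scope.

(* C^k on an open set U, for V finite dimensional: all directional derivatives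
   of order at most k exist and are continuous on U *)
Fixpoint C_on (R : realType) (V W : normedModType R) (k : nat) (U : set V)
    (f : V -> W) : Prop :=
  match k with
  | 0 => forall x, U x -> {for x, continuous f}
  | k'.+1 => (forall x, U x -> differentiable f x) /\
             forall v : V, C_on k' U (fun x => 'D_v f x)
  end.

Definition smooth_on (R : realType) (V W : normedModType R) (U : set V)
    (f : V -> W) : Prop :=
  forall k, C_on k U f.

(* C^3 as a real normed space: (a, b) stands for the vector a + i b *)
Definition C3 (R : realType) : normedModType R := ('rV[R]_3 * 'rV[R]_3)%type.

Section ProjectivePlane.
Variable R : realType.
Implicit Types (z v w : C3 R) (j : 'I_3).

Definition zcoord z j : R[i] := z.1 ord0 j +i* z.2 ord0 j.

Definition hnorm2 z : R[i] := \sum_j `|zcoord z j| ^+ 2.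

Definition sphere : {pred C3 R} := [pred z | hnorm2 z == 2].

(* (i/2) * sum_j dz_j /\ d(conj z_j), evaluated on (v, w) *)
Definition omega_std v w : R :=
  complex.Re ('i / 2 * \sum_j (zcoord v j * conjc (zcoord w j)
                       - zcoord w j * conjc (zcoord v j))).

Definition tangent_sphere z v : Prop :=
  complex.Re (\sum_j conjc (zcoord z j) * zcoord v j) = 0.

Definition S5 := {z : C3 R | z \in sphere}.

Definition circle_orbit (p q : S5) : bool :=
  `[< exists2 u : R[i], `|u| = 1 &
        forall j, zcoord (val q) j = u * zcoord (val p) j >].

Lemma circle_orbit_refl : reflexive circle_orbit.
Proof. by move=> p; apply/asboolP; exists 1; rewrite ?normr1// => j; rewrite mul1r. Qed.

Lemma circle_orbit_sym : symmetric circle_orbit.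
Proof.
suff H p q : circle_orbit p q -> circle_orbit q p.
  by move=> p q; apply/idP/idP; exact: H.
move=> /asboolP[u u1 pq]; apply/asboolP; exists u^-1.
  by rewrite normfV u1 invr1.
by move=> j; rewrite pq mulKf// -normr_gt0 u1.
Qed.

Lemma circle_orbit_trans : transitive circle_orbit.
Proof.
move=> q p r /asboolP[u u1 pq] /asboolP[v v1 qr]; apply/asboolP.
exists (v * u); first by rewrite normrM u1 v1 mulr1.
by move=> j; rewrite qr pq mulrA.
Qed.

Canonical circle_orbit_equiv :=
  EquivRel circle_orbit circle_orbit_refl circle_orbit_sym circle_orbit_trans.

Definition CP2 := {eq_quot circle_orbit}.

Lemma hnorm2E z :
  hnorm2 z = (\sum_j (z.1 ord0 j ^+ 2 + z.2 ord0 j ^+ 2))%:C.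
Proof.
rewrite /hnorm2 rmorph_sum; apply: eq_bigr => j _.
by rewrite normc_def -rmorphXn sqr_sqrtr ?addr_ge0 ?sqr_ge0.
Qed.

Lemma hnorm2Z (a : R) z : hnorm2 (a *: z) = (a ^+ 2)%:C * hnorm2 z.
Proof.
rewrite !hnorm2E -rmorphM mulr_sumr; congr (_%:C).
by apply: eq_bigr => j _; rewrite /= !mxE !exprMn -mulrDr.
Qed.

Lemma hnorm2_gt0 z : z != 0 -> 0 < complex.Re (hnorm2 z).
Proof.
move=> z0; rewrite hnorm2E /= lt0r sumr_ge0 ?andbT; last first.
  by move=> j _; rewrite addr_ge0 ?sqr_ge0.
apply: contra z0 => /eqP /psumr_eq0P H; apply/eqP.
have {}H j : z.1 ord0 j = 0 /\ z.2 ord0 j = 0.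
  have /eqP := H (fun j _ => addr_ge0 (sqr_ge0 _) (sqr_ge0 _)) j isT.
  by rewrite paddr_eq0 ?sqr_ge0// !sqrf_eq0 => /andP[/eqP ? /eqP ?].
by case: z H => a b /= H; congr (_, _); apply/rowP => j; rewrite mxE; case: (H j).
Qed.

Lemma normalize_sphere z : z != 0 ->
  Num.sqrt (2 / complex.Re (hnorm2 z)) *: z \in sphere.
Proof.
move=> /hnorm2_gt0 z0; rewrite inE hnorm2Z sqr_sqrtr ?divr_ge0 ?ltW//.
have {2}-> : hnorm2 z = (complex.Re (hnorm2 z))%:C by rewrite hnorm2E.
by rewrite -rmorphM divfK ?lt0r_neq0//; apply/eqP/(rmorph_nat (real_complex R) 2).
Qed.

Definition base_vector : C3 R := (Num.sqrt 2 *: delta_mx ord0 ord0, 0).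

Lemma base_vectorP : base_vector \in sphere.
Proof.
rewrite inE hnorm2E /= big_ord_recl big1 => [|j _]; rewrite !mxE /=.
  by rewrite mulr1 expr0n addr0 /= addr0 sqr_sqrtr// -[2]/(2%:R) rmorph_nat.
by rewrite mulr0 expr0n addr0.
Qed.

(* The projection C^3 \ {0} -> CP2, the value at 0 being irrelevant *)
Definition hproj z : CP2 :=
  \pi_CP2 (insubd (Sub base_vector base_vectorP : S5)
              (Num.sqrt (2 / complex.Re (hnorm2 z)) *: z)).

Lemma hproj_val (p : S5) : hproj (val p) = \pi_CP2 p.
Proof.
rewrite /hproj; congr (\pi_CP2 _); apply: val_inj.
have pS := valP p; move: (pS); rewrite inE => /eqP ->.
by rewrite /= divff ?pnatr_eq0// sqrtr1 scale1r insubdK.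
Qed.

Lemma hproj_eq z w : z \in sphere -> w \in sphere ->
  hproj z = hproj w <->
  exists2 u : R[i], `|u| = 1 & forall j, zcoord w j = u * zcoord z j.
Proof.
move=> zS wS; rewrite -(SubK S5 zS) -(SubK S5 wS) !hproj_val.
split=> [/eqmodP/asboolP//|H]; apply/eqmodP; exact/asboolP.
Qed.

(* H is smooth on R x CP2: CP2 carries the quotient smooth structure, so this
   is smoothness of its pullback along the submersion R x (C^3 \ {0}) -> R x CP2 *)
Definition smooth_hamiltonian (H : R -> CP2 -> R) : Prop :=
  smooth_on (V := (R^o * C3 R)%type) (W := R^o) [set tz | tz.2 != 0]
    (fun tz => H tz.1 (hproj tz.2)).

(* v in T_z S5 projects to the Hamiltonian vector field X_h at [z], where
   iota_(X_h) omega = dh; the reduced form omega on CP2 is the one whose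
   pullback to S5 is the restriction of omega_std *)
Definition hamiltonian_lift (h : CP2 -> R) z v : Prop :=
  tangent_sphere z v /\
  forall w, tangent_sphere z w ->
    omega_std v w = 'D_w (fun z' => h (hproj z') : R^o) z.

Definition integral_curve (H : R -> CP2 -> R) (gamma : R -> CP2) : Prop :=
  exists c : R^o -> C3 R, forall t,
    [/\ c t \in sphere, hproj (c t) = gamma t, derivable c t 1 &
        hamiltonian_lift (H t) (c t) ('D_1 c t)].

Definition hamiltonian_flow (H : R -> CP2 -> R) (phi : R -> CP2 -> CP2) : Prop :=
  forall p, phi 0 p = p /\ integral_curve H (fun t => phi t p).

(* By compactness and uniqueness for ODEs the flow of a smooth H exists, is
   unique and consists of diffeomorphisms *)
Definition hamiltonian_diffeo (psi : CP2 -> CP2) : Prop :=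
  exists H phi,
    [/\ smooth_hamiltonian H, hamiltonian_flow H phi & psi = phi 1].

Definition hamiltonian_isotopic (A B : set CP2) : Prop :=
  exists2 psi, hamiltonian_diffeo psi & psi @` A = B.

Definition Delta_W : set (R * R) :=
  [set p | 0 <= p.1 <= 2 /\ 0 <= p.2 <= 1 / 2 - 1 / 4 * p.1].

Definition L_torus (x y : R) : set CP2 :=
  [set hproj z | z in [set z | [/\ z \in sphere,
    `|\sum_j zcoord z j ^+ 2| = (4 * Num.sqrt (y * (1 - y)))%:C &
    complex.Im (conjc (zcoord z 1) * zcoord z 2) = x + 2 * y - 1]]].

End ProjectivePlane.

(* Main.v *)
From HB Require Import structures.
Require Import Defs.
From mathcomp Require Import all_boot all_order all_algebra.
From mathcomp Require Import all_classical all_reals all_analysis.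
From mathcomp Require Import complex ring lra zify.
Import Order.TTheory GRing.Theory Num.Theory.
Import numFieldNormedType.Exports.

Set Implicit Arguments.
Unset Strict Implicit.
Unset Printing Implicit Defensive.

Local Open Scope classical_set_scope.
Local Open Scope ring_scope.
Local Open Scope complex_scope.

(** Two quantities attached to loops in a torus are invariant under Hamiltonian
    isotopies and tell the tori apart: the holonomy of the prequantization bundle
    S^5 -> CP^2 and the Maslov phase.

    The tori are lifted to S^5. For x = 1 - 2 y the points of the lift are
    (z_0, zeta n) with n a unit vector of R^2, and u = z_0 + i zeta,
    v = z_0 - i zeta satisfy |u|^2 = 4 y, |v|^2 = 4 (1 - y) ([torus_coordP]). If A and B
    are the arguments of u and v, the contact form of the sphere restricts to a
    multiple of y dA + (1 - y) dB ([horizontal_bound]), and the complex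
    determinant of a frame consisting of a point and of two tangent horizontal
    vectors has the argument of u v zeta up to a sign ([det3_phase_Re]); along a
    loop its variation is dA + 2 dB, because |u| < |v| ([phase_lift]).

    A Hamiltonian isotopy lifts to the flow of an equivariant field on S^5
    ([regular_Xfun], [lift_curve]), which preserves the contact form and the
    circle action. The loop along which u makes 1 - y turns and v makes - y
    turns is horizontal and closes up in CP^2 with holonomy exp (- 2 i pi y). Its
    image in the second torus is horizontal with the same holonomy, so that
    A and B vary by 2 pi (a - y) and 2 pi (b - y) with integers a and b, and
    y' (a - y) + (1 - y') (b - y) = 0. The flow maps Lagrangian frames to Lagrangian
    frames, so the determinant never vanishes and its winding is preserved:
    (a - y) + 2 (b - y) = 1 - 3 y. With n = a - b this reads y = n y' + b and
    1 - 3 y = n (1 - 3 y') ([rotation_numbers]). The reversed isotopy gives an integer m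
    with 1 - 3 y' = m (1 - 3 y), and these relations force y = y' ([torus_rigidity]).

    The differential of the flow never appears. A frame is replaced by
    three nearby points p, q, r of the sphere ([triple]), on which the lifted flow acts
    directly; estimates of Gronwall type show that such a triple remains almost
    Lagrangian and quantitatively independent ([triple_flow]), which bounds its
    determinant below ([det3_lower]). *)

(** * Arguments and winding of complex-valued functions *)

Section Winding.
Variable R : realType.
Implicit Types (s t a b : R) (w z : R[i]).

Lemma ReM w z : complex.Re (w * z) = complex.Re w * complex.Re z - complex.Im w * complex.Im z.
Proof. by case: w => a b; case: z => c d. Qed.

Lemma ImM w z : complex.Im (w * z) = complex.Re w * complex.Im z + complex.Im w * complex.Re z.
Proof. by case: w => a b; case: z => c d. Qed.

Lemma complex_eq w z : complex.Re w = complex.Re z -> complex.Im w = complex.Im z -> w = z.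
Proof. by case: w => a b; case: z => c d /= -> ->. Qed.

Definition cis a : R[i] := cos a +i* sin a.

Lemma cis0 : cis 0 = 1.
Proof. by rewrite /cis cos0 sin0. Qed.

Lemma cisD a b : cis (a + b) = cis a * cis b.
Proof.
by apply: complex_eq; rewrite ?ReM ?ImM /= ?cosD ?sinD //; ring.
Qed.

Lemma cisN a : cis (- a) = (cis a)^-1.
Proof.
have H : cis a * cis (- a) = 1 by rewrite -cisD subrr cis0.
have c0 : cis a != 0.
  by apply/eqP => c0; move: H; rewrite c0 mul0r => /eqP; rewrite eq_sym oner_eq0.
by rewrite -[RHS]mulr1 -H mulKf.
Qed.

Lemma cis_neq0 a : cis a != 0.
Proof.
apply/eqP => c0; have: cis a * cis (- a) = 1 by rewrite -cisD subrr cis0.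
by rewrite c0 mul0r => /eqP; rewrite eq_sym oner_eq0.
Qed.

Lemma cis_eq1 a : cis a = 1 -> exists n : int, a = n%:~R * (2 * pi).
Proof.
move=> Ha; set n := Num.floor (a / (2 * pi)).
have p0 : 0 < 2 * pi :> R by rewrite mulr_gt0 // pi_gt0.
exists n; set b := a - n%:~R * (2 * pi).
have [b0 b1] : 0 <= b /\ b < 2 * pi.
  have /andP[] := floor_itv (a / (2 * pi)); rewrite -/n ler_pdivlMr // ltr_pdivrMr //.
  rewrite intrD mulrDl mul1r /b; lra.
have cisn (m : nat) : cis (m%:R * (2 * pi)) = 1.
  elim: m => [|m IH]; first by rewrite mul0r cis0.
  rewrite -natr1 mulrDl mul1r cisD IH mul1r /cis.
  by rewrite [2 * pi]mulr_natl cos2pi sin2pi.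
have cisz : cis (n%:~R * (2 * pi)) = 1.
  case: n {b b0 b1} => m; first exact: cisn.
  by rewrite NegzE mulrNz mulNr cisN cisn invr1.
have Hb : cos b = 1.
  have : cis b = 1 by rewrite /b cisD cisN cisz Ha invr1 mulr1.
  by move=> [].
suff : b = 0 by rewrite /b => /eqP; rewrite subr_eq0 => /eqP.
apply/eqP; rewrite eq_le b0 andbT leNgt; apply/negP => b0'.
have s0 : 0 < sin (b / 2) by apply: sin_gt0_pi; apply/andP; split; lra.
have : cos (b / 2 *+ 2) = 1 by rewrite -mulr_natr divfK.
rewrite cos_mulr2n cos2sin2 => H.
have : 0 < sin (b / 2) ^+ 2 by rewrite exprn_gt0.
lra.
Qed.

Definition is_arg w a := exists2 r : R, 0 < r & w = r%:C * cis a.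

Lemma is_arg_neq0 w a : is_arg w a -> w != 0.
Proof.
move=> [r r0 ->]; rewrite mulf_neq0 ?cis_neq0 //.
by rewrite (_ : 0 = 0%:C) // (inj_eq (@complexI R)) gt_eqF.
Qed.

Lemma is_argM w z a b : is_arg w a -> is_arg z b -> is_arg (w * z) (a + b).
Proof.
move=> [r r0 ->] [q q0 ->]; exists (r * q); first exact: mulr_gt0.
by rewrite cisD rmorphM /=; ring.
Qed.

Lemma is_argV w a : is_arg w a -> is_arg w^-1 (- a).
Proof.
move=> [r r0 ->]; exists r^-1; first by rewrite invr_gt0.
by rewrite cisN invfM fmorphV.
Qed.

Lemma is_arg_cis a : is_arg (cis a) a.
Proof. by exists 1; rewrite ?mul1r. Qed.

Lemma is_arg1 : is_arg 1 0.
Proof. by rewrite -cis0; exact: is_arg_cis. Qed.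

Lemma is_arg_uniq w a b : is_arg w a -> is_arg w b ->
  exists n : int, a - b = n%:~R * (2 * pi).
Proof.
move=> ha hb; apply: cis_eq1.
have := is_argM ha (is_argV hb); rewrite mulfV ?(is_arg_neq0 ha) // => -[r r0 e].
have r1 : r = 1.
  have h : cos (a - b) ^+ 2 + sin (a - b) ^+ 2 = 1 by exact: cos2Dsin2.
  move: e; rewrite /cis => /(congr1 (fun z => (complex.Re z, complex.Im z))).
  rewrite ReM ImM /= !mul0r subr0 addr0 => -[e1 e2].
  have : r ^+ 2 = 1.
    rewrite -[r ^+ 2]mulr1 -h mulrDr -!exprMn -e1 -e2 expr0n /= addr0 expr1n //.
  move/eqP; rewrite sqrf_eq1 => /orP[/eqP //|/eqP rN].
  by move: r0; rewrite rN ltr0N1.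
by rewrite e r1 mul1r.
Qed.

(** An argument of w when its real part is positive; the formula does not
    distinguish w from - w, which also serves when the real part is negative. *)
Definition arg w := atan (complex.Im w / complex.Re w).

Lemma is_arg_arg w : 0 < complex.Re w -> is_arg w (arg w).
Proof.
case: w => a b /= a0; rewrite /arg /=; set x := b / a.
have c0 : 0 < cos (atan x) by rewrite cos_atan invr_gt0 sqrtr_gt0 ltr_wpDr ?sqr_ge0.
exists (a / cos (atan x)); first exact: divr_gt0.
have sE : sin (atan x) = x * cos (atan x).
  by rewrite -{2}[x]atanK /tan divfK ?gt_eqF.
apply: complex_eq; rewrite ?ReM ?ImM /= mul0r ?subr0 ?addr0.
  by rewrite divfK ?gt_eqF.
by rewrite sE mulrCA divfK ?gt_eqF // /x divfK ?gt_eqF.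
Qed.

Lemma arg1 : arg 1 = 0.
Proof. by rewrite /arg /= mul0r atan0. Qed.

(** Componentwise, so that it reduces to continuity of real functions. *)
Definition ccont (f : R -> R[i]) s :=
  {for s, continuous (fun s => complex.Re (f s))} /\ {for s, continuous (fun s => complex.Im (f s))}.

Lemma ccont_cst w s : ccont (fun=> w) s.
Proof. by split; exact: cvg_cst. Qed.

Lemma ccontM f g s : ccont f s -> ccont g s -> ccont (fun s => f s * g s) s.
Proof.
move=> [f1 f2] [g1 g2]; split.
  rewrite (_ : (fun _ => _) = (fun s => complex.Re (f s) * complex.Re (g s) - complex.Im (f s) * complex.Im (g s))).
    by apply: continuousB; exact: continuousM.
  by apply/funext => x; exact: ReM.
rewrite (_ : (fun _ => _) = (fun s => complex.Re (f s) * complex.Im (g s) + complex.Im (f s) * complex.Re (g s))).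
  by apply: continuousD; exact: continuousM.
by apply/funext => x; exact: ImM.
Qed.

Lemma ccontD f g s : ccont f s -> ccont g s -> ccont (fun s => f s + g s) s.
Proof.
move=> [f1 f2] [g1 g2]; split.
  rewrite (_ : (fun _ => _) = (fun s => complex.Re (f s) + complex.Re (g s))).
    exact: continuousD.
  by apply/funext => x; case: (f x); case: (g x).
rewrite (_ : (fun _ => _) = (fun s => complex.Im (f s) + complex.Im (g s))).
  exact: continuousD.
by apply/funext => x; case: (f x); case: (g x).
Qed.

Lemma ccontV f s : f s != 0 -> ccont f s -> ccont (fun s => (f s)^-1) s.
Proof.
move=> fs0 [f1 f2].
have n0 : complex.Re (f s) ^+ 2 + complex.Im (f s) ^+ 2 != 0.
  apply: contra fs0; rewrite paddr_eq0 ?sqr_ge0 // !sqrf_eq0 => /andP[/eqP h1 /eqP h2].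
  by apply/eqP/complex_eq.
have cN : {for s, continuous (fun s => (complex.Re (f s) ^+ 2 + complex.Im (f s) ^+ 2)^-1)}.
  apply: continuousV => //.
  apply: continuousD; [exact: (continuousM f1 f1)|exact: (continuousM f2 f2)].
split.
  rewrite (_ : (fun _ => _) = (fun s => complex.Re (f s) * (complex.Re (f s) ^+ 2 + complex.Im (f s) ^+ 2)^-1)).
    exact: continuousM.
  by apply/funext => x; case: (f x).
rewrite (_ : (fun _ => _) = (fun s => - (complex.Im (f s) * (complex.Re (f s) ^+ 2 + complex.Im (f s) ^+ 2)^-1))).
  by apply: continuousN; exact: continuousM.
by apply/funext => x; case: (f x) => a b /=; rewrite -mulNr.
Qed.

Lemma continuous_arg f s : ccont f s -> 0 < complex.Re (f s) ->
  {for s, continuous (fun s => arg (f s))}.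
Proof.
move=> [f1 f2] p; rewrite /arg.
apply: (@continuous_comp _ _ _ (fun s => complex.Im (f s) / complex.Re (f s)) (@atan R)).
  by apply: continuousM => //; apply: continuousV => //; rewrite gt_eqF.
exact: continuous_atan.
Qed.

(** A half-integral value between two distinct values would be attained. *)
Lemma discrete_valued_const (g : R -> R) a b c : a <= b -> 0 < c ->
  {within `[a, b], continuous g} ->
  (forall s, s \in `[a, b] -> exists n : int, g s = n%:~R * c) -> g a = g b.
Proof.
move=> ab c0 gc gi.
wlog gab : g gc gi / g a <= g b.
  move=> W; have [gab|/ltW gab] := leP (g a) (g b); first exact: W.
  apply: oppr_inj; apply: (W (fun s => - g s)).
  - by move=> s; apply: cvgN; exact: gc.
  - by move=> s /gi[n ->]; exists (- n); rewrite mulrNz mulNr.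
  - by rewrite lerN2.
apply/eqP; rewrite eq_le gab /= leNgt; apply/negP => gab'.
have [n gn] : exists n : int, g a = n%:~R * c by apply: gi; rewrite in_itv /= lexx.
have [m gm] : exists n : int, g b = n%:~R * c by apply: gi; rewrite in_itv /= lexx andbT.
have nm : (n < m)%R by move: gab'; rewrite gn gm ltr_pM2r // ltr_int.
have nm' : (n%:~R + 1 <= m%:~R :> R) by rewrite -[1]/(1%:~R) -intrD ler_int lezD1.
have [] := @IVT _ g a b ((n%:~R + 1 / 2) * c) ab gc.
  rewrite /Num.min /Num.max gab' gn gm !ler_pM2r //; apply/andP; split; lra.
move=> s /gi[k ->] /(mulIf (lt0r_neq0 c0)) /(congr1 (fun x => x * 2)).
rewrite mulrDl divfK ?pnatr_eq0 // => h.
have : (k * 2 = n * 2 + 1)%R.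
  by apply/eqP; rewrite -(eqr_int R) intrD !intrM h.
lia.
Qed.

(** Over a step eta the quotient stays in the right half plane, where [arg] is
    a continuous choice of argument. *)
Definition slow (f : R -> R[i]) eta :=
  forall s s', `|s - s'| <= eta -> 0 < complex.Re (f s' / f s).

Lemma slow_neq0 f eta s : 0 <= eta -> slow f eta -> f s != 0.
Proof.
move=> eta0 sl; have := sl s s; rewrite subrr normr0 => /(_ eta0).
by apply: contraL => /eqP ->; rewrite mul0r ltxx.
Qed.

(** The difference of both sides is continuous in b, vanishes at b = a and takes
    values in the multiples of 2 pi. *)
Lemma lift_step f th eta a b : 0 < eta -> slow f eta -> (forall s, ccont f s) ->
  continuous th -> 0 <= a -> a <= b -> b <= 1 -> b - a <= eta ->
  (forall s, 0 <= s <= 1 -> is_arg (f s / f 0) (th s)) ->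
  th b - th a = arg (f b / f a).
Proof.
move=> eta0 sl fc thc a0 ab b1 bae hth.
have f0 s : f s != 0 by apply: slow_neq0 sl; exact: ltW.
have sl' s : s \in `[a, b] -> 0 < complex.Re (f s / f a).
  rewrite in_itv /= => /andP[h1 h2]; apply: sl.
  by rewrite distrC ger0_norm; lra.
pose g s := th s - th a - arg (f s / f a).
have gab : g a = g b.
  apply: (@discrete_valued_const _ _ _ (2 * pi)) => //.
  - by rewrite mulr_gt0 // pi_gt0.
  - apply: continuous_in_subspaceT => s; rewrite inE /= => sab.
    apply: (@continuousB _ _ _ (fun s => th s - th a) (fun s => arg (f s / f a))).
      by apply: continuousB; [exact: thc|exact: cvg_cst].
    apply: (@continuous_arg (fun s => f s / f a)); last exact: sl'.
    by apply: ccontM => //; exact: ccont_cst.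
  - move=> s sab; have := sl' s sab; move: sab; rewrite in_itv /= => /andP[h1 h2] p.
    apply: is_arg_uniq (is_arg_arg p).
    have -> : f s / f a = (f s / f 0) / (f a / f 0).
      by field; rewrite !f0.
    by apply: is_argM; [|apply: is_argV]; apply: hth; lra.
move: gab; rewrite /g subrr divff // arg1; lra.
Qed.

(** The increment of a lift of the argument, written as a finite sum that depends
    continuously on f. *)
Definition incr_sum (f : R -> R[i]) N :=
  \sum_(0 <= k < N.+1) arg (f (k.+1%:R / N.+1%:R) / f (k%:R / N.+1%:R)).

Lemma mesh_le N k : (k <= N.+1)%N -> 0 <= (k%:R / N.+1%:R : R) <= 1.
Proof.
move=> kN; rewrite divr_ge0 // ?ler0n //=.
by rewrite ler_pdivrMr ?ltr0n // mul1r ler_nat.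
Qed.

Lemma mesh_step N k : k.+1%:R / N.+1%:R - k%:R / N.+1%:R = N.+1%:R^-1 :> R.
Proof. by rewrite -mulrBl -natr1 addrAC subrr add0r mul1r. Qed.

Lemma lift_increment f th eta N : 0 < eta -> slow f eta -> (forall s, ccont f s) ->
  continuous th -> (forall s, 0 <= s <= 1 -> is_arg (f s / f 0) (th s)) ->
  N.+1%:R^-1 <= eta -> th 1 - th 0 = incr_sum f N.
Proof.
move=> eta0 sl fc thc hth Ne.
have -> : th 1 - th 0 = th (N.+1%:R / N.+1%:R) - th (0%:R / N.+1%:R).
  by rewrite divff ?mul0r // pnatr_eq0.
rewrite -(telescope_sumr (fun k => th (k%:R / N.+1%:R))) //.
rewrite /incr_sum !big_nat; apply: eq_bigr => k /andP[_ kN].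
have /andP[h1 h2] := @mesh_le N k (ltnW kN).
have /andP[h3 h4] := @mesh_le N k.+1 kN.
apply: (@lift_step f th eta) => //.
  by rewrite -subr_ge0 mesh_step invr_ge0.
by rewrite mesh_step.
Qed.

Lemma is_arg_prod (f : R -> R[i]) (x : nat -> R) m :
  (forall k, (k <= m)%N -> f (x k) != 0) ->
  (forall k, (k < m)%N -> 0 < complex.Re (f (x k.+1) / f (x k))) ->
  is_arg (f (x m) / f (x 0%N)) (\sum_(0 <= k < m) arg (f (x k.+1) / f (x k))).
Proof.
elim: m => [|m IH] fn0 fp; first by rewrite big_nil divff ?fn0 //; exact: is_arg1.
rewrite big_nat_recr //=.
have -> : f (x m.+1) / f (x 0%N) = f (x m) / f (x 0%N) * (f (x m.+1) / f (x m)).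
  by rewrite [RHS]mulrC mulrA divfK ?fn0.
apply: is_argM; last by apply: is_arg_arg; exact: fp.
by apply: IH => k km; [apply: fn0; exact: leqW|apply: fp; exact: ltnW].
Qed.

Lemma incr_sum_arg f eta N : 0 < eta -> slow f eta -> N.+1%:R^-1 <= eta ->
  is_arg (f 1 / f 0) (incr_sum f N).
Proof.
move=> eta0 sl Ne.
have := @is_arg_prod f (fun k => k%:R / N.+1%:R) N.+1.
rewrite divff ?mul0r ?pnatr_eq0 //; apply.
  by move=> k _; apply: slow_neq0 sl; exact: ltW.
move=> k _; apply: sl; rewrite distrC mesh_step ger0_norm ?invr_ge0 //.
Qed.

Lemma ex_mesh eta : 0 < eta -> exists N, N.+1%:R^-1 <= eta :> R.
Proof.
move=> e0; exists (Num.bound eta^-1).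
rewrite invf_ple ?posrE // ?ltr0n //; apply: ltW.
apply: lt_le_trans (archi_boundP _) _; first by rewrite invr_ge0 ltW.
by rewrite ler_nat.
Qed.

(** The increment at time t is an argument of kappa, hence confined to a discrete
    set, and it is continuous in t because the same mesh serves for all t. *)
Lemma winding_homotopy (D : R -> R -> R[i]) eta (kappa : R[i]) th0 th1 :
  0 < eta -> (forall t, 0 <= t <= 1 -> slow (D t) eta) ->
  (forall t s, 0 <= t <= 1 -> ccont (D t) s) ->
  (forall t s, 0 <= t <= 1 -> ccont (D^~ s) t) ->
  (forall t, 0 <= t <= 1 -> D t 1 = kappa * D t 0) ->
  continuous th0 -> continuous th1 ->
  (forall s, 0 <= s <= 1 -> is_arg (D 0 s / D 0 0) (th0 s)) ->
  (forall s, 0 <= s <= 1 -> is_arg (D 1 s / D 1 0) (th1 s)) ->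
  th0 1 - th0 0 = th1 1 - th1 0.
Proof.
move=> eta0 sl cs ct Dk c0 c1 h0 h1.
have [N Ne] := ex_mesh eta0.
have i0 : 0 <= (0 : R) <= 1 by rewrite lexx ler01.
have i1 : 0 <= (1 : R) <= 1 by rewrite lexx ler01.
rewrite (@lift_increment (D 0) th0 eta N) //; [|exact: sl|by move=> s; exact: cs].
rewrite (@lift_increment (D 1) th1 eta N) //; [|exact: sl|by move=> s; exact: cs].
pose g t := incr_sum (D t) N - incr_sum (D 0) N.
suff : g 0 = g 1 by rewrite /g subrr => /esym/eqP; rewrite subr_eq0 => /eqP.
have D0 t s : 0 <= t <= 1 -> D t s != 0.
  by move=> /sl /slow_neq0; apply; exact: ltW.
apply: (@discrete_valued_const _ _ _ (2 * pi)) => //.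
- by rewrite mulr_gt0 // pi_gt0.
- apply: continuous_in_subspaceT => t; rewrite inE /= in_itv /= => t01.
  apply: (@continuousB _ _ _ (fun t => incr_sum (D t) N)); last exact: cvg_cst.
  rewrite /incr_sum.
  apply: cvg_big => [|k _]; first exact: add_continuous.
  apply: (@continuous_arg (fun t => D t (k.+1%:R / N.+1%:R) / D t (k%:R / N.+1%:R))).
    by apply: ccontM; [exact: ct|apply: ccontV; [exact: D0|exact: ct]].
  apply: (sl t t01); rewrite distrC mesh_step ger0_norm ?invr_ge0 //.
- move=> t; rewrite in_itv /= => t01; apply: (@is_arg_uniq kappa).
    have := incr_sum_arg eta0 (sl t t01) Ne.
    by rewrite Dk // mulfK ?D0.
  have := incr_sum_arg eta0 (sl 0 i0) Ne.
  by rewrite Dk // mulfK ?D0.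
Qed.

Local Notation normc := ComplexField.Normc.normc.

Lemma Re_le_normc w : `|complex.Re w| <= normc w.
Proof.
case: w => a b /=; rewrite -sqrtr_sqr ler_wsqrtr // lerDl sqr_ge0 //.
Qed.

Lemma normc_gt0 w : (0 < normc w) = (w != 0).
Proof.
case: w => a b /=; rewrite sqrtr_gt0 lt0r addr_ge0 ?sqr_ge0 // andbT.
by rewrite paddr_eq0 ?sqr_ge0 // !sqrf_eq0 eq_complex.
Qed.

Lemma Re_div_gt0 w z : normc (z - w) < normc w -> 0 < complex.Re (z / w).
Proof.
move=> h; have w0 : 0 < normc w by apply: le_lt_trans h; case: (z - w) => a b /=; exact: sqrtr_ge0.
have w0' : w != 0 by rewrite -normc_gt0.
have -> : z / w = 1 + (z - w) / w by rewrite mulrBl divff // addrC subrK.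
have := Re_le_normc ((z - w) / w).
rewrite ComplexField.Normc.normcM ComplexField.Normc.normcV.
have : normc (z - w) / normc w < 1 by rewrite ltr_pdivrMr // mul1r.
case: ((z - w) / w) => a b /=; rewrite ler_norml => ? /andP[]; lra.
Qed.

Lemma slow_lipschitz f L m : 0 < m -> 0 < L -> (forall s, m <= normc (f s)) ->
  (forall s s', normc (f s' - f s) <= L * `|s' - s|) -> slow f (m / (2 * L)).
Proof.
move=> m0 L0 fm fL s s' ss; apply: Re_div_gt0.
apply: le_lt_trans (fL _ _) _; apply: lt_le_trans (fm s).
apply: le_lt_trans (_ : L * (m / (2 * L)) < m).
  by rewrite ler_pM2l // distrC.
rewrite (_ : L * _ = m / 2); first by rewrite ltr_pdivrMr //; lra.
by field; rewrite gt_eqF.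
Qed.

(** The lift at s adds up the increments over the mesh points truncated at s. *)
Lemma ex_lift f eta : 0 < eta -> slow f eta -> (forall s, ccont f s) ->
  exists2 th : R -> R, continuous th &
    forall s, 0 <= s <= 1 -> is_arg (f s / f 0) (th s).
Proof.
move=> e0 sl fc; have [N Ne] := ex_mesh e0.
have fn0 s : f s != 0 by apply: slow_neq0 sl; exact: ltW.
pose x s k := Num.min s (k%:R / N.+1%:R) : R.
have xlip s k : `|x s k - x s k.+1| <= eta.
  apply: le_trans Ne; have := @mesh_step N k; rewrite /x; set a := _ / _; set b := k%:R / _.
  set e := _^-1; move=> h; have e00 : 0 <= e by rewrite invr_ge0.
  by rewrite /Num.min; case: ltP => ?; case: ltP => ?; rewrite ler_norml; apply/andP; split; lra.
have xc k : continuous (fun s => x s k).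
  move=> s; apply: (@continuous_min _ _ (fun s => s) (fun=> _)); [exact: cvg_id|exact: cvg_cst].
exists (fun s => \sum_(0 <= k < N.+1) arg (f (x s k.+1) / f (x s k))).
  move=> s; apply: cvg_big => [|k _]; first exact: add_continuous.
  have fx j : ccont (fun s => f (x s j)) s.
    have [c1 c2] := fc (x s j); split.
      exact: (@continuous_comp _ _ _ (fun s => x s j) (fun s => complex.Re (f s)) s (xc j s) c1).
    exact: (@continuous_comp _ _ _ (fun s => x s j) (fun s => complex.Im (f s)) s (xc j s) c2).
  apply: (@continuous_arg (fun s => f (x s k.+1) / f (x s k))).
    by apply: ccontM => //; apply: ccontV.
  exact: sl.
move=> s /andP[s0 s1].
have := @is_arg_prod f (x s) N.+1.
have -> : x s N.+1 = s by rewrite /x divff ?pnatr_eq0 //; exact/min_idPl.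
have -> : x s 0%N = 0 by rewrite /x mul0r; exact/min_idPr.
apply => k _ //.
exact: sl.
Qed.

End Winding.

(** * Hermitian geometry of C^3 *)

Section HermitianSpace.
Variable R : realType.
Implicit Types (v w z : C3 R) (a b : R[i]).

Lemma sum3 (V : nmodType) (F : 'I_3 -> V) : \sum_j F j = F 0 + F 1 + F 2.
Proof.
rewrite !big_ord_recl big_ord0 addr0 addrA.
by congr (F _ + F _ + F _); apply: val_inj.
Qed.

(** [dot] and [om] are the real and the imaginary part of the Hermitian product
    of v and w, antilinear in v. *)
Definition dot v w : R :=
  \sum_j (v.1 ord0 j * w.1 ord0 j + v.2 ord0 j * w.2 ord0 j).
Definition om v w : R :=
  \sum_j (v.1 ord0 j * w.2 ord0 j - v.2 ord0 j * w.1 ord0 j).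
Definition cmul a v : C3 R :=
  (complex.Re a *: v.1 - complex.Im a *: v.2, complex.Re a *: v.2 + complex.Im a *: v.1).

Lemma C3_eq v w : (forall j, zcoord v j = zcoord w j) -> v = w.
Proof.
case: v w => [v1 v2] [w1 w2] H; congr (_, _); apply/rowP => j;
  by have := H j; rewrite /zcoord /= => -[].
Qed.

Lemma dotDl u v w : dot (u + v) w = dot u w + dot v w.
Proof. by rewrite /dot !sum3 /= !mxE; ring. Qed.
Lemma dotDr u v w : dot w (u + v) = dot w u + dot w v.
Proof. by rewrite /dot !sum3 /= !mxE; ring. Qed.
Lemma dotZl (k : R) v w : dot (k *: v) w = k * dot v w.
Proof. by rewrite /dot !sum3 /= !mxE; ring. Qed.
Lemma dotZr (k : R) v w : dot v (k *: w) = k * dot v w.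
Proof. by rewrite /dot !sum3 /= !mxE; ring. Qed.
Lemma dotC v w : dot v w = dot w v.
Proof. by rewrite /dot !sum3; ring. Qed.
Lemma dotNl v w : dot (- v) w = - dot v w.
Proof. by rewrite -scaleN1r dotZl mulN1r. Qed.
Lemma dotNr v w : dot v (- w) = - dot v w.
Proof. by rewrite -scaleN1r dotZr mulN1r. Qed.
Lemma omDl u v w : om (u + v) w = om u w + om v w.
Proof. by rewrite /om !sum3 /= !mxE; ring. Qed.
Lemma omDr u v w : om w (u + v) = om w u + om w v.
Proof. by rewrite /om !sum3 /= !mxE; ring. Qed.
Lemma omZl (k : R) v w : om (k *: v) w = k * om v w.
Proof. by rewrite /om !sum3 /= !mxE; ring. Qed.
Lemma omZr (k : R) v w : om v (k *: w) = k * om v w.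
Proof. by rewrite /om !sum3 /= !mxE; ring. Qed.
Lemma omC v w : om v w = - om w v.
Proof. by rewrite /om !sum3; ring. Qed.
Lemma omvv v : om v v = 0.
Proof. by rewrite /om !sum3; ring. Qed.
Lemma omNl v w : om (- v) w = - om v w.
Proof. by rewrite -scaleN1r omZl mulN1r. Qed.
Lemma omNr v w : om v (- w) = - om v w.
Proof. by rewrite -scaleN1r omZr mulN1r. Qed.
Definition omE := (omDl, omDr, omNl, omNr, omZl, omZr).

Lemma dot_ge0 v : 0 <= dot v v.
Proof. by rewrite /dot sumr_ge0 // => j _; rewrite addr_ge0 // -expr2 sqr_ge0. Qed.

Lemma zcoord_cmul a v j : zcoord (cmul a v) j = a * zcoord v j.
Proof.
rewrite /zcoord /cmul /= !mxE; case: a => a b /=.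
by apply: complex_eq; rewrite ?ReM ?ImM /=; ring.
Qed.

Lemma zcoordD v w j : zcoord (v + w) j = zcoord v j + zcoord w j.
Proof. by rewrite /zcoord /= !mxE. Qed.
Lemma zcoordB v w j : zcoord (v - w) j = zcoord v j - zcoord w j.
Proof. by rewrite /zcoord /= !mxE. Qed.
Lemma zcoordZ (k : R) v j : zcoord (k *: v) j = k%:C * zcoord v j.
Proof. by rewrite /zcoord /= !mxE; apply: complex_eq; rewrite ?ReM ?ImM /=; ring. Qed.

Lemma cmulM a b v : cmul (a * b) v = cmul a (cmul b v).
Proof. by apply: C3_eq => j; rewrite !zcoord_cmul mulrA. Qed.
Lemma cmul1 v : cmul 1 v = v.
Proof. by apply: C3_eq => j; rewrite !zcoord_cmul mul1r. Qed.
Lemma cmulD a v w : cmul a (v + w) = cmul a v + cmul a w.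
Proof. by apply: C3_eq => j; rewrite !(zcoord_cmul, zcoordD) mulrDr. Qed.
Lemma cmulZ a (k : R) v : cmul a (k *: v) = k *: cmul a v.
Proof. by apply: C3_eq => j; rewrite !(zcoord_cmul, zcoordZ); ring. Qed.

Definition sqn a : R := complex.Re a ^+ 2 + complex.Im a ^+ 2.

Lemma norm1_sqn a : `|a| = 1 <-> sqn a = 1.
Proof.
rewrite normc_def /sqn; split=> [/complexI h|->]; last by rewrite sqrtr1.
by rewrite -[LHS]sqr_sqrtr ?h ?expr1n // addr_ge0 ?sqr_ge0.
Qed.

Lemma dot_cmul a v w : dot (cmul a v) (cmul a w) = sqn a * dot v w.
Proof. by rewrite /dot /sqn /cmul !sum3 /= !mxE; ring. Qed.
Lemma om_cmul a v w : om (cmul a v) (cmul a w) = sqn a * om v w.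
Proof. by rewrite /om /sqn /cmul !sum3 /= !mxE; ring. Qed.
Lemma om_cmul_i v w : om v (cmul 'i w) = dot v w.
Proof. by rewrite /om /dot /cmul !sum3 /= !mxE; ring. Qed.
Lemma om_dot v w : om v w = dot (cmul 'i v) w.
Proof. by rewrite /om /dot /cmul !sum3 /= !mxE; ring. Qed.

Lemma omega_stdE v w : omega_std v w = om v w.
Proof.
rewrite /omega_std mulr_sumr /om !sum3 /zcoord.
set a0 := v.1 _ _; set a1 := v.1 _ _; set a2 := v.1 _ _.
set b0 := v.2 _ _; set b1 := v.2 _ _; set b2 := v.2 _ _.
set c0 := w.1 _ _; set c1 := w.1 _ _; set c2 := w.1 _ _.
set d0 := w.2 _ _; set d1 := w.2 _ _; set d2 := w.2 _ _.
have E (x : R[i]) : 'i / 2 * x = (1 / 2)%:C * ('i * x).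
  by rewrite rmorphM fmorphV rmorph1 rmorph_nat; ring.
rewrite !E; do ?rewrite raddfD /=.
by rewrite !(mul0r, mul1r, subr0, sub0r, add0r); field.
Qed.

Lemma tangent_sphereE z v : tangent_sphere z v <-> dot z v = 0.
Proof.
rewrite /tangent_sphere /dot !sum3 /=.
by split=> <-; ring.
Qed.

Lemma sphereE z : (z \in @sphere R) = (dot z z == 2).
Proof.
rewrite inE hnorm2E -[2 in LHS](rmorph_nat (real_complex R) 2) (inj_eq (@complexI R)).
by congr (_ == _); apply: eq_bigr => j _; rewrite !expr2.
Qed.

Lemma coord1_le v j : `|v.1 ord0 j| <= `|v|.
Proof.
apply: le_trans (_ : `|v.1| <= _); last by rewrite [`|v|]/Num.norm /= le_max lexx.
rewrite [X in _ <= X]/Num.norm /= mx_normrE.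
exact: (le_bigmax _ (fun ij : 'I_1 * 'I_3 => `|v.1 ij.1 ij.2|) (ord0, j)).
Qed.

Lemma coord2_le v j : `|v.2 ord0 j| <= `|v|.
Proof.
apply: le_trans (_ : `|v.2| <= _); last by rewrite [`|v|]/Num.norm /= le_max lexx orbT.
rewrite [X in _ <= X]/Num.norm /= mx_normrE.
exact: (le_bigmax _ (fun ij : 'I_1 * 'I_3 => `|v.2 ij.1 ij.2|) (ord0, j)).
Qed.

Lemma norm_le_coord v (M : R) : 0 <= M ->
  (forall j, `|v.1 ord0 j| <= M) -> (forall j, `|v.2 ord0 j| <= M) -> `|v| <= M.
Proof.
move=> M0 h1 h2; rewrite [`|v|]/Num.norm /= ge_max; apply/andP; split;
  rewrite /Num.norm /= mx_normrE; apply: bigmax_le => // -[i j] _ /=; rewrite (ord1 i).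
  exact: h1.
exact: h2.
Qed.

Lemma norm_dot_le v w : `|dot v w| <= 6 * (`|v| * `|w|).
Proof.
have H (j : 'I_3) : `|v.1 ord0 j * w.1 ord0 j + v.2 ord0 j * w.2 ord0 j| <= 2 * (`|v| * `|w|).
  apply: le_trans (ler_normD _ _) _; rewrite !normrM mulrDl mul1r.
  by apply: lerD; apply: ler_pM; rewrite // ?coord1_le ?coord2_le.
apply: le_trans (ler_norm_sum _ _ _) _; rewrite sum3.
have := H 0; have := H 1; have := H 2; lra.
Qed.

Lemma norm_om_le v w : `|om v w| <= 6 * (`|v| * `|w|).
Proof.
have H (j : 'I_3) : `|v.1 ord0 j * w.2 ord0 j - v.2 ord0 j * w.1 ord0 j| <= 2 * (`|v| * `|w|).
  apply: le_trans (ler_normB _ _) _; rewrite !normrM mulrDl mul1r.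
  by apply: lerD; apply: ler_pM; rewrite // ?coord1_le ?coord2_le.
apply: le_trans (ler_norm_sum _ _ _) _; rewrite sum3.
have := H 0; have := H 1; have := H 2; lra.
Qed.

Lemma sqr_norm_le_dot v : `|v| ^+ 2 <= dot v v.
Proof.
have H j : v.1 ord0 j ^+ 2 + v.2 ord0 j ^+ 2 <= dot v v.
  rewrite /dot (bigD1 j) //= !expr2 lerDl sumr_ge0 // => i _.
  by rewrite addr_ge0 // -expr2 sqr_ge0.
rewrite -[leRHS](sqr_sqrtr (dot_ge0 v)) ler_sqr ?nnegrE ?sqrtr_ge0 //.
apply: norm_le_coord => [|j|j]; rewrite ?sqrtr_ge0 // -sqrtr_sqr ler_wsqrtr //;
  apply: le_trans (H j); rewrite ?lerDl ?lerDr ?sqr_ge0 //.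
Qed.

Lemma dot_le_norm v : dot v v <= 6 * `|v| ^+ 2.
Proof. by rewrite expr2; apply: le_trans (norm_dot_le v v); exact: ler_norm. Qed.

Lemma sphere_norm_le z : z \in @sphere R -> `|z| <= 2.
Proof.
rewrite sphereE => /eqP h; have := sqr_norm_le_dot z; rewrite h => h2.
rewrite -(@ler_pXn2r _ 2) ?nnegrE //; apply: le_trans h2 _; lra.
Qed.

Lemma sphere_cmul a z : `|a| = 1 -> (cmul a z \in @sphere R) = (z \in @sphere R).
Proof. by move=> /norm1_sqn h; rewrite !sphereE dot_cmul h mul1r. Qed.

End HermitianSpace.

(** * Second order estimates for a symplectic flow *)

Section Flow.
Variable R : realType.
Implicit Types (v w z : C3 R) (a b : R[i]) (t : R).

Lemma is_deriveE (V W : normedModType R) (f : V -> W) (x v : V) (l : W) :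
  is_derive x v f l <-> h^-1 *: ((f \o shift x) (h *: v) - f x) @[h --> 0^'] --> l.
Proof.
split=> [[h <-] //|h]; apply: DeriveDef; first by apply/cvg_ex; exists l.
exact: cvg_lim h.
Qed.

Lemma is_derive_C3 (c : R -> C3 R) t v :
  (forall j, is_derive t 1 (fun s : R => (c s).1 ord0 j) (v.1 ord0 j)) ->
  (forall j, is_derive t 1 (fun s : R => (c s).2 ord0 j) (v.2 ord0 j)) ->
  is_derive t 1 c v.
Proof.
move=> h1 h2.
have d1 : is_derive t 1 (fun s => (c s).1) v.1.
  apply: DeriveDef.
    by apply/derivable_mxP => i j; rewrite (ord1 i); case: (h1 j).
  rewrite derive_mx; first by apply/rowP => j; rewrite mxE; case: (h1 j).
  by apply/derivable_mxP => i j; rewrite (ord1 i); case: (h1 j).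
have d2 : is_derive t 1 (fun s => (c s).2) v.2.
  apply: DeriveDef.
    by apply/derivable_mxP => i j; rewrite (ord1 i); case: (h2 j).
  rewrite derive_mx; first by apply/rowP => j; rewrite mxE; case: (h2 j).
  by apply/derivable_mxP => i j; rewrite (ord1 i); case: (h2 j).
move/is_deriveE: d1 => d1; move/is_deriveE: d2 => d2; apply/is_deriveE.
case: v {h1 h2} d1 d2 => v1 v2 /= d1 d2.
exact: (cvg_pair d1 d2).
Qed.

Lemma coord1_continuous j : continuous (fun z : C3 R => z.1 ord0 j).
Proof.
move=> z; apply: (@continuous_comp _ _ _ fst (fun M : 'rV[R]_3 => M ord0 j)).
  exact: cvg_fst.
exact: coord_continuous.
Qed.

Lemma coord2_continuous j : continuous (fun z : C3 R => z.2 ord0 j).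
Proof.
move=> z; apply: (@continuous_comp _ _ _ snd (fun M : 'rV[R]_3 => M ord0 j)).
  exact: cvg_snd.
exact: coord_continuous.
Qed.

Lemma is_derive_coord1 (c : R -> C3 R) t v j : is_derive t 1 c v ->
  is_derive t 1 (fun s : R => (c s).1 ord0 j) (v.1 ord0 j).
Proof.
move=> /is_deriveE h; apply/is_deriveE.
rewrite [X in fmap X _](_ : _ = (fun z : C3 R => z.1 ord0 j) \o
    (fun h0 : R => h0^-1 *: ((c \o shift t) (h0 *: 1) - c t))).
  exact: (continuous_cvg _ (@coord1_continuous j v) h).
by apply/funext => x; rewrite /= !mxE.
Qed.

Lemma is_derive_coord2 (c : R -> C3 R) t v j : is_derive t 1 c v ->
  is_derive t 1 (fun s : R => (c s).2 ord0 j) (v.2 ord0 j).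
Proof.
move=> /is_deriveE h; apply/is_deriveE.
rewrite [X in fmap X _](_ : _ = (fun z : C3 R => z.2 ord0 j) \o
    (fun h0 : R => h0^-1 *: ((c \o shift t) (h0 *: 1) - c t))).
  exact: (continuous_cvg _ (@coord2_continuous j v) h).
by apply/funext => x; rewrite /= !mxE.
Qed.

Lemma is_derive_dot (c d : R -> C3 R) t v w : is_derive t 1 c v -> is_derive t 1 d w ->
  is_derive t 1 (fun s : R => dot (c s) (d s)) (dot v (d t) + dot (c t) w).
Proof.
move=> hc hd.
have c1 j := is_derive_coord1 j hc.
have c2 j := is_derive_coord2 j hc.
have d1 j := is_derive_coord1 j hd.
have d2 j := is_derive_coord2 j hd.
rewrite /dot (_ : (fun s => _) = (fun s : R =>
    (c s).1 ord0 0 * (d s).1 ord0 0 + (c s).2 ord0 0 * (d s).2 ord0 0 +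
    ((c s).1 ord0 1 * (d s).1 ord0 1 + (c s).2 ord0 1 * (d s).2 ord0 1) +
    ((c s).1 ord0 2 * (d s).1 ord0 2 + (c s).2 ord0 2 * (d s).2 ord0 2))); last first.
  by apply/funext => s; rewrite sum3.
have := (c1 0, c1 1, c1 2); have := (c2 0, c2 1, c2 2).
have := (d1 0, d1 1, d1 2); have := (d2 0, d2 1, d2 2).
move=> [[? ?] ?] [[? ?] ?] [[? ?] ?] [[? ?] ?].
by apply: is_derive_eq; rewrite !sum3 /GRing.scale /=; ring.
Qed.

Lemma is_derive_om (c d : R -> C3 R) t v w : is_derive t 1 c v -> is_derive t 1 d w ->
  is_derive t 1 (fun s : R => om (c s) (d s)) (om v (d t) + om (c t) w).
Proof.
move=> hc hd.
have c1 j := is_derive_coord1 j hc.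
have c2 j := is_derive_coord2 j hc.
have d1 j := is_derive_coord1 j hd.
have d2 j := is_derive_coord2 j hd.
rewrite /om (_ : (fun s => _) = (fun s : R =>
    (c s).1 ord0 0 * (d s).2 ord0 0 - (c s).2 ord0 0 * (d s).1 ord0 0 +
    ((c s).1 ord0 1 * (d s).2 ord0 1 - (c s).2 ord0 1 * (d s).1 ord0 1) +
    ((c s).1 ord0 2 * (d s).2 ord0 2 - (c s).2 ord0 2 * (d s).1 ord0 2))); last first.
  by apply/funext => s; rewrite sum3.
have := (c1 0, c1 1, c1 2); have := (c2 0, c2 1, c2 2).
have := (d1 0, d1 1, d1 2); have := (d2 0, d2 1, d2 2).
move=> [[? ?] ?] [[? ?] ?] [[? ?] ?] [[? ?] ?].
by apply: is_derive_eq; rewrite !sum3 /GRing.scale /=; ring.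
Qed.

Lemma gronwall (f f' : R -> R) (k : R) :
  (forall t, 0 <= t <= 1 -> is_derive t 1 f (f' t)) ->
  (forall t, 0 <= t <= 1 -> f' t <= k * f t) ->
  forall t, 0 <= t <= 1 -> f t <= expR (k * t) * f 0.
Proof.
move=> fd fk t /andP[t0 t1].
pose g s := f s * expR (- k * s).
have gd (s : R) : 0 <= s <= 1 -> is_derive s 1 g ((f' s - k * f s) * expR (- k * s)).
  move=> s01; have fds := fd s s01.
  have e : is_derive s 1 (fun s : R => expR (- k * s)) (- k * expR (- k * s)).
    apply: is_derive_eq; rewrite /GRing.scale /=; ring.
  apply: is_derive_eq; rewrite /GRing.scale /=; ring.
have gle : g t <= g 0.
  apply: (@ler0_derive1_nincr _ g 0 1) => //.
  - move=> s; rewrite in_itv /= => /andP[s0 s1].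
    by have [] := gd s _; rewrite // !ltW.
  - move=> s; rewrite in_itv /= => /andP[s0 s1].
    have s01 : 0 <= s <= 1 by rewrite !ltW.
    have -> : (g^`()%classic) s = (f' s - k * f s) * expR (- k * s).
      by rewrite derive1E; apply: derive_val; exact: gd.
    by rewrite pmulr_lle0 ?expR_gt0 // subr_le0 fk.
  - apply: continuous_in_subspaceT => s; rewrite inE /= in_itv /= => s01.
    by apply: differentiable_continuous; apply/derivable1_diffP; have [] := gd s s01.
move: gle; rewrite /g mulr0 expR0 mulr1 => h.
rewrite -ler_pdivrMl ?expR_gt0 // mulrC -expRN -mulNr //.
Qed.

Lemma deriv_bound (f f' : R -> R) (M : R) :
  (forall t, 0 <= t <= 1 -> is_derive t 1 f (f' t)) ->
  (forall t, 0 <= t <= 1 -> `|f' t| <= M) ->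
  forall t, 0 <= t <= 1 -> `|f t - f 0| <= M.
Proof.
move=> fd fk t /andP[t0 t1].
have [||s] := @MVT_segment _ f f' 0 t t0.
- move=> s; rewrite in_itv /= => /andP[s0 st]; apply: fd; lra.
- apply: continuous_in_subspaceT => s; rewrite inE /= in_itv /= => /andP[s0 s1].
  apply: differentiable_continuous; apply/derivable1_diffP.
  by have [] : is_derive s 1 f (f' s) by apply: fd; lra.
rewrite in_itv /= => /andP[s0 st] ->; rewrite subr0 normrM (ger0_norm t0).
have M0 : 0 <= M by apply: le_trans (fk 0 _); rewrite ?lexx ?ler01.
have /fk : 0 <= s <= 1 by lra.
move=> h; apply: le_trans (_ : M * 1 <= _); last by rewrite mulr1.
by apply: ler_pM.
Qed.

Definition solves (X : R -> C3 R -> C3 R) (c : R -> C3 R) :=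
  forall t, 0 <= t <= 1 -> c t \in @sphere R /\ is_derive t 1 c (X t (c t)).

(** The only regularity of the field that the flow estimates use: an infinitesimally
    symplectic linear map A approximates X at p up to second order, uniformly in p.
    The equation A p = X p is Euler's identity for a field homogeneous of degree
    one, and the last clause is invariance under the circle. *)
Definition regular (X : R -> C3 R -> C3 R) (C : R) :=
  0 < C /\ forall t, 0 <= t <= 1 -> forall p, p \in @sphere R ->
  (exists A : {linear C3 R -> C3 R},
     [/\ forall v, `|A v| <= C * `|v|,
         forall v w, om (A v) w + om v (A w) = 0,
         A p = X t p &
         forall q, q \in @sphere R -> `|X t q - X t p - A (q - p)| <= C * `|q - p| ^+ 2]) /\
  forall a, `|a| = 1 -> X t (cmul a p) = cmul a (X t p).

Variables (X : R -> C3 R -> C3 R) (C : R).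
Hypothesis Xreg : regular X C.

Let C0 : 0 < C. Proof. by case: Xreg. Qed.

Lemma regular_lipschitz t p q : 0 <= t <= 1 -> p \in @sphere R -> q \in @sphere R ->
  `|X t q - X t p| <= 5 * C * `|q - p|.
Proof.
move=> t01 pS qS; have [[A [Ab _ _ AX]] _] := Xreg.2 t t01 p pS.
have := AX q qS; have := Ab (q - p).
have d4 : `|q - p| <= 4.
  by apply: le_trans (ler_normB _ _) _; have := sphere_norm_le pS; have := sphere_norm_le qS; lra.
have dd : C * `|q - p| ^+ 2 <= 4 * C * `|q - p|.
  by rewrite expr2 mulrA ler_wpM2r // mulrC ler_wpM2r // ltW.
move=> h1 h2; have -> : X t q - X t p = (X t q - X t p - A (q - p)) + A (q - p) by rewrite subrK.
apply: le_trans (ler_normD _ _) _; lra.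
Qed.

(** Gronwall's constant for the squared distance; the factor 6 compares [dot] with
    the square of the maximum norm. *)
Definition flow_factor := Num.sqrt (6 * expR (60 * C)).

Lemma flow_factor_ge1 : 1 <= flow_factor.
Proof.
rewrite -sqrtr1 ler_wsqrtr //; have := expR_gt0 (60 * C).
have : 1 <= expR (60 * C) by rewrite -expR0 ler_expR mulr_ge0 // ltW.
lra.
Qed.

Lemma flow_lipschitz p q t : solves X p -> solves X q -> 0 <= t <= 1 ->
  `|q t - p t| <= flow_factor * `|q 0 - p 0|.
Proof.
move=> sp sq t01.
pose E s := dot (q s - p s) (q s - p s).
have Ed (s : R) : 0 <= s <= 1 -> is_derive s 1 E
    (2 * dot (q s - p s) (X s (q s) - X s (p s))).
  move=> s01; have [_ dp] := sp s s01; have [_ dq] := sq s s01.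
  have dd : is_derive s 1 (fun s => q s - p s) (X s (q s) - X s (p s)) by apply: is_deriveB.
  by have := is_derive_dot dd dd => h; apply: is_derive_eq h _; rewrite dotC; ring.
have Ele s : 0 <= s <= 1 -> 2 * dot (q s - p s) (X s (q s) - X s (p s)) <= 60 * C * E s.
  move=> s01; have [pS _] := sp s s01; have [qS _] := sq s s01.
  have h1 := regular_lipschitz s01 pS qS.
  have h2 := norm_dot_le (q s - p s) (X s (q s) - X s (p s)).
  have h3 := sqr_norm_le_dot (q s - p s).
  have h4 := ler_norm (dot (q s - p s) (X s (q s) - X s (p s))).
  have h5 : `|q s - p s| * `|X s (q s) - X s (p s)| <= 5 * C * `|q s - p s| ^+ 2.
    by rewrite expr2 mulrA [leLHS]mulrC ler_wpM2r.
  have h6 : 5 * C * `|q s - p s| ^+ 2 <= 5 * C * E s.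
    by rewrite ler_wpM2l //; have := C0; lra.
  lra.
have := gronwall Ed Ele t01 => h.
have E0 := dot_ge0 (q 0 - p 0).
rewrite -(@ler_pXn2r _ 2) ?nnegrE ?mulr_ge0 ?sqrtr_ge0 //.
rewrite exprMn /flow_factor sqr_sqrtr; last by rewrite mulr_ge0 // expR_ge0.
apply: le_trans (sqr_norm_le_dot _) _; apply: le_trans h _.
apply: le_trans (_ : expR (60 * C) * E 0 <= _).
  rewrite ler_wpM2r // ler_expR; have := C0.
  by move: t01 => /andP[_ t1] c0; rewrite ler_piMr // mulr_ge0 // ltW.
rewrite mulrAC mulrC ler_wpM2r ?expR_ge0 //.
exact: dot_le_norm.
Qed.

(** Since A is infinitesimally symplectic and A p = X p, the derivative of om p q
    only sees the second order remainder of X. *)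
Lemma flow_om p q t : solves X p -> solves X q -> 0 <= t <= 1 ->
  `|om (p t) (q t) - om (p 0) (q 0)| <= 12 * C * flow_factor ^+ 2 * `|q 0 - p 0| ^+ 2.
Proof.
move=> sp sq; apply: (@deriv_bound (fun t => om (p t) (q t))
  (fun s => om (X s (p s)) (q s) + om (p s) (X s (q s)))) => s s01.
  have [_ dp] := sp s s01; have [_ dq] := sq s s01; exact: is_derive_om.
have [pS _] := sp s s01; have [qS _] := sq s s01.
have [[A [Ab Aom Ap AX]] _] := Xreg.2 s s01 _ pS.
have -> : om (X s (p s)) (q s) + om (p s) (X s (q s)) =
    om (p s) (X s (q s) - X s (p s) - A (q s - p s)).
  have h1 : om (A (p s)) (q s - p s) + om (p s) (A (q s - p s)) = 0 := Aom _ _.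
  have h2 : om (A (p s)) (p s) + om (p s) (A (p s)) = 0 := Aom _ _.
  by move: h1 h2; rewrite Ap !omE; lra.
apply: le_trans (norm_om_le _ _) _.
have h1 := AX _ qS; have h2 := flow_lipschitz sp sq s01.
have h3 : `|q s - p s| ^+ 2 <= flow_factor ^+ 2 * `|q 0 - p 0| ^+ 2.
  by rewrite -exprMn ler_pXn2r ?nnegrE ?mulr_ge0 ?sqrtr_ge0.
have h4 := sphere_norm_le pS.
have h5 : C * `|q s - p s| ^+ 2 <= C * (flow_factor ^+ 2 * `|q 0 - p 0| ^+ 2) by rewrite ler_pM2l.
have h6 : `|p s| * `|X s (q s) - X s (p s) - A (q s - p s)| <=
    2 * (C * (flow_factor ^+ 2 * `|q 0 - p 0| ^+ 2)).
  by apply: ler_pM => //; apply: le_trans h1 _.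
clear - h6; lra.
Qed.

(** The linear part A preserves [om], so that the derivative is a second order
    remainder paired with a vector of length d. *)
Lemma flow_lagrangian p q r t (d : R) : solves X p -> solves X q -> solves X r ->
  `|q 0 - p 0| <= d -> `|r 0 - p 0| <= d -> 0 <= t <= 1 ->
  `|om (q t - p t) (r t - p t) - om (q 0 - p 0) (r 0 - p 0)| <= 12 * C * flow_factor ^+ 3 * d ^+ 3.
Proof.
move=> sp sq sr qd rd.
have d0 : 0 <= d by apply: le_trans qd.
apply: (@deriv_bound (fun t => om (q t - p t) (r t - p t))
  (fun s => om (X s (q s) - X s (p s)) (r s - p s) + om (q s - p s) (X s (r s) - X s (p s)))) => s s01.
  have [_ dp] := sp s s01; have [_ dq] := sq s s01; have [_ dr] := sr s s01.
  have h1 : is_derive s 1 (fun s => q s - p s) (X s (q s) - X s (p s)) by apply: is_deriveB.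
  have h2 : is_derive s 1 (fun s => r s - p s) (X s (r s) - X s (p s)) by apply: is_deriveB.
  exact: (is_derive_om h1 h2).
have [pS _] := sp s s01; have [qS _] := sq s s01; have [rS _] := sr s s01.
have [[A [Ab Aom Ap AX]] _] := Xreg.2 s s01 _ pS.
have M0 : 0 <= flow_factor by rewrite sqrtr_ge0.
have bd x : `|x 0 - p 0| <= d -> solves X x -> `|x s - p s| <= flow_factor * d.
  by move=> xd sx; apply: le_trans (flow_lipschitz sp sx s01) _; rewrite ler_wpM2l.
have ba := bd q qd sq; have bb := bd r rd sr.
have be x : `|x 0 - p 0| <= d -> solves X x ->
    `|X s (x s) - X s (p s) - A (x s - p s)| <= C * (flow_factor * d) ^+ 2.
  move=> xd sx; apply: le_trans (AX _ (sx s s01).1) _; rewrite ler_pM2l //.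
  by rewrite ler_pXn2r ?nnegrE ?mulr_ge0 // (bd x).
have ea := be q qd sq; have eb := be r rd sr.
set e1 := X s (q s) - _ - _ in ea; set e2 := X s (r s) - _ - _ in eb.
have -> : om (X s (q s) - X s (p s)) (r s - p s) + om (q s - p s) (X s (r s) - X s (p s)) =
    om e1 (r s - p s) + om (q s - p s) e2.
  have : om (A (q s - p s)) (r s - p s) + om (q s - p s) (A (r s - p s)) = 0 by exact: Aom.
  rewrite /e1 /e2 (omDl _ (- A _)) (omDr _ (- A _)) omNl omNr; lra.
apply: le_trans (ler_normD _ _) _.
have := norm_om_le e1 (r s - p s); have := norm_om_le (q s - p s) e2.
have h1 : `|e1| * `|r s - p s| <= C * (flow_factor * d) ^+ 2 * (flow_factor * d) by exact: ler_pM.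
have h2 : `|q s - p s| * `|e2| <= flow_factor * d * (C * (flow_factor * d) ^+ 2) by exact: ler_pM.
move=> h3 h4; have -> : 12 * C * flow_factor ^+ 3 * d ^+ 3 =
    6 * (C * (flow_factor * d) ^+ 2 * (flow_factor * d)) +
    6 * (flow_factor * d * (C * (flow_factor * d) ^+ 2)) by ring.
clear - h1 h2 h3 h4; lra.
Qed.

Definition comb p q r (l m n : R) : C3 R := l *: p + m *: (q - p) + n *: (r - p).
Definition sqcomb p q r (l m n : R) : R := dot (comb p q r l m n) (comb p q r l m n).
(** Independence of p, q - p and r - p over the reals persists: their combination e
    satisfies e' = A e up to an error of order d ^ 2, and Gronwall's inequality bounds
    it from below. *)
Lemma flow_independent p q r t (d l m n : R) : solves X p -> solves X q -> solves X r ->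
  `|q 0 - p 0| <= d -> `|r 0 - p 0| <= d -> 0 <= t <= 1 ->
  expR (- (12 * C + 6)) * sqcomb (p 0) (q 0) (r 0) l m n
    - ((`|m| + `|n|) * (C * (flow_factor * d) ^+ 2)) ^+ 2 <= sqcomb (p t) (q t) (r t) l m n.
Proof.
move=> sp sq sr qd rd t01; set eta := (`|m| + `|n|) * _.
pose e s := comb (p s) (q s) (r s) l m n.
change (expR (- (12 * C + 6)) * dot (e 0) (e 0) - eta ^+ 2 <= dot (e t) (e t)).
have d0 : 0 <= d by apply: le_trans qd.
have M0 : 0 <= flow_factor by rewrite sqrtr_ge0.
pose e' s := l *: X s (p s) + m *: (X s (q s) - X s (p s)) + n *: (X s (r s) - X s (p s)).
have ed (s : R) : 0 <= s <= 1 -> is_derive s 1 e (e' s).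
  move=> s01; have [_ dp] := sp s s01; have [_ dq] := sq s s01; have [_ dr] := sr s s01.
  have h1 : is_derive s 1 (fun s => q s - p s) (X s (q s) - X s (p s)) by apply: is_deriveB.
  have h2 : is_derive s 1 (fun s => r s - p s) (X s (r s) - X s (p s)) by apply: is_deriveB.
  exact: is_deriveD.
have eta0 : 0 <= eta by rewrite mulr_ge0 ?addr_ge0 // mulr_ge0 ?sqr_ge0 // ltW.
have eb (s : R) : 0 <= s <= 1 -> `|e' s| <= C * `|e s| + eta.
  move=> s01.
  have [pS _] := sp s s01.
  have [[A [Ab Aom Ap AX]] _] := Xreg.2 s s01 _ pS.
  have be x : `|x 0 - p 0| <= d -> solves X x ->
      `|X s (x s) - X s (p s) - A (x s - p s)| <= C * (flow_factor * d) ^+ 2.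
    move=> xd sx; apply: le_trans (AX _ (sx s s01).1) _; rewrite ler_pM2l //.
    rewrite ler_pXn2r ?nnegrE ?mulr_ge0 //.
    by apply: le_trans (flow_lipschitz sp sx s01) _; rewrite ler_wpM2l.
  have ea := be q qd sq; have er := be r rd sr.
  set e1 := X s (q s) - _ - _ in ea; set e2 := X s (r s) - _ - _ in er.
  have -> : e' s = A (e s) + (m *: e1 + n *: e2).
    have -> : A (e s) = l *: A (p s) + m *: A (q s - p s) + n *: A (r s - p s).
      by rewrite /e /comb (linearD A) (linearD A); congr (_ + _ + _); exact: linearZZ.
    rewrite /e' /e1 /e2 Ap (scalerBr m (_ - _)) (scalerBr n (_ - _)).
    have Z (V : zmodType) (a0 b0 c0 b1 c1 : V) :
        a0 + b0 + c0 = a0 + b1 + c1 + ((b0 - b1) + (c0 - c1)).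
      by rewrite [RHS]addrACA -[a0 + b1 + _]addrA [b1 + _]addrC subrK [c1 + _]addrC subrK.
    exact: Z.
  apply: le_trans (ler_normD _ _) _; apply: lerD; first exact: Ab.
  apply: le_trans (ler_normD _ _) _; rewrite !normrZ /eta mulrDl.
  by apply: lerD; rewrite ler_wpM2l.
(* the shift by eta ^+ 2 absorbs the error term, so that - F obeys a linear inequality *)
pose F s := dot (e s) (e s) + eta ^+ 2.
have Fd (s : R) : 0 <= s <= 1 -> is_derive s 1 (fun s => - F s) (- (2 * dot (e s) (e' s))).
  move=> s01; have h := is_derive_dot (ed s s01) (ed s s01).
  have h' : is_derive s 1 F (2 * dot (e s) (e' s)).
    by apply: is_derive_eq; rewrite dotC; ring.
  exact: is_deriveN.
have Fle (s : R) : 0 <= s <= 1 -> - (2 * dot (e s) (e' s)) <= - (12 * C + 6) * - F s.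
  move=> s01; have h1 := eb s s01; have h2 := norm_dot_le (e s) (e' s).
  have h3 : `|e s| * `|e' s| <= `|e s| * (C * `|e s| + eta) by rewrite ler_wpM2l.
  have h4 := ler_norm (- dot (e s) (e' s)); rewrite normrN in h4.
  have h5 := sqr_norm_le_dot (e s).
  have h6 : C * `|e s| ^+ 2 <= C * dot (e s) (e s) by rewrite ler_pM2l.
  have h7 : 2 * (`|e s| * eta) <= `|e s| ^+ 2 + eta ^+ 2.
    by have := sqr_ge0 (`|e s| - eta); rewrite sqrrB; lra.
  have h8 : 0 <= C * eta ^+ 2 by rewrite mulr_ge0 ?sqr_ge0 // ltW.
  have h9 : `|e s| * (C * `|e s| + eta) = C * `|e s| ^+ 2 + `|e s| * eta by ring.
  rewrite h9 in h3; rewrite /F.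
  have -> : - (12 * C + 6) * - (dot (e s) (e s) + eta ^+ 2) =
   12 * (C * dot (e s) (e s)) + 6 * dot (e s) (e s) + 12 * (C * eta ^+ 2) + 6 * eta ^+ 2 by ring.
  clear - h2 h3 h4 h5 h6 h7 h8; lra.
have := gronwall Fd Fle t01.
have /andP[t0 t1] := t01.
have F0 : 0 <= F 0 by rewrite addr_ge0 ?dot_ge0 ?sqr_ge0.
have : expR (- (12 * C + 6)) * F 0 <= expR (- (12 * C + 6) * t) * F 0.
  rewrite ler_wpM2r // ler_expR mulNr lerN2 ler_piMr //; have := C0; lra.
have : 0 <= expR (- (12 * C + 6)) * eta ^+ 2 by rewrite mulr_ge0 ?expR_ge0 ?sqr_ge0.
rewrite /F mulrDr mulrN; lra.
Qed.

End Flow.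

(** * Approximate Lagrangian frames and their determinants *)

Section Triple.
Variable R : realType.
Implicit Types (p q r v w z : C3 R) (a b c : R[i]) (d K k l m n : R).
Local Notation normc := ComplexField.Normc.normc.

(** Finite differences in place of a Lagrangian frame: at scale d the vectors q - p
    and r - p replace tangent vectors of length d. The forms that vanish on a
    horizontal Lagrangian frame are smaller than their generic size by one factor d,
    and the last clause is quantitative independence over the reals. *)
Definition triple K k d p q r :=
  [/\ `|q - p| <= K * d, `|r - p| <= K * d,
      `|om p q| <= K * d ^+ 2, `|om p r| <= K * d ^+ 2 &
      `|om (q - p) (r - p)| <= K * d ^+ 3] /\
  forall l m n, k * (l ^+ 2 + d ^+ 2 * (m ^+ 2 + n ^+ 2)) <= sqcomb p q r l m n.

Lemma triple_flow X C K k : regular X C -> 0 < K -> 0 < k ->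
  exists K' k' d1 : R, [/\ 0 < K', 0 < k', 0 < d1 &
    forall d, 0 < d -> d <= d1 -> forall p q r : R -> C3 R,
      solves X p -> solves X q -> solves X r ->
      triple K k d (p 0) (q 0) (r 0) ->
      forall t, 0 <= t <= 1 -> triple K' k' d (p t) (q t) (r t)].
Proof.
move=> Xreg K0 k0; have C0 : 0 < C := Xreg.1.
have M0 : 0 < flow_factor C by apply: lt_le_trans (flow_factor_ge1 Xreg).
set M := flow_factor C in M0 *; set E := expR (- (12 * C + 6)).
have E0 : 0 < E by exact: expR_gt0.
set B := C * (M * K) ^+ 2.
have B0 : 0 < B by rewrite mulr_gt0 // exprn_gt0 // mulr_gt0.
have P1 : 0 < M * K by exact: mulr_gt0.
have P2 : 0 < 12 * C * M ^+ 2 * K ^+ 2 by rewrite !mulr_gt0 // exprn_gt0.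
have P3 : 0 < 12 * C * M ^+ 3 * K ^+ 3 by rewrite !mulr_gt0 // exprn_gt0.
exists (K + M * K + 12 * C * M ^+ 2 * K ^+ 2 + 12 * C * M ^+ 3 * K ^+ 3), (E * k / 2),
  (Num.sqrt (E * k) / (2 * B)).
set K' := (K + _ + _ + _).
split; [by rewrite !addr_gt0|by rewrite divr_gt0 ?mulr_gt0|
  by rewrite divr_gt0 ?mulr_gt0 // sqrtr_gt0 mulr_gt0|].
move=> d d0 dd1 p q r sp sq sr [[qp rp opq opr oqr] ind] t t01.
have d20 : 0 <= d ^+ 2 by exact: sqr_ge0.
have d30 : 0 <= d ^+ 3 by rewrite exprn_ge0 // ltW.
have lip x : solves X x -> `|x 0 - p 0| <= K * d -> `|x t - p t| <= K' * d.
  move=> sx xp; apply: le_trans (flow_lipschitz Xreg sp sx t01) _.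
  apply: le_trans (_ : M * (K * d) <= _); first by rewrite ler_pM2l.
  by rewrite mulrA ler_pM2r // /K'; clear - P1 P2 P3 K0; lra.
have oml x : solves X x -> `|x 0 - p 0| <= K * d -> `|om (p 0) (x 0)| <= K * d ^+ 2 ->
    `|om (p t) (x t)| <= K' * d ^+ 2.
  move=> sx xp ox; have h := flow_om Xreg sp sx t01.
  rewrite -(subrK (om (p 0) (x 0)) (om (p t) (x t))).
  apply: le_trans (ler_normD _ _) _.
  apply: le_trans (lerD h ox) _.
  apply: le_trans (_ : 12 * C * M ^+ 2 * (K * d) ^+ 2 + K * d ^+ 2 <= _).
    rewrite lerD2r -/M ler_pM2l ?mulr_gt0 ?exprn_gt0 // ler_pXn2r ?nnegrE //.
    by rewrite mulr_ge0 // ltW.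
  by rewrite exprMn mulrA -mulrDl ler_wpM2r // /K'; clear - P1 P2 P3 K0; lra.
split; first split.
- exact: lip.
- exact: lip.
- exact: oml.
- exact: oml.
- have h := flow_lagrangian Xreg sp sq sr qp rp t01.
  rewrite -(subrK (om (q 0 - p 0) (r 0 - p 0)) (om (q t - p t) _)).
  apply: le_trans (ler_normD _ _) _; apply: le_trans (lerD h oqr) _.
  by rewrite -/M exprMn mulrA -mulrDl ler_wpM2r // /K'; clear - P1 P2 P3 K0; lra.
move=> l m n; apply: le_trans (flow_independent Xreg l m n sp sq sr qp rp t01).
rewrite -/M -/E.
have h1 := ind l m n.
have h2 : E * (k * (l ^+ 2 + d ^+ 2 * (m ^+ 2 + n ^+ 2))) <= E * sqcomb (p 0) (q 0) (r 0) l m n.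
  by rewrite ler_pM2l.
have h3 : (`|m| + `|n|) ^+ 2 <= 2 * (m ^+ 2 + n ^+ 2).
  have e (x : R) : `|x| ^+ 2 = x ^+ 2 by rewrite -normrX ger0_norm ?sqr_ge0.
  by have := sqr_ge0 (`|m| - `|n|); rewrite sqrrB sqrrD !e; lra.
have h4 : (d * (2 * B)) ^+ 2 <= E * k.
  rewrite -[leRHS](@sqr_sqrtr _ (E * k)); last by rewrite ltW // mulr_gt0.
  rewrite ler_pXn2r ?nnegrE ?sqrtr_ge0 //; last by rewrite ltW // !mulr_gt0.
  by rewrite -ler_pdivlMr // mulr_gt0.
have h5 : ((`|m| + `|n|) * (C * (M * (K * d)) ^+ 2)) ^+ 2 <= E * k / 2 * (d ^+ 2 * (m ^+ 2 + n ^+ 2)).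
  have -> : ((`|m| + `|n|) * (C * (M * (K * d)) ^+ 2)) ^+ 2 =
     (`|m| + `|n|) ^+ 2 * ((d * (2 * B)) ^+ 2 / 4 * d ^+ 2) by rewrite /B; field.
  have -> : E * k / 2 * (d ^+ 2 * (m ^+ 2 + n ^+ 2)) =
     2 * (m ^+ 2 + n ^+ 2) * (E * k / 4 * d ^+ 2) by field.
  apply: ler_pM => //; rewrite ?sqr_ge0 //.
    by rewrite mulr_ge0 // divr_ge0 // sqr_ge0.
  by rewrite ler_wpM2r // ler_wpM2r.
have h6 : 0 <= E * k / 2 * l ^+ 2 by rewrite mulr_ge0 ?sqr_ge0 // divr_ge0 // ltW // mulr_gt0.
apply: le_trans (lerB h2 h5).
have -> : E * k / 2 * (l ^+ 2 + d ^+ 2 * (m ^+ 2 + n ^+ 2)) =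
  E * (k * (l ^+ 2 + d ^+ 2 * (m ^+ 2 + n ^+ 2))) - E * k / 2 * (d ^+ 2 * (m ^+ 2 + n ^+ 2))
   - E * k / 2 * l ^+ 2 by field.
by rewrite gerBl.
Qed.

Definition det3 p q r : R[i] :=
  zcoord p 0 * (zcoord q 1 * zcoord r 2 - zcoord q 2 * zcoord r 1)
  - zcoord p 1 * (zcoord q 0 * zcoord r 2 - zcoord q 2 * zcoord r 0)
  + zcoord p 2 * (zcoord q 0 * zcoord r 1 - zcoord q 1 * zcoord r 0).

Lemma det3_cmul a p q r : det3 (cmul a p) (cmul a q) (cmul a r) = a ^+ 3 * det3 p q r.
Proof. by rewrite /det3 !zcoord_cmul; ring. Qed.

Lemma sqnM a b : sqn (a * b) = sqn a * sqn b.
Proof. by rewrite /sqn ReM ImM; ring. Qed.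
Lemma sqnN a : sqn (- a) = sqn a.
Proof. by case: a => x y; rewrite /sqn /= !sqrrN. Qed.
Lemma sqn_ge0 a : 0 <= sqn a.
Proof. by rewrite addr_ge0 ?sqr_ge0. Qed.
Lemma sqn0 : sqn (0 : R[i]) = 0.
Proof. by rewrite /sqn /= expr0n addr0. Qed.

Lemma dot_sqn v : dot v v = sqn (zcoord v 0) + sqn (zcoord v 1) + sqn (zcoord v 2).
Proof. by rewrite /dot sum3 /sqn /=; ring. Qed.

Definition ccomb p q r a b c := cmul a p + cmul b (q - p) + cmul c (r - p).

Lemma dot_addi v w : dot (v + cmul 'i w) (v + cmul 'i w) = dot v v + dot w w + 2 * om w v.
Proof.
have s1 : sqn ('i%C : R[i]) = 1 by rewrite /sqn /= expr0n expr1n add0r.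
by rewrite dotDl !dotDr dot_cmul s1 mul1r (dotC v (cmul _ _)) -om_dot; ring.
Qed.

(** A real subspace on which [om] vanishes is totally real. Here [om] is only small
    on the span of p, q - p and r - p, and the defect is absorbed when d <= k / (4 K). *)
Lemma complex_independent K k d p q r a b c : 0 < K -> 0 < k -> 0 < d -> d <= k / (4 * K) ->
  triple K k d p q r ->
  k / 2 * (sqn a + d ^+ 2 * (sqn b + sqn c)) <= dot (ccomb p q r a b c) (ccomb p q r a b c).
Proof.
move=> K0 k0 d0 dk [[qp rp opq opr oqr] ind].
case: a b c => [l l'] [m m'] [n n'].
set S := l ^+ 2 + d ^+ 2 * (m ^+ 2 + n ^+ 2).
set S' := l' ^+ 2 + d ^+ 2 * (m' ^+ 2 + n' ^+ 2).
have -> : sqn (l +i* l') + d ^+ 2 * (sqn (m +i* m') + sqn (n +i* n')) = S + S'.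
  by rewrite /S /S' /sqn /=; ring.
have -> : ccomb p q r (l +i* l') (m +i* m') (n +i* n') =
    comb p q r l m n + cmul 'i (comb p q r l' m' n').
  apply: C3_eq => j; rewrite /ccomb /comb !(zcoordD, zcoord_cmul, zcoordZ).
  have E (x y : R) : x +i* y = x%:C + 'i%C * y%:C by exact: complexE.
  by rewrite (E l) (E m) (E n); ring.
have i1 := ind l m n; have i2 := ind l' m' n'; rewrite -/S -/S' /sqcomb in i1 i2.
set e := comb _ _ _ l m n in i1 *; set e' := comb _ _ _ l' m' n' in i2 *.
have -> : dot (e + cmul 'i e') (e + cmul 'i e') = dot e e + dot e' e' + 2 * om e' e.
  exact: dot_addi.
have o1 : om p (q - p) = om p q by rewrite omDr omNr omvv subr0.
have o2 : om p (r - p) = om p r by rewrite omDr omNr omvv subr0.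
have oE : om e' e = (l' * m - l * m') * om p q + (l' * n - l * n') * om p r
    + (m' * n - m * n') * om (q - p) (r - p).
  rewrite -o1 -o2 /e /e' /comb.
  move: (q - p) (r - p) => u v; rewrite !omE (omC u p) (omC v p) (omC v u) !omvv; ring.
have SS (x y z : R) : 0 <= x ^+ 2 + d ^+ 2 * (y ^+ 2 + z ^+ 2).
  by apply: addr_ge0; rewrite ?sqr_ge0 //; apply: mulr_ge0; rewrite ?sqr_ge0 // addr_ge0 ?sqr_ge0.
have S0 : 0 <= S by exact: SS.
have S'0 : 0 <= S' by exact: SS.
have ob : `|om e' e| <= K * d * (S + S').
  have N (x y x' y' : R) : `|x' * y - x * y'| <= (x ^+ 2 + x' ^+ 2 + y ^+ 2 + y' ^+ 2) / 2.
    rewrite ler_norml; apply/andP.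
    have := sqr_ge0 (x' - y); have := sqr_ge0 (x' + y).
    have := sqr_ge0 (x - y'); have := sqr_ge0 (x + y'); rewrite !sqrrB !sqrrD; split; lra.
  have T (x y x' y' w u : R) : 0 < u -> `|w| <= K * d * u ->
     `|(x' * y - x * y') * w| <= K * d * ((x ^+ 2 + x' ^+ 2 + y ^+ 2 + y' ^+ 2) / 2 * u).
    move=> u0 wu; rewrite normrM mulrCA; apply: ler_pM => //.
  rewrite oE.
  have E1 : (l' * m - l * m') * om p q = (l' * (d * m) - l * (d * m')) * (om p q / d).
    by field; rewrite gt_eqF.
  have E2 : (l' * n - l * n') * om p r = (l' * (d * n) - l * (d * n')) * (om p r / d).
    by field; rewrite gt_eqF.
  have E3 : (m' * n - m * n') * om (q - p) (r - p) =
      ((d * m') * (d * n) - (d * m) * (d * n')) * (om (q - p) (r - p) / d ^+ 2).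
    by field; rewrite gt_eqF.
  rewrite E1 E2 E3.
  have dd (x : R) e1 : `|x| <= K * d ^+ e1.+1 -> `|x / d ^+ e1| <= K * d * 1.
    move=> h; rewrite normrM normfV (ger0_norm (exprn_ge0 _ (ltW d0))) mulr1.
    by rewrite ler_pdivrMr ?exprn_gt0 // -mulrA -exprS.
  have t1 := T l (d * m) l' (d * m') _ 1 ltr01 (dd _ 1%N opq).
  have t2 := T l (d * n) l' (d * n') _ 1 ltr01 (dd _ 1%N opr).
  have t3 := T (d * m) (d * n) (d * m') (d * n') _ 1 ltr01 (dd _ 2%N oqr).
  rewrite expr1 in t1 t2.
  apply: le_trans (ler_normD _ _) _; apply: le_trans (lerD (ler_normD _ _) (lexx _)) _.
  apply: le_trans (lerD (lerD t1 t2) t3) _.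
  by rewrite le_eqVlt; apply/orP; left; apply/eqP; rewrite /S /S'; field.
have dk' : K * d * (S + S') <= k / 4 * (S + S').
  rewrite ler_wpM2r //; first exact: addr_ge0.
  by move: dk; rewrite ler_pdivlMr ?mulr_gt0 // => h; lra.
move: ob; rewrite ler_norml => /andP[ob _].
have kS : k / 2 * (S + S') = k * S + k * S' - 2 * (k / 4 * (S + S')) by field.
rewrite kS; clear - i1 i2 ob dk'; lra.
Qed.

(** With cross products as coefficients, a combination of p, q - p and r - p has a
    single nonzero coordinate, which is the determinant; [complex_independent] bounds
    it from below by a minor, and applied to p and q - p alone it bounds the minors. *)
Lemma det3_lower K k d p q r : 0 < K -> 0 < k -> 0 < d -> d <= k / (4 * K) ->
  p \in @sphere R -> triple K k d p q r ->
  k ^+ 2 * d ^+ 4 <= 18 * sqn (det3 p q r).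
Proof.
move=> K0 k0 d0 dk pS tr.
have ind a b c := complex_independent a b c K0 k0 d0 dk tr.
have kd : 0 < k / 2 * d ^+ 2 by rewrite mulr_gt0 ?divr_gt0 ?exprn_gt0.
pose x j := zcoord p j; pose y j := zcoord q j - zcoord p j; pose z j := zcoord r j - zcoord p j.
pose cr (u v : 'I_3 -> R[i]) i j := u i * v j - u j * v i.
have D0 : sqn (det3 p q r) = sqn (x 0 * cr y z 1 2 - x 1 * cr y z 0 2 + x 2 * cr y z 0 1).
  by congr sqn; rewrite /det3 /x /cr /y /z; ring.
set D := det3 p q r in D0 *.
have L a b c : k / 2 * d ^+ 2 * sqn c <= dot (ccomb p q r a b c) (ccomb p q r a b c).
  apply: le_trans (ind a b c); rewrite -mulrA ler_pM2l ?divr_gt0 //.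
  have := sqn_ge0 a; have := mulr_ge0 (sqr_ge0 d) (sqn_ge0 b); rewrite (mulrDr _ (sqn b)); lra.
have L' a b c : k / 2 * d ^+ 2 * sqn b <= dot (ccomb p q r a b c) (ccomb p q r a b c).
  apply: le_trans (ind a b c); rewrite -mulrA ler_pM2l ?divr_gt0 //.
  have := sqn_ge0 a; have := mulr_ge0 (sqr_ge0 d) (sqn_ge0 c); rewrite (mulrDr _ (sqn b)); lra.
have Z a b c j : zcoord (ccomb p q r a b c) j = a * x j + b * y j + c * z j.
  by rewrite /ccomb !zcoordD !zcoord_cmul !zcoordB.
have s0 (u : R[i]) : u = 0 -> sqn u = 0 by move=> ->; exact: sqn0.
have c0 := L (cr y z 1 2) (cr z x 1 2) (cr x y 1 2).
have c1 := L (cr y z 2 0) (cr z x 2 0) (cr x y 2 0).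
have c2 := L (cr y z 0 1) (cr z x 0 1) (cr x y 0 1).
have DE (u v w : R[i]) e : sqn e = sqn D -> (u = e /\ v = 0 /\ w = 0) \/ (v = e /\ u = 0 /\ w = 0)
   \/ (w = e /\ u = 0 /\ v = 0) -> sqn u + sqn v + sqn w = sqn D.
  by move=> eD [[-> [-> ->]]|[[-> [-> ->]]|[-> [-> ->]]]]; rewrite !sqn0 eD ?addr0 ?add0r.
rewrite dot_sqn !Z (DE _ _ _ _ (esym D0)) in c0; last first.
  by left; rewrite /cr; split; [|split]; ring.
rewrite dot_sqn !Z (DE _ _ _ _ (esym D0)) in c1; last first.
  by right; left; rewrite /cr; split; [|split]; ring.
rewrite dot_sqn !Z (DE _ _ _ _ (esym D0)) in c2; last first.
  by right; right; rewrite /cr; split; [|split]; ring.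
have e0 := L' (- y 0) (x 0) 0; have e1 := L' (- y 1) (x 1) 0; have e2 := L' (- y 2) (x 2) 0.
rewrite dot_sqn !Z in e0; rewrite dot_sqn !Z in e1; rewrite dot_sqn !Z in e2.
have F i j : - y i * x j + x i * y j + 0 * z j = cr x y i j by rewrite /cr; ring.
rewrite !F in e0; rewrite !F in e1; rewrite !F in e2.
have G i j : sqn (cr x y i j) = sqn (cr x y j i).
  by rewrite -sqnN; congr sqn; rewrite /cr; ring.
have H i : sqn (cr x y i i) = 0 by apply: s0; rewrite /cr; ring.
rewrite H in e0; rewrite H (G 1 0) in e1; rewrite H (G 2 0) (G 2 1) in e2; rewrite (G 2 0) in c1.
have pS2 : sqn (x 0) + sqn (x 1) + sqn (x 2) = 2.
  by rewrite -dot_sqn; apply/eqP; rewrite -sphereE.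
set A := sqn (cr x y 0 1) in c2 e0 e1 e2; set B := sqn (cr x y 0 2) in c1 e0 e1 e2.
set Cc := sqn (cr x y 1 2) in c0 e0 e1 e2.
set h := k / 2 * d ^+ 2 in kd c0 c1 c2 e0 e1 e2 *.
have [D1 A0] : 0 <= sqn D /\ 0 < h by split=> //; exact: sqn_ge0.
have -> : k ^+ 2 * d ^+ 4 = 4 * (h * h) by rewrite /h; field.
move: c0 c1 c2 e0 e1 e2 pS2 D1; clearbody A B Cc h; clear - A0.
move: (sqn (x 0)) (sqn (x 1)) (sqn (x 2)) (sqn D) => X0 X1 X2 Y c0 c1 c2 e0 e1 e2 pS2 Y0.
have s0 : h * 2 = h * X0 + h * X1 + h * X2 by rewrite -pS2; ring.
have s1 : h * 2 <= 2 * (A + B + Cc) by rewrite s0; lra.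
have s2 : h * (A + B + Cc) <= 3 * Y by rewrite !mulrDr; lra.
have s3 : h * h <= h * (A + B + Cc) by rewrite ler_pM2l //; lra.
lra.
Qed.

End Triple.

(** * Calculus of functions of class C^k *)

Section Calculus.
Variable R : realType.
Implicit Types (V W : normedModType R).

Lemma near_eq_differentiable V W (f g : V -> W) (x : V) :
  {near x, f =1 g} -> differentiable f x -> differentiable g x.
Proof.
move=> fg df; have [dc E] := (diff_locallyP x f).1 df.
have fgx : f x = g x by exact: nbhs_singleton fg.
have H : g \o shift x = cst (g x) + 'd f x +o_0 id.
  apply/eqaddoP => _/posnumP[e].
  move/eqaddoP : E => /(_ _ [gt0 of e%:num]) h.
  have fg' : \forall y \near (0 : V), f (y + x) = g (y + x).
    have : \forall y \near (0 + x), f y = g y by rewrite add0r.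
    by move/nbhs0P => h'; near=> y; rewrite addrC; near: y; rewrite add0r in h'.
  near=> y.
  have fy : f (y + x) = g (y + x) by near: y.
  have hy : `|(f \o shift x - (cst (f x) + 'd f x)) y| <= e%:num * `|y| by near: y; exact: h.
  move: hy; rewrite -[(f \o shift x - _) y]/(f (y + x) - (f x + 'd f x y)).
  by rewrite -[(g \o shift x - _) y]/(g (y + x) - (g x + 'd f x y)) fy fgx.
have dE := diff_unique dc H.
by apply/diff_locallyP; rewrite dE.
Unshelve. all: by end_near.
Qed.

Lemma C_on_ext V W (k : nat) (U : set V) (f g : V -> W) : open U ->
  (forall x, U x -> f x = g x) -> C_on k U f -> C_on k U g.
Proof.
move=> oU; elim: k f g => [|k IH] f g fg /=.
  move=> H x Ux; have := H x Ux; rewrite /prop_for /continuous_at -fg //.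
  apply: cvg_trans; apply: near_eq_cvg; near=> y; apply: fg.
  by near: y; exact: open_nbhs_nbhs.
have nearfg x : U x -> {near x, f =1 g}.
  by move=> Ux; near=> y; apply: fg; near: y; exact: open_nbhs_nbhs.
move=> [df H]; split=> [x Ux|v].
  by apply: near_eq_differentiable (df x Ux); exact: nearfg.
by apply: (IH ('D_v f)) => // x Ux; apply: near_eq_derive; exact: nearfg.
Unshelve. all: by end_near.
Qed.

Lemma C_onS V W (k : nat) (U : set V) (f : V -> W) : C_on k.+1 U f -> C_on k U f.
Proof.
elim: k f => [|k IH] f; first by move=> [df _] x /df; exact: differentiable_continuous.
by move=> [df H]; split=> // v; apply: IH; exact: H.
Qed.

Lemma C_on_cst V W (k : nat) (U : set V) (a : W) : C_on k U (fun=> a).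
Proof.
elim: k a => [|k IH] a; first by move=> x _; exact: cvg_cst.
split=> [x _|v]; first exact: differentiable_cst.
rewrite (_ : 'D_v (fun=> a) = (fun=> 0)); first exact: IH.
by apply/funext => x; exact: (derive_cst a x v).
Qed.

Lemma C_onD V W (k : nat) (U : set V) (f g : V -> W) : open U ->
  C_on k U f -> C_on k U g -> C_on k U (fun x => f x + g x).
Proof.
move=> oU; elim: k f g => [|k IH] f g.
  by move=> hf hg x Ux; apply: continuousD; [exact: hf|exact: hg].
move=> [df hf] [dg hg]; split=> [x Ux|v].
  by apply: differentiableD; [exact: df|exact: dg].
apply: (C_on_ext oU _ (IH _ _ (hf v) (hg v))) => x Ux.
by rewrite deriveD //; apply: diff_derivable; [exact: df|exact: dg].
Qed.

Lemma C_onM V (k : nat) (U : set V) (f g : V -> R^o) : open U ->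
  C_on k U f -> C_on k U g -> C_on k U (fun x => f x * g x : R^o).
Proof.
move=> oU; elim: k f g => [|k IH] f g.
  by move=> hf hg x Ux; apply: continuousM; [exact: hf|exact: hg].
move=> hf' hg'; move: (hf') (hg') => [df hf] [dg hg]; split=> [x Ux|v].
  by apply: differentiableM; [exact: df|exact: dg].
have h1 := IH _ _ (C_onS hf') (hg v); have h2 := IH _ _ (C_onS hg') (hf v).
apply: (C_on_ext oU _ (C_onD oU h1 h2)) => x Ux.
by rewrite deriveM //; apply: diff_derivable; [exact: df|exact: dg].
Qed.

Lemma C_on_linear V W (k : nat) (U : set V) (f : {linear V -> W}) : continuous f -> C_on k U f.
Proof.
move=> fc; have df x : differentiable f x by exact: linear_differentiable.
case: k => [|k]; first by move=> x _; exact: fc.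
split=> [x _|v]; first exact: df.
rewrite (_ : 'D_v f = (fun=> f v)); first exact: C_on_cst.
by apply/funext => x; rewrite deriveE // diff_lin.
Qed.

Lemma derive_affine V V' W (g : V' -> W) (S : V -> V') (x v : V) (v' : V') :
  (forall h : R, S (h *: v + x) = h *: v' + S x) ->
  'D_v (g \o S) x = 'D_v' g (S x).
Proof. move=> hS; rewrite /derive.
rewrite (_ : (fun h : R => h^-1 *: (((g \o S) \o shift x) (h *: v) - (g \o S) x)) =
  (fun h : R => h^-1 *: ((g \o shift (S x)) (h *: v') - g (S x)))) //.
by apply/funext => h /=; rewrite hS. Qed.

Lemma is_derive_line V W (g : V -> W) (x v : V) (a : R) : derivable g (a *: v + x) v ->
  is_derive a 1 (fun s : R => g (s *: v + x)) ('D_v g (a *: v + x)).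
Proof.
move=> /derivableP /is_deriveE h; apply/is_deriveE.
rewrite [X in fmap X _](_ : _ = (fun h : R => h^-1 *: ((g \o shift (a *: v + x)) (h *: v) - g (a *: v + x)))) //.
by apply/funext => k /=; rewrite [k *: 1]mulr1 scalerDl addrA.
Qed.

Lemma mvt_line V (g : V -> R^o) (x v : V) (b : R) : 0 < b ->
  (forall s : R, 0 <= s <= b -> derivable g (s *: v + x) v) ->
  exists2 s : R, 0 <= s <= b & g (b *: v + x) - g x = 'D_v g (s *: v + x) * b.
Proof.
move=> b0 hd.
pose f (s : R) := g (s *: v + x) : R.
have hf (s : R) : 0 <= s <= b -> is_derive s 1 f ('D_v g (s *: v + x)).
  by move=> s0; apply: is_derive_line; exact: hd.
have [||s] := @MVT_segment _ f (fun s => 'D_v g (s *: v + x)) 0 b (ltW b0).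
- move=> s; rewrite in_itv /= => /andP[s0 sb]; apply: hf; lra.
- apply: continuous_in_subspaceT => s; rewrite inE /= in_itv /= => s0.
  by apply: differentiable_continuous; apply/derivable1_diffP; case: (hf s s0).
rewrite in_itv /= => s0; rewrite /f scale0r add0r subr0 => E; exists s => //.
Qed.

(** The left-hand side is symmetric in v and w, which yields the symmetry of
    second derivatives. *)
Lemma second_difference V (g : V -> R^o) (x v w : V) (b : R) : 0 < b ->
  (forall s r : R, 0 <= s <= b -> 0 <= r <= b -> differentiable g (s *: v + (r *: w + x)) /\
      differentiable ('D_v g) (s *: v + (r *: w + x))) ->
  exists s r : R, [/\ 0 <= s <= b, 0 <= r <= b &
   g (b *: v + (b *: w + x)) - g (b *: v + x) - (g (b *: w + x) - g x)
     = 'D_w ('D_v g) (s *: v + (r *: w + x)) * b ^+ 2].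
Proof.
move=> b0 hd.
have z0 : 0 <= (0 : R) <= b by rewrite lexx ltW.
have bb : 0 <= b <= b by rewrite lexx ltW.
pose f y := g ((b *: w) + y) - g y : R^o.
have Sw y (h : R) : b *: w + (h *: v + y) = h *: v + (b *: w + y) by rewrite addrCA.
have df (s : R) : 0 <= s <= b -> is_derive (s *: v + x) v f
    ('D_v g (s *: v + (b *: w + x)) - 'D_v g (s *: v + x)).
  move=> sb; have [d1 _] := hd s b sb bb; have [d2 _] := hd s 0 sb z0.
  rewrite scale0r add0r in d2.
  have E : 'D_v g (s *: v + (b *: w + x)) = 'D_v (g \o (fun y => b *: w + y)) (s *: v + x).
    by rewrite -Sw; apply/esym; apply: derive_affine => h; exact: Sw.
  rewrite E; apply: is_deriveB; last by apply/derivableP; exact: diff_derivable.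
  apply/derivableP; apply/diff_derivable.
  apply: (@differentiable_comp _ _ _ _ (fun y => b *: w + y) g); last by rewrite Sw.
  by apply: differentiableD.
have [|s sb Es] := @mvt_line _ f x v b b0.
  by move=> s sb; case: (df s sb).
have [|r rb Er] := @mvt_line _ ('D_v g) (s *: v + x) w b b0.
  move=> r rb; have [_ d2] := hd s r sb rb.
  by rewrite addrCA; exact: diff_derivable.
exists s, r; split=> //.
have := Es; rewrite /f (derive_val (is_derive := df s sb)).
rewrite addrCA in Er.
rewrite Sw => ->.
by rewrite Er (addrCA (r *: w)) expr2 mulrA.
Qed.

Lemma ball_close2 V (U : set V) (F G : V -> R^o) (x : V) (e : R) : open U -> U x ->
  {for x, continuous F} -> {for x, continuous G} -> 0 < e ->
  exists2 r : R, 0 < r & forall y, ball x r y -> [/\ U y, `|F x - F y| < e & `|G x - G y| < e].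
Proof.
move=> oU Ux Fc Gc e0.
have n1 : \forall y \near x, U y by exact: open_nbhs_nbhs.
have n2 : \forall y \near x, `|F x - F y| < e by move/cvgrPdist_lt : Fc; apply.
have n3 : \forall y \near x, `|G x - G y| < e by move/cvgrPdist_lt : Gc; apply.
have N : \forall y \near x, [/\ U y, `|F x - F y| < e & `|G x - G y| < e].
  by apply: filterS3 n1 n2 n3 => y u1 u2 u3; split.
by have [r /= r0 rb] := (nbhs_ballP _ _).1 N; exists r.
Qed.

(** Both mixed derivatives equal the same second difference quotient at points as
    close to x as desired, and they are continuous. *)
Lemma derive_comm V (U : set V) (g : V -> R^o) (x v w : V) : open U -> C_on 2 U g -> U x ->
  'D_v ('D_w g) x = 'D_w ('D_v g) x.
Proof.
move=> oU [dg hg] Ux.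
have [dv hv] := hg v; have [dw hw] := hg w.
have cvw : {for x, continuous ('D_w ('D_v g))} by exact: (hv w).
have cwv : {for x, continuous ('D_v ('D_w g))} by exact: (hw v).
apply/eqP; rewrite -subr_eq0 -normr_le0; apply/ler_addgt0Pr => e e0; rewrite add0r.
have e20 : 0 < e / 2 by rewrite divr_gt0.
have [r r0 rb] := ball_close2 oU Ux cvw cwv e20.
pose b := r / (2 * (`|v| + `|w| + 1)).
have vw0 : 0 < `|v| + `|w| + 1 by rewrite ltr_wpDl // addr_ge0.
have b0 : 0 < b by rewrite divr_gt0 // mulr_gt0.
have inb (s t : R) : 0 <= s <= b -> 0 <= t <= b -> ball x r (s *: v + (t *: w + x)).
  move=> /andP[s0 sb] /andP[t0 tb]; rewrite -ball_normE /ball_ /= addrA opprD addrCA subrr addr0 normrN.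
  apply: le_lt_trans (ler_normD _ _) _; rewrite !normrZ !ger0_norm //.
  apply: le_lt_trans (lerD (ler_wpM2r (normr_ge0 v) sb) (ler_wpM2r (normr_ge0 w) tb)) _.
  rewrite -mulrDr; apply: le_lt_trans (_ : b * (`|v| + `|w| + 1) < r).
    by rewrite ler_pM2l // lerDl.
  have -> : b * (`|v| + `|w| + 1) = r / 2 by rewrite /b; field; rewrite gt_eqF.
  lra.
have inb' (s t : R) : 0 <= s <= b -> 0 <= t <= b -> ball x r (s *: w + (t *: v + x)).
  by move=> hs ht; rewrite addrCA; exact: inb.
have [|s1 [t1 [hs1 ht1 E1]]] := @second_difference V g x v w b b0.
  move=> s t hs ht; have [Uy _ _] := rb _ (inb s t hs ht); split; [exact: dg|exact: dv].
have [|s2 [t2 [hs2 ht2 E2]]] := @second_difference V g x w v b b0.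
  by move=> s t hs ht; have [Uy _ _] := rb _ (inb' s t hs ht); split; [exact: dg|exact: dw].
have E : 'D_w ('D_v g) (s1 *: v + (t1 *: w + x)) = 'D_v ('D_w g) (s2 *: w + (t2 *: v + x)).
  have T (a c G1 G2 : R) : G1 = G2 -> G1 = a * b ^+ 2 -> G2 = c * b ^+ 2 -> a = c.
    by move=> <- -> /(mulIf (expf_neq0 2 (lt0r_neq0 b0))).
  have S4 (a1 a2 a3 a4 : R) : a1 - a2 - (a3 - a4) = a1 - a3 - (a2 - a4) by ring.
  by apply: T E1 E2; rewrite (addrCA (b *: w)); exact: S4.
have [_ h1 _] := rb _ (inb s1 t1 hs1 ht1).
have [_ _ h2] := rb _ (inb' s2 t2 hs2 ht2).
have T (a c a' c' : R) : a' = c' -> `|a - a'| < e / 2 -> `|c - c'| < e / 2 -> `|c - a| <= e.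
  move=> -> k1 k2; have -> : c - a = (c - c') - (a - c') by rewrite opprB addrA subrK.
  by apply: le_trans (ler_normB _ _) _; clear - k1 k2; lra.
exact: T E h1 h2.
Qed.

Lemma taylor_line V (g : V -> R^o) (x v : V) (M : R) :
  (forall s : R, 0 <= s <= 1 -> differentiable g (s *: v + x) /\
      differentiable ('D_v g) (s *: v + x)) ->
  (forall s : R, 0 <= s <= 1 -> `|'D_v ('D_v g) (s *: v + x)| <= M) ->
  `|g (v + x) - g x - 'D_v g x| <= M.
Proof.
move=> hd hM.
have M0 : 0 <= M by apply: le_trans (hM 0 _); rewrite ?lexx ?ler01.
have [|s s01 Es] := @mvt_line _ g x v 1 ltr01.
  by move=> s s01; apply: diff_derivable; case: (hd s s01).
rewrite scale1r mulr1 in Es; rewrite Es.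
move: (s01) => /andP[s0 s1]; move: s0; rewrite le_eqVlt => /orP[/eqP <-|s0].
  by rewrite scale0r add0r subrr normr0.
have [|r /andP[r0 rs] Er] := @mvt_line _ ('D_v g) x v s s0.
  move=> r /andP[r0 rs]; apply: diff_derivable; have [] // := hd r _.
  by rewrite r0 (le_trans rs).
rewrite Er normrM (gtr0_norm s0) -[M]mulr1; apply: ler_pM => //; first exact: ltW.
by apply: hM; rewrite r0 (le_trans rs).
Qed.

End Calculus.

(** * Bounds near the sphere *)

Section Annulus.
Variable R : realType.
Local Notation V := (R^o * C3 R)%type.
Implicit Types (v w z p q : C3 R) (t : R) (x y : V).

Definition punctured : set V := [set tz | tz.2 != 0].

Lemma open_punctured : open punctured.
Proof.
rewrite (_ : punctured = snd @^-1` [set z : C3 R | z != 0]) //.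
apply: open_comp; first by move=> x _; exact: cvg_snd.
rewrite (_ : [set z : C3 R | z != 0] = ~` [set 0]); last by apply/seteqP; split=> z /= /eqP.
apply: closed_openC; apply: accessible_closed_set1; apply: hausdorff_accessible; exact: norm_hausdorff.
Qed.

Definition tcoord1 (j : 'I_3) (x : V) : R^o := x.2.1 ord0 j.
Definition tcoord2 (j : 'I_3) (x : V) : R^o := x.2.2 ord0 j.
Lemma tcoord1_linear j : linear (tcoord1 j).
Proof. by move=> a x y; rewrite /tcoord1 /= !mxE. Qed.
Lemma tcoord2_linear j : linear (tcoord2 j).
Proof. by move=> a x y; rewrite /tcoord2 /= !mxE. Qed.
HB.instance Definition _ j := GRing.isLinear.Build R V R^o *:%R (tcoord1 j) (tcoord1_linear j).
HB.instance Definition _ j := GRing.isLinear.Build R V R^o *:%R (tcoord2 j) (tcoord2_linear j).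
Lemma tcoord1_continuous j : continuous (tcoord1 j).
Proof.
move=> x; apply: (@continuous_comp _ _ _ snd (fun z : C3 R => z.1 ord0 j)); first exact: cvg_snd.
exact: coord1_continuous.
Qed.
Lemma tcoord2_continuous j : continuous (tcoord2 j).
Proof.
move=> x; apply: (@continuous_comp _ _ _ snd (fun z : C3 R => z.2 ord0 j)); first exact: cvg_snd.
exact: coord2_continuous.
Qed.

(** A direction of R x C^3 that leaves the time fixed. *)
Definition sp v : V := (0, v).

(** The real basis of C^3; the boolean is true for the real axes. *)
Definition be (b : bool * 'I_3) : C3 R :=
  if b.1 then (delta_mx ord0 b.2, 0) else (0, delta_mx ord0 b.2).

Lemma sp_expand v : sp v = \sum_j (v.1 ord0 j *: sp (be (true, j)) + v.2 ord0 j *: sp (be (false, j))).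
Proof.
rewrite sum3 [LHS]surjective_pairing [RHS]surjective_pairing /=; congr (_, _).
  by rewrite !scaler0 !addr0.
rewrite [LHS]surjective_pairing [RHS]surjective_pairing /=; congr (_, _);
apply/rowP => k; rewrite !mxE /=;
by case: k => [[|[|[|k]]] hk] //=; rewrite ?(mulr0, mulr1, addr0, add0r); congr (_ _ _); apply: val_inj.
Qed.

Lemma derive_expand (g : V -> R^o) x v : differentiable g x ->
  'D_(sp v) g x = \sum_j (v.1 ord0 j * 'D_(sp (be (true, j))) g x
                           + v.2 ord0 j * 'D_(sp (be (false, j))) g x).
Proof.
move=> dg; rewrite deriveE // {1}sp_expand linear_sum; apply: eq_bigr => j _.
by rewrite linearD !linearZ /= -!deriveE.
Qed.

Lemma derive_bound (g : V -> R^o) x v (M : R) : differentiable g x -> 0 <= M ->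
  (forall b, `|'D_(sp (be b)) g x| <= M) -> `|'D_(sp v) g x| <= 6 * M * `|v|.
Proof.
move=> dg M0 hM; rewrite derive_expand //.
have H (j : 'I_3) : `|v.1 ord0 j * 'D_(sp (be (true, j))) g x
   + v.2 ord0 j * 'D_(sp (be (false, j))) g x| <= 2 * (`|v| * M).
  have T (a b c d n : R) : `|a| <= n -> `|b| <= n -> `|c| <= M -> `|d| <= M ->
      `|a * c + b * d| <= 2 * (n * M).
    move=> h1 h2 h3 h4; apply: le_trans (ler_normD _ _) _; rewrite !normrM mulrDl mul1r.
    by apply: lerD; apply: ler_pM.
  by apply: T; rewrite ?coord1_le ?coord2_le ?hM.
apply: le_trans (ler_norm_sum _ _ _) _; rewrite sum3.
have T (a b c n : R) : a <= 2 * (n * M) -> b <= 2 * (n * M) -> c <= 2 * (n * M) -> a + b + c <= 6 * M * n by lra.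
by apply: T.
Qed.

(** A compact set that contains [0, 1] x S^5 together with all short segments
    issuing from it. *)
Definition annulus : set V := [set x | 0 <= x.1 <= 1 /\ 1 / 4 <= `|x.2| <= 4].

Lemma compact_annulus : compact annulus.
Proof.
pose B : set 'rV[R]_3 := [set r | `|r| <= 4].
have Bc : compact B.
  apply: bounded_closed_compact.
    by exists 4; split; [exact: num_real|move=> M M4 r /= h; exact: le_trans h (ltW M4)].
  rewrite (_ : B = (fun r => `|r|) @^-1` [set s : R | s <= 4]) //.
  by apply: closed_comp; [move=> r _; exact: norm_continuous|exact: closed_le].
have c1 : compact (`[0, 1]%classic : set R^o) by exact: segment_compact.
have := compact_setX c1 (compact_setX Bc Bc).
have cl : closed [set x : V | 1 / 4 <= `|x.2|].
  rewrite (_ : [set x : V | _] = (fun x : V => `|x.2|) @^-1` [set s : R | 1 / 4 <= s]) //.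
  apply: closed_comp; last exact: closed_ge.
  move=> x _; apply: (@continuous_comp _ _ _ snd (fun z : C3 R => `|z|)); first exact: cvg_snd.
  exact: norm_continuous.
move=> /compact_closedI /(_ cl); congr compact; apply/seteqP; split => -[t z] /=.
  move=> [[t01 [z1 z2]] z4]; split; first by move: t01; rewrite in_itv.
  by rewrite z4 /= [`|z|]/Num.norm /= ge_max; apply/andP.
move=> [t01 /andP[z4 zl]]; split=> //; split; first by rewrite in_itv.
by move: zl; rewrite [`|z|]/Num.norm /= ge_max => /andP[].
Qed.

Lemma annulus_punctured x : annulus x -> punctured x.
Proof.
move=> [_ /andP[h _]]; rewrite /punctured /=; apply/eqP => z0.
by move: h; rewrite z0 normr0; lra.
Qed.

Lemma annulus_bound (I : finType) (g : I -> V -> R^o) :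
  (forall i x, punctured x -> {for x, continuous (g i)}) ->
  exists2 M : R, 0 < M & forall i x, annulus x -> `|g i x| <= M.
Proof.
move=> gc; pose phi (x : V) : R := \sum_i `|g i x|.
have [A0|/set0P A0] := eqVneq annulus set0.
  by exists 1 => // i x; rewrite A0.
have [|c cA cm] := @compact_EVT_max _ _ phi _ A0 compact_annulus.
  apply: continuous_in_subspaceT => x; rewrite inE => xA.
  apply: cvg_big => [|i _]; first exact: add_continuous.
  apply: (@continuous_comp _ _ _ (g i) (fun y : R^o => `|y|)); last exact: norm_continuous.
  by apply: gc; exact: annulus_punctured.
exists (phi c + 1) => [|i x xA].
  by rewrite ltr_wpDl // sumr_ge0.
apply: le_trans (_ : phi x <= _).
  by rewrite /phi (bigD1 i) //= lerDl sumr_ge0.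
have := cm x _; rewrite inE => /(_ xA); lra.
Qed.

End Annulus.

(** * The Hamiltonian vector field on the sphere *)

Section SmoothHamiltonian.
Variable R : realType.
Local Notation V := (R^o * C3 R)%type.
Implicit Types (v w z p q : C3 R) (t : R) (x y : V).

Lemma hprojZ (a : R) z : 0 < a -> hproj (a *: z) = hproj z.
Proof.
move=> a0; rewrite /hproj.
suff -> : Num.sqrt (2 / complex.Re (hnorm2 (a *: z))) *: (a *: z) =
  Num.sqrt (2 / complex.Re (hnorm2 z)) *: z by [].
have -> : complex.Re (hnorm2 (a *: z)) = a ^+ 2 * complex.Re (hnorm2 z).
  by rewrite hnorm2Z ReM /= mul0r subr0.
rewrite invfM mulrCA sqrtrM ?invr_ge0 ?sqr_ge0 // sqrtrV ?sqr_ge0 // sqrtr_sqr gtr0_norm //.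
by rewrite scalerA mulrAC mulVf ?mul1r // gt_eqF.
Qed.

Lemma hproj_cmul (a : R[i]) z : z != 0 -> `|a| = 1 -> hproj (cmul a z) = hproj z.
Proof.
move=> z0 a1; have n0 := hnorm2_gt0 z0.
have s0 : 0 < Num.sqrt (2 / complex.Re (hnorm2 z)) by rewrite sqrtr_gt0 divr_gt0.
rewrite -(hprojZ z s0) -(hprojZ (cmul a z) s0) -cmulZ; symmetry.
apply/hproj_eq; first exact: normalize_sphere.
  by rewrite sphere_cmul // normalize_sphere.
by exists a => // j; rewrite zcoord_cmul.
Qed.

Lemma om_inj v w : (forall u, om v u = om w u) -> v = w.
Proof.
move=> h; have : dot (v - w) (v - w) = 0.
  have E u1 u2 : dot u1 u2 = om u1 (cmul 'i u2) by rewrite om_cmul_i.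
  by rewrite dotDl dotNl !E !h subrr.
have := sqr_norm_le_dot (v - w) => /[swap] -> h0.
have : `|v - w| ^+ 2 = 0 by apply/eqP; rewrite eq_le h0 sqr_ge0.
by move=> /eqP; rewrite sqrf_eq0 normr_eq0 subr_eq0 => /eqP.
Qed.

(** The vector that represents, through [om], the linear form with values phi on the
    real basis. *)
Definition grad (phi : bool * 'I_3 -> R) : C3 R :=
  (\row_j phi (false, j), \row_j - phi (true, j)).

Lemma om_grad (phi : bool * 'I_3 -> R) w :
  om (grad phi) w = \sum_j (w.1 ord0 j * phi (true, j) + w.2 ord0 j * phi (false, j)).
Proof. by rewrite /om; apply: eq_bigr => j _; rewrite /= !mxE; ring. Qed.

Lemma gradD (phi psi : bool * 'I_3 -> R) : grad (phi \+ psi) = grad phi + grad psi.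
Proof.
rewrite [LHS]surjective_pairing [RHS]surjective_pairing /=; congr (_, _);
  by apply/rowP => j; rewrite !mxE // opprD.
Qed.

Lemma gradZ a (phi : bool * 'I_3 -> R) : grad (a \*o phi) = a *: grad phi.
Proof.
rewrite [LHS]surjective_pairing [RHS]surjective_pairing /=; congr (_, _);
  by apply/rowP => j; rewrite !mxE // mulrN.
Qed.

Lemma norm_grad_le (phi : bool * 'I_3 -> R) (M : R) : 0 <= M ->
  (forall b, `|phi b| <= M) -> `|grad phi| <= M.
Proof. by move=> M0 h; apply: norm_le_coord => // j; rewrite /= mxE ?normrN. Qed.

Lemma sphere_neq0 z : z \in @sphere R -> z != 0.
Proof.
rewrite sphereE; apply: contraL => /eqP ->.
have -> : (0 : C3 R) = 0 *: 0 by rewrite scale0r.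
by rewrite dotZl mul0r eq_sym pnatr_eq0.
Qed.

Lemma sp_shift (h : R) w t z : h *: sp w + ((t, z) : V) = (t, h *: w + z).
Proof. by rewrite [LHS]surjective_pairing /=; congr (_, _); rewrite scaler0 add0r. Qed.

Lemma near_punctured x : punctured x -> \forall y \near x, punctured y.
Proof. by move=> Px; exact: (open_nbhs_nbhs (conj (@open_punctured R) Px)). Qed.

Variable H : R -> CP2 R -> R.
Hypothesis Hs : smooth_hamiltonian H.

Definition hfun x : R^o := H x.1 (hproj x.2).
Definition qfun x : R^o := 1 / 2 * dot x.2 x.2.
(** The extension of the Hamiltonian to C^3 \ 0 as a function homogeneous of degree
    two and invariant under the circle: its Hamiltonian vector field on C^3 is then
    homogeneous of degree one, tangent to the sphere, and lifts the field of H. *)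
Definition Kfun x : R^o := qfun x * hfun x.

Lemma qfun_smooth k : C_on k (@punctured R) qfun.
Proof.
have oP := @open_punctured R.
have c1 j : C_on k (@punctured R) (fun x => tcoord1 j x * tcoord1 j x : R^o).
  by apply: C_onM => //; apply: C_on_linear; exact: tcoord1_continuous.
have c2 j : C_on k (@punctured R) (fun x => tcoord2 j x * tcoord2 j x : R^o).
  by apply: C_onM => //; apply: C_on_linear; exact: tcoord2_continuous.
have c j := C_onD oP (c1 j) (c2 j).
have cs := C_onD oP (C_onD oP (c 0) (c 1)) (c 2).
have ch := C_onM oP (@C_on_cst R V R^o k (@punctured R) (1 / 2)) cs.
by apply: C_on_ext ch => // x _; rewrite /qfun /dot sum3.
Qed.

Lemma Kfun_smooth k : C_on k (@punctured R) Kfun.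
Proof. by apply: C_onM; [exact: open_punctured|exact: qfun_smooth|exact: Hs]. Qed.

Definition Gfun w : V -> R^o := 'D_(sp w) Kfun.

Lemma Kfun_diff x : punctured x -> differentiable Kfun x.
Proof. by move=> Px; have [d _] := Kfun_smooth 1; exact: d. Qed.
Lemma Gfun_smooth k w : C_on k (@punctured R) (Gfun w).
Proof. by have [_ d] := Kfun_smooth k.+1; exact: d. Qed.
Lemma Gfun_diff w x : punctured x -> differentiable (Gfun w) x.
Proof. by move=> Px; have [d _] := Gfun_smooth 1 w; exact: d. Qed.
Lemma DGfun_diff w v x : punctured x -> differentiable ('D_(sp v) (Gfun w)) x.
Proof. by move=> Px; have [_ d] := Gfun_smooth 2 w; have [d' _] := d (sp v); exact: d'. Qed.

Lemma Gfun_cont w x : punctured x -> {for x, continuous (Gfun w)}.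
Proof. by move=> Px; have := Gfun_smooth 0 w; apply. Qed.
Lemma DGfun_cont v w x : punctured x -> {for x, continuous ('D_(sp v) (Gfun w))}.
Proof. by move=> Px; have [_ h] := Gfun_smooth 1 w; exact: h. Qed.
Lemma DDGfun_cont u v w x : punctured x -> {for x, continuous ('D_(sp u) ('D_(sp v) (Gfun w)))}.
Proof. by move=> Px; have [_ h] := Gfun_smooth 2 w; have [_ h'] := h (sp v); exact: h'. Qed.

Lemma hessian_sym v w x : punctured x -> 'D_(sp v) (Gfun w) x = 'D_(sp w) (Gfun v) x.
Proof. by move=> Px; exact: (derive_comm _ _ (@open_punctured R) (Kfun_smooth 2) Px). Qed.

Definition Xfun t z : C3 R := grad (fun b => Gfun (be R b) (t, z)).

Lemma om_Xfun t z w : z != 0 -> om (Xfun t z) w = Gfun w (t, z).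
Proof.
move=> z0; rewrite om_grad.
by rewrite /Gfun (derive_expand w (Kfun_diff _)).
Qed.

(** For w tangent to the sphere the last term vanishes: on such vectors the field of K
    satisfies the equation that defines Hamiltonian lifts. *)
Lemma Xfun_lift t z w : z \in @sphere R ->
  om (Xfun t z) w = 'D_w (fun z' => H t (hproj z') : R^o) z + H t (hproj z) * dot z w.
Proof.
move=> zS; have z0 := sphere_neq0 zS; rewrite om_Xfun //.
have Px : punctured ((t, z) : V) by [].
have dq : differentiable qfun (t, z) by have [d _] := qfun_smooth 1; exact: d.
have dh : differentiable hfun (t, z) by have [d _] := Hs 1; exact: d.
rewrite /Gfun deriveM; [|exact: diff_derivable|exact: diff_derivable].
have -> : 'D_(sp w) hfun (t, z) = 'D_w (fun z' => H t (hproj z') : R^o) z.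
  have := @derive_affine R _ _ _ hfun (fun z' : C3 R => ((t : R^o), z') : V) z w (sp w).
  by move=> <- // h; rewrite sp_shift.
have -> : 'D_(sp w) qfun (t, z) = dot z w.
  have d0 : derivable qfun (0 *: sp w + (t, z)) (sp w) by rewrite scale0r add0r; exact: diff_derivable.
  have := is_derive_line d0; rewrite scale0r add0r => -[_ <-].
  have dz : is_derive (0 : R) 1 (fun s : R => s *: w + z) w.
    have di : derivable (@id (C3 R)) (0 *: w + z) w by exact: derivable_id.
    by have := is_derive_line di; rewrite derive_id.
  have dd := is_derive_dot dz dz; rewrite scale0r add0r in dd.
  have -> : (fun s : R => qfun (s *: sp w + (t, z))) =
      (fun s : R => (1 / 2) *: (dot (s *: w + z) (s *: w + z) : R^o)) by [].
  have := is_deriveZ (1 / 2) dd => -[_ ->].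
  by rewrite /GRing.scale /= (dotC w); field.
have -> : qfun (t, z) = 1.
  by rewrite /qfun /=; move: zS; rewrite sphereE => /eqP ->; rewrite divfK ?pnatr_eq0.
by rewrite scale1r.
Qed.

Lemma Xfun_om_continuous (c : R -> C3 R) t w : (forall s, c s \in @sphere R) ->
  {for t, continuous c} -> {for t, continuous (fun s => om (Xfun s (c s)) w)}.
Proof.
move=> cS ct.
have -> : (fun s => om (Xfun s (c s)) w) = (Gfun w) \o (fun s : R^o => (s, c s) : V).
  by apply/funext => s; rewrite om_Xfun //; exact: sphere_neq0.
have h : {for (t : R^o), continuous (fun s : R^o => (s, c s) : V)}.
  exact: (@cvg_pair _ _ _ (nbhs t) (nbhs (t : R^o)) (nbhs (c t)) _ _ _ (fun s => s) c cvg_id ct).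
have Px : punctured ((t, c t) : V) := sphere_neq0 (cS t).
exact: (@continuous_comp _ _ _ (fun s : R^o => (s, c s) : V) (Gfun w) t h (@Gfun_cont w _ Px)).
Qed.

Lemma Gfun_hom w t z (a : R) : z != 0 -> 0 < a -> Gfun w (t, a *: z) = a * Gfun w (t, z).
Proof.
move=> z0 a0; pose S (x : V) : V := (x.1, a *: x.2).
have az0 : a *: z != 0 by rewrite scaler_eq0 negb_or gt_eqF.
have h1 : 'D_(sp w) (Kfun \o S) (t, z) = a * Gfun w (t, a *: z).
  rewrite (@derive_affine R _ _ _ Kfun S (t, z) (sp w) (a *: sp w)); last first.
    move=> h; rewrite sp_shift /S /= [RHS]surjective_pairing /=; congr (_, _).
      by rewrite !scaler0 add0r.
    by rewrite scalerDr !scalerA mulrC.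
  by rewrite /Gfun !deriveE; [rewrite linearZ|exact: Kfun_diff|exact: Kfun_diff].
have h2 : 'D_(sp w) (Kfun \o S) (t, z) = a ^+ 2 * Gfun w (t, z).
  have E x : (Kfun \o S) x = (a ^+ 2 *: Kfun x).
    rewrite /= /Kfun /qfun /hfun /S /= hprojZ // dotZl dotZr /GRing.scale /=; ring.
  rewrite (_ : Kfun \o S = (a ^+ 2) \*: Kfun); last by apply/funext => x; exact: E.
  by rewrite deriveZ //; apply: diff_derivable; exact: Kfun_diff.
apply: (mulfI (lt0r_neq0 a0)); rewrite -h1 h2; ring.
Qed.

Lemma Gfun_euler w t z : z != 0 -> 'D_(sp z) (Gfun w) (t, z) = Gfun w (t, z).
Proof.
move=> z0; have Px : punctured ((t, z) : V) by [].
have d0 : derivable (Gfun w) (0 *: sp z + (t, z)) (sp z).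
  by rewrite scale0r add0r; apply: diff_derivable; exact: Gfun_diff.
have := is_derive_line d0; rewrite scale0r add0r => -[_ <-].
have N : \forall s \near (0 : R), (1 + s) * Gfun w (t, z) = Gfun w (s *: sp z + (t, z)).
  have : \forall s \near (0 : R), `|s| < 1 / 2 by apply: nbhs0_lt; lra.
  apply: filterS => s; rewrite ltr_norml => /andP[s1 s2].
  have s0 : 0 < 1 + s by clear - s1; lra.
  by rewrite -(Gfun_hom w t z0 s0) sp_shift scalerDl scale1r addrC.
rewrite -(near_eq_derive _ N).
have D : is_derive (0 : R) 1 (fun s : R => (1 + s) * Gfun w (t, z)) (Gfun w (t, z)).
  by apply: is_derive_eq; rewrite /GRing.scale /=; ring.
exact: derive_val.
Qed.

Lemma Gfun_equivariant w t z (a : R[i]) : z != 0 -> `|a| = 1 ->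
  Gfun (cmul a w) (t, cmul a z) = Gfun w (t, z).
Proof.
move=> z0 a1; pose S (x : V) : V := (x.1, cmul a x.2).
have az0 : cmul a z != 0.
  apply: contraNN z0 => /eqP h; apply/eqP.
  have a0 : a != 0 by rewrite -normr_gt0 a1.
  rewrite -(cmul1 z) -(mulVf a0) cmulM h; apply: C3_eq => j.
  by rewrite zcoord_cmul /zcoord /= !mxE /= mulr0.
have h1 : 'D_(sp w) (Kfun \o S) (t, z) = Gfun (cmul a w) (t, cmul a z).
  rewrite (@derive_affine R _ _ _ Kfun S (t, z) (sp w) (sp (cmul a w))) // => h.
  have -> : S (t, z) = ((t, cmul a z) : V) by [].
  by rewrite !sp_shift /S /= cmulD cmulZ.
have s1 : sqn a = 1 := (norm1_sqn a).1 a1.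
have KS x : punctured x -> Kfun (S x) = Kfun x.
  move=> xP; rewrite /Kfun /qfun /hfun /S /= (hproj_cmul xP a1).
  by rewrite dot_cmul s1 (mul1r (dot _ _)).
have Px : punctured ((t, z) : V) by [].
rewrite -h1; apply: near_eq_derive.
exact: (@filterS _ (nbhs ((t, z) : V)) _ _ _ KS (near_punctured Px)).
Qed.

Lemma sphere_norm_ge z : z \in @sphere R -> 1 / 2 <= `|z|.
Proof.
rewrite sphereE => /eqP h; have := dot_le_norm z; rewrite h => h2.
rewrite leNgt; apply/negP => h3.
have : `|z| ^+ 2 < (1 / 2) ^+ 2 by rewrite ltr_pXn2r ?nnegrE //; lra.
lra.
Qed.

Lemma annulus_near_sphere t p h (s : R) : 0 <= t <= 1 -> p \in @sphere R -> `|h| <= 1 / 4 ->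
  0 <= s <= 1 -> annulus ((t, s *: h + p) : V).
Proof.
move=> t01 pS h4 /andP[s0 s1]; split=> //=.
have h5 : `|s *: h| <= 1 / 4.
  rewrite normrZ ger0_norm // -[leRHS]mul1r; exact: ler_pM.
have := sphere_norm_ge pS; have := sphere_norm_le pS => p2 p1.
apply/andP; split; last by apply: le_trans (ler_normD _ _) _; lra.
have := ler_normB (s *: h + p) (s *: h); rewrite addrAC subrr add0r; lra.
Qed.

Definition DG v w x : R := 'D_(sp v) (Gfun w) x.
(** The differential of [Xfun] at p; it is infinitesimally symplectic because the
    Hessian of K is symmetric. *)
Definition Afun t p v : C3 R := grad (fun b => DG v (be R b) (t, p)).

Lemma DG_sym v w x : punctured x -> DG v w x = DG w v x.
Proof. exact: hessian_sym. Qed.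

Lemma DG_linear a v w u x : punctured x -> DG (a *: v + w) u x = a * DG v u x + DG w u x.
Proof.
move=> Px; have d := Gfun_diff u Px; rewrite /DG !deriveE //.
rewrite -[a * _]/(a *: _) -linearP; congr ('d _ _ _).
by rewrite [RHS]surjective_pairing /sp /=; congr (_, _); rewrite scaler0 addr0.
Qed.

Lemma DG_expand v w x : punctured x -> DG w v x =
  \sum_j (w.1 ord0 j * DG (be R (true, j)) v x + w.2 ord0 j * DG (be R (false, j)) v x).
Proof. by move=> Px; exact: (derive_expand w (Gfun_diff v Px)). Qed.

Lemma DG_euler w t z : z != 0 -> DG z w (t, z) = Gfun w (t, z).
Proof. exact: Gfun_euler. Qed.

Opaque DG Gfun.

Lemma Afun_linear t p : p != 0 -> linear (Afun t p).
Proof.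
move=> p0 a v w; have Px : punctured ((t, p) : V) by [].
rewrite /Afun -gradZ -gradD; congr grad; apply/funext => b.
exact: DG_linear.
Qed.

Lemma om_Afun t p v w : p != 0 -> om (Afun t p v) w = DG v w (t, p).
Proof.
move=> p0; have Px : punctured ((t, p) : V) by [].
rewrite om_grad (DG_sym v w Px) (DG_expand v w Px); apply: eq_bigr => j _.
by rewrite !(DG_sym v _ Px).
Qed.

Lemma DG_bound : exists2 M : R, 0 < M &
  [/\ forall b x, annulus x -> `|Gfun (be R b) x| <= M,
      forall v b x, annulus x -> `|DG v (be R b) x| <= M * `|v| &
      forall t p h b, 0 <= t <= 1 -> p \in @sphere R -> `|h| <= 1 / 4 ->
        `|Gfun (be R b) (t, h + p) - Gfun (be R b) (t, p) - DG h (be R b) (t, p)| <= M * `|h| ^+ 2].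
Proof.
have [N1 N10 B1] := @annulus_bound R _ (fun b => Gfun (be R b))
  (fun b => @Gfun_cont (be R b)).
have [N2 N20 B2] := @annulus_bound R _ (fun b : (bool * 'I_3) * (bool * 'I_3) =>
    'D_(sp (be R b.1)) (Gfun (be R b.2)))
  (fun b => @DGfun_cont (be R b.1) (be R b.2)).
have [N3 N30 B3] := @annulus_bound R _ (fun b : (bool * 'I_3) * (bool * 'I_3) * (bool * 'I_3) =>
    'D_(sp (be R b.1.1)) ('D_(sp (be R b.1.2)) (Gfun (be R b.2))))
  (fun b => @DDGfun_cont (be R b.1.1) (be R b.1.2) (be R b.2)).
pose M := N1 + 6 * N2 + 36 * N3.
have M0 : 0 < M by rewrite !addr_gt0 ?mulr_gt0.
exists M => //; split.
- move=> b x xA; apply: le_trans (B1 b x xA) _; rewrite /M; clear - N20 N30; lra.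
- move=> v b x xA.
  have := derive_bound v (Gfun_diff (be R b) (annulus_punctured xA)) (ltW N20) (fun b' => B2 (b', b) x xA).
  move=> h; apply: le_trans h _; rewrite ler_wpM2r // /M; clear - N10 N30; lra.
move=> t p h b t01 pS h4.
apply: le_trans (_ : 36 * N3 * `|h| ^+ 2 <= _); last first.
  by rewrite ler_wpM2r ?sqr_ge0 // /M; clear - N10 N20; lra.
have E : (t, h + p) = sp h + ((t, p) : V).
  by have := sp_shift 1 h t p; rewrite !scale1r.
have inA s : 0 <= s <= 1 -> annulus (s *: sp h + ((t, p) : V)).
  by rewrite sp_shift; exact: annulus_near_sphere.
rewrite E; apply: taylor_line => s s01; have As := inA s s01; have Ps := annulus_punctured As.
  by split; [exact: Gfun_diff|exact: DGfun_diff].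
have bb b' : `|'D_(sp (be R b')) ('D_(sp h) (Gfun (be R b))) (s *: sp h + ((t, p) : V))|
    <= 6 * N3 * `|h|.
  rewrite (derive_comm _ _ (@open_punctured R) (Gfun_smooth 2 _) Ps).
  apply: derive_bound (DGfun_diff _ _ Ps) (ltW N30) _ => b''; exact: (B3 (b'', b', b) _ As).
have N30' : 0 <= 6 * N3 * `|h| by rewrite !mulr_ge0 // ltW.
have := derive_bound h (DGfun_diff _ _ Ps) N30' bb.
by have -> : 6 * (6 * N3 * `|h|) * `|h| = 36 * N3 * `|h| ^+ 2 by ring.
Qed.

(** Taylor's formula inside the annulus gives the remainder for q near p; for the
    other q the distance is bounded below and any bound on the field suffices. *)
Lemma regular_Xfun : exists C, regular Xfun C.
Proof.
have [M M0 [B1 B2 B3]] := DG_bound.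
pose C := 100 * M.
have C0 : 0 < C by rewrite mulr_gt0.
exists C; split=> // t t01 p pS; have p0 := sphere_neq0 pS; have Px : punctured ((t, p) : V) by [].
have onS q : q \in @sphere R -> annulus ((t, q) : V).
  move=> qS; have z4 : `|0 : C3 R| <= 1 / 4 by rewrite normr0 divr_ge0.
  have z1 : 0 <= (0 : R) <= 1 by rewrite lexx ler01.
  by have := annulus_near_sphere t01 qS z4 z1; rewrite scaler0 add0r.
split; last first.
  move=> a a1; apply: om_inj => u.
  have a0 : a != 0 by rewrite -normr_gt0 a1.
  have az0 : cmul a p != 0 by apply: sphere_neq0; rewrite sphere_cmul.
  have -> : u = cmul a (cmul a^-1 u) by rewrite -cmulM mulfV // cmul1.
  by rewrite om_Xfun // Gfun_equivariant // om_cmul (norm1_sqn _).1 // mul1r om_Xfun.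
pose A := HB.pack_for {linear C3 R -> C3 R} (Afun t p)
  (GRing.isLinear.Build _ _ _ _ (Afun t p) (Afun_linear t p0)).
exists A; split.
- move=> v; apply: norm_grad_le; first by rewrite mulr_ge0 // ltW.
  move=> b; apply: le_trans (B2 v b _ (onS p pS)) _.
  by rewrite ler_wpM2r // /C; clear - M0; lra.
- by move=> v w; rewrite om_Afun // omC om_Afun // (DG_sym v w Px) subrr.
- by apply: om_inj => u; rewrite om_Afun // om_Xfun // DG_euler.
move=> q qS.
have -> : Xfun t q - Xfun t p - A (q - p) =
    grad (fun b => Gfun (be R b) (t, q) - Gfun (be R b) (t, p) - DG (q - p) (be R b) (t, p)).
  have -> : A (q - p) = Afun t p (q - p) by [].
  rewrite -[- Afun _ _ _]scaleN1r -[- Xfun t p]scaleN1r /Afun /Xfun -!gradZ -!gradD; congr grad.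
  by apply/funext => b /=; rewrite !mulN1r.
apply: norm_grad_le => [|b]; first by rewrite mulr_ge0 ?sqr_ge0 // ltW.
have [h4|h4] := leP `|q - p| (1 / 4).
  have := B3 t p (q - p) b t01 pS h4; rewrite subrK => h; apply: le_trans h _.
  by rewrite ler_wpM2r ?sqr_ge0 // /C; clear - M0; lra.
have N (a c d : R) : `|a| <= M -> `|c| <= M -> `|d| <= M * `|q - p| ->
    `|a - c - d| <= C * `|q - p| ^+ 2.
  move=> h1 h2 h3; have q4 : `|q - p| <= 4.
    by apply: le_trans (ler_normB _ _) _; have := sphere_norm_le qS; have := sphere_norm_le pS; clear - R; lra.
  apply: le_trans (ler_normB _ _) _; apply: le_trans (lerD (ler_normB _ _) (lexx _)) _.
  have k1 : (1 / 4) ^+ 2 <= `|q - p| ^+ 2 by rewrite ler_pXn2r ?nnegrE // ltW.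
  have k2 : 100 * M * (1 / 4) ^+ 2 <= C * `|q - p| ^+ 2 by rewrite ler_pM2l.
  have k3 : M * `|q - p| <= M * 4 by rewrite ler_pM2l.
  clear - h1 h2 h3 k2 k3 M0; lra.
apply: N; [exact: (B1 b _ (onS q qS))|exact: (B1 b _ (onS p pS))|exact: (B2 _ b _ (onS p pS))].
Qed.

End SmoothHamiltonian.

(** * Lifting Hamiltonian curves to the sphere *)

Section CurveLift.
Variable R : realType.
Implicit Types (v w z p q : C3 R) (t : R).

Lemma is_derive0_const (f : R -> R) (a b : R) : (forall t, a < t < b -> is_derive t 1 f 0) ->
  forall x y, a < x < b -> a < y < b -> f x = f y.
Proof.
move=> fd; suff H x y : a < x -> x <= y -> y < b -> f x = f y.
  move=> x y /andP[ax xb] /andP[ay yb]; have [xy|/ltW yx] := leP x y; first exact: H.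
  by symmetry; exact: H.
move=> ax xy yb; have [||s] := @MVT_segment _ f (fun=> 0) x y xy.
- by move=> s; rewrite in_itv /= => /andP[h1 h2]; apply: fd; rewrite (lt_trans ax h1) (lt_trans h2 yb).
- apply: continuous_in_subspaceT => s; rewrite inE /= in_itv /= => /andP[h1 h2].
  apply: differentiable_continuous; apply/derivable1_diffP.
  by have [] // : is_derive s 1 f 0; apply: fd; rewrite (lt_le_trans ax h1) (le_lt_trans h2 yb).
by move=> _ /eqP; rewrite mul0r subr_eq0 => /eqP.
Qed.

(** The supremum of the times up to which an antiderivative exists is 1, since two
    antiderivatives differ by a constant on the overlap of their domains. *)
Lemma glue_antiderivative (l : R -> R) :
  (forall t0, 0 <= t0 <= 1 -> exists2 e, 0 < e &
     exists k : R -> R, forall t, `|t - t0| < e -> is_derive t 1 k (l t)) ->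
  exists k : R -> R, forall t, 0 <= t <= 1 -> is_derive t 1 k (l t).
Proof.
move=> loc.
pose S : set R := [set T | 0 <= T <= 1 /\ exists2 e, 0 < e &
   exists k : R -> R, forall t, - e < t < T + e -> is_derive t 1 k (l t)].
have S0 : S 0.
  split; first by rewrite lexx ler01.
  have [|e e0 [k hk]] := loc 0; first by rewrite lexx ler01.
  exists e => //; exists k => t; rewrite add0r => h; apply: hk; rewrite subr0.
  by rewrite ltr_norml.
have ubS : ubound S 1 by move=> T [/andP[]].
have hS : has_sup S by split; [exists 0|exists 1].
set s := sup S.
have s0 : 0 <= s by apply: ub_le_sup => //; exists 1.
have s1 : s <= 1 by apply: sup_le_ub => //; exists 0.
have [|e e0 [ks hks]] := loc s; first by rewrite s0 s1.
have [T [T01 [e1 e10 [k hk]]] sT] := sup_adherent e0 hS.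
have Ts : T <= s by apply: ub_le_sup; [exists 1|split=> //; exists e1 => //; exists k].
rewrite -/s in sT.
pose d := Num.min e1 (e - (s - T)).
have d0 : 0 < d by rewrite lt_min e10 subr_gt0; lra.
have [de1 de2] : d <= e1 /\ d <= e - (s - T) by rewrite !ge_min !lexx orbT.
pose k' t := if t <= T then k t else ks t - ks T + k T.
have near_eq t : T - d < t < T + d -> ks t - ks T + k T = k t.
  move=> ht; have /andP[T0 T1] := T01.
  have C : ks t - k t = ks T - k T.
    have [T00|T0'] := leP (- e1) (T - d).
      apply: (@is_derive0_const (fun t => ks t - k t) (T - d) (T + d)) => //; last by apply/andP; lra.
      move=> x /andP[x1 x2].
      have h1 : is_derive x 1 ks (l x) by apply: hks; rewrite ltr_norml; apply/andP; lra.
      have h2 : is_derive x 1 k (l x) by apply: hk; apply/andP; lra.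
      by have := is_deriveB h1 h2; rewrite subrr.
    by exfalso; lra.
  by move: C; lra.
have k'd t : - e1 < t < s + e -> is_derive t 1 k' (l t).
  move=> /andP[t1 t2]; have [tT|tT|tT] := ltgtP t T.
  - have N : {near t, k =1 k'}.
      have : \forall x \near t, x < T by exact: lt_nbhsl.
      by apply: filterS => x xT; rewrite /k' ltW.
    by apply: near_eq_is_derive N _; apply: hk; rewrite t1; lra.
  - have N : {near t, (fun t => ks t - ks T + k T) =1 k'}.
      have : \forall x \near t, T < x by exact: lt_nbhsr.
      by apply: filterS => x xT; rewrite /k' leNgt xT.
    apply: near_eq_is_derive N _.
    have h1 : is_derive t 1 ks (l t) by apply: hks; rewrite ltr_norml; apply/andP; lra.
    by apply: is_derive_eq; rewrite subr0 addr0.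
  - have N : {near t, k =1 k'}.
      have : \forall x \near t, `|t - x| < d by exact: (@cvgr_dist_lt _ _ _ _ _ id t cvg_id d d0).
      apply: filterS => x; rewrite ltr_norml => /andP[x1 x2]; rewrite /k'.
      by case: ifP => // _; rewrite near_eq //; apply/andP; lra.
    apply: near_eq_is_derive N _; apply: hk; rewrite t1; lra.
have Sx x : s <= x -> x < s + e -> x <= 1 -> S x.
  move=> sx xe x1; split; first by rewrite (le_trans s0 sx).
  exists (Num.min e1 (s + e - x)); first by rewrite lt_min e10 subr_gt0.
  exists k' => t /andP[t1 t2]; apply: k'd; apply/andP; split.
    by apply: le_lt_trans t1; rewrite lerN2 ge_min lexx.
  apply: lt_le_trans t2 _; rewrite addrC -lerBrDr ge_min lexx orbT //.
have s_1 : s = 1.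
  apply/eqP; rewrite eq_le s1 leNgt; apply/negP => s1'.
  pose x := Num.min 1 (s + e / 2).
  have xs : s < x by rewrite lt_min s1'; lra.
  have : x <= s.
    apply: ub_le_sup; first by exists 1.
    by apply: Sx; [exact: ltW|rewrite gt_min; apply/orP; right; lra|rewrite ge_min lexx].
  lra.
have [_ [e2 e20 [k2 hk2]]] : S 1 by apply: Sx; rewrite ?s_1 //; lra.
by exists k2 => t /andP[t0 t1]; apply: hk2; apply/andP; lra.
Qed.

Lemma ex_antiderivative (h : R -> R) (a b : R) : (forall t, a <= t <= b -> {for t, continuous h}) ->
  exists F : R -> R, forall t, a < t < b -> is_derive t 1 F (h t).
Proof.
move=> hc.
exists (fun x => \int[lebesgue_measure]_(t in `[a, x]) h t)%R => t /andP[at_ tb].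
have ab : a <= b by rewrite ltW // (lt_trans at_ tb).
have hi : lebesgue_measure.-integrable `[a, b] (EFin \o h).
  apply: continuous_compact_integrable; first exact: segment_compact.
  by apply: continuous_in_subspaceT => s; rewrite inE /= in_itv /= => /hc.
have ht : {for t, continuous h} by apply: hc; rewrite !ltW.
have [d e] := continuous_FTC1_closed tb hi at_ ht.
by apply: DeriveDef; [exact: d|rewrite -derive1E; exact: e].
Qed.

Lemma is_derive_cmul (u : R[i]) (d : R -> C3 R) t d' : is_derive t 1 d d' ->
  is_derive t 1 (fun s => cmul u (d s)) (cmul u d').
Proof.
move=> hd; apply: is_derive_C3 => j.
  have h1 := is_derive_coord1 j hd; have h2 := is_derive_coord2 j hd.
  rewrite (_ : (fun s => _) = (fun s : R => complex.Re u * (d s).1 ord0 j - complex.Im u * (d s).2 ord0 j)); last first.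
    by apply/funext => s; rewrite /= !mxE.
  by apply: is_derive_eq; rewrite /= !mxE.
have h1 := is_derive_coord1 j hd; have h2 := is_derive_coord2 j hd.
rewrite (_ : (fun s => _) = (fun s : R => complex.Re u * (d s).2 ord0 j + complex.Im u * (d s).1 ord0 j)); last first.
  by apply/funext => s; rewrite /= !mxE.
by apply: is_derive_eq; rewrite /= !mxE.
Qed.

Lemma is_derive_cmul_cis (f : R -> R) (d : R -> C3 R) t f' d' :
  is_derive t 1 f f' -> is_derive t 1 d d' ->
  is_derive t 1 (fun s => cmul (cis (f s)) (d s))
    (cmul (cis (f t)) d' + f' *: cmul 'i (cmul (cis (f t)) (d t))).
Proof.
move=> hf hd.
have hcos : is_derive t 1 (fun s => cos (f s)) (- sin (f t) * f').
  exact: (is_derive1_comp (is_derive_cos (f t)) hf).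
have hsin : is_derive t 1 (fun s => sin (f s)) (cos (f t) * f').
  exact: (is_derive1_comp (is_derive_sin (f t)) hf).
apply: is_derive_C3 => j.
  have h1 := is_derive_coord1 j hd; have h2 := is_derive_coord2 j hd.
  rewrite (_ : (fun s => _) = (fun s : R => cos (f s) * (d s).1 ord0 j - sin (f s) * (d s).2 ord0 j)); last first.
    by apply/funext => s; rewrite /= !mxE.
  by apply: is_derive_eq; rewrite /= !mxE /= /GRing.scale /=; ring.
have h1 := is_derive_coord1 j hd; have h2 := is_derive_coord2 j hd.
rewrite (_ : (fun s => _) = (fun s : R => cos (f s) * (d s).2 ord0 j + sin (f s) * (d s).1 ord0 j)); last first.
  by apply/funext => s; rewrite /= !mxE.
by apply: is_derive_eq; rewrite /= !mxE /= /GRing.scale /=; ring.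
Qed.

(** The characteristic direction of the sphere is spanned by i z. *)
Lemma tangent_kernel z e : z \in @sphere R -> (forall w, dot z w = 0 -> om e w = 0) ->
  e = (- (om e z / 2)) *: cmul 'i z.
Proof.
rewrite sphereE => /eqP zz h; apply: om_inj => w.
have : om e (w - (dot z w / 2) *: z) = 0.
  by apply: h; rewrite dotDr dotNr dotZr zz divfK ?subrr // pnatr_eq0.
rewrite omDr omNr omZr => /eqP; rewrite subr_eq0 => /eqP ->.
have E : om (cmul 'i z) w = - dot z w by rewrite /om /dot /cmul !sum3 /= !mxE; ring.
rewrite omZl E; ring.
Qed.

Lemma dot_continuous (c : R -> C3 R) t w : {for t, continuous c} ->
  {for t, continuous (fun s => dot (c s) w)}.
Proof.
move=> hc; have c1 j : {for t, continuous (fun s => (c s).1 ord0 j)}.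
  exact: (@continuous_comp _ _ _ c (fun z : C3 R => z.1 ord0 j) t hc (@coord1_continuous R j (c t))).
have c2 j : {for t, continuous (fun s => (c s).2 ord0 j)}.
  exact: (@continuous_comp _ _ _ c (fun z : C3 R => z.2 ord0 j) t hc (@coord2_continuous R j (c t))).
apply: cvg_big => [|j _]; first exact: add_continuous.
by apply: cvgD; apply: cvgM; [exact: c1|exact: cvg_cst|exact: c2|exact: cvg_cst].
Qed.

Variable H : R -> CP2 R -> R.
Hypothesis Hs : smooth_hamiltonian H.

(** The vertical speed l of a lift is a priori an arbitrary function. Pairing the
    equation with c t0 gives the derivative of the argument of the Hermitian product
    of c t and c t0, so that l is the sum of a continuous function and of a derivative. *)
Lemma gauge_local (c : R -> C3 R) (l : R -> R) :
  (forall t, c t \in @sphere R) ->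
  (forall t, is_derive t 1 c (Xfun H t (c t) + l t *: cmul 'i (c t))) ->
  forall t0, exists2 e, 0 < e &
    exists k : R -> R, forall t, `|t - t0| < e -> is_derive t 1 k (l t).
Proof.
move=> cS cd t0; pose z0 := c t0.
have cc t : {for t, continuous c}.
  by apply: differentiable_continuous; apply/derivable1_diffP; case: (cd t).
pose a t := dot (c t) z0; pose b t := om (c t) z0.
have ac t : {for t, continuous a} by exact: dot_continuous.
have bE : b = fun t => - dot (c t) (cmul 'i z0).
  by apply/funext => t; rewrite /b /om /dot /cmul !sum3 /= !mxE; ring.
have bc t : {for t, continuous b}.
  by rewrite bE; apply: continuousN; exact: dot_continuous.
have a0 : 0 < a t0 by rewrite /a; move: (cS t0); rewrite sphereE => /eqP ->.
have [e /= e0 he] : exists2 e, 0 < e & forall t, `|t - t0| <= e -> 0 < a t.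
  have N : \forall t \near t0, `|a t0 - a t| < a t0 by move/cvgrPdist_lt : (ac t0); apply.
  have [r /= r0 hr] := (nbhs_ballP _ _).1 N.
  exists (r / 2) => [|t ht]; first exact: divr_gt0.
  have : `|a t0 - a t| < a t0 by apply: hr; rewrite /ball /= distrC; lra.
  by rewrite ltr_norml => /andP[]; lra.
exists e => //.
pose x t := om (Xfun H t (c t)) z0; pose y t := om (Xfun H t (c t)) (cmul 'i z0).
have xc t : {for t, continuous x} by exact: Xfun_om_continuous.
have yc t : {for t, continuous y} by exact: Xfun_om_continuous.
pose h t := (x t * a t - y t * b t) / (a t * a t + b t * b t).
have n0 t : `|t - t0| <= e -> a t * a t + b t * b t != 0.
  by move=> /he at0; rewrite gt_eqF // ltr_wpDr -?expr2 ?sqr_ge0 // exprn_gt0.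
have [|F hF] := @ex_antiderivative h (t0 - e) (t0 + e).
  move=> t ht; have nt : `|t - t0| <= e by rewrite ler_norml; apply/andP; lra.
  apply: continuousM; first by apply: continuousB; apply: continuousM; [exact: xc|exact: ac|exact: yc|exact: bc].
  apply: continuousV; first exact: n0.
  by apply: continuousD; apply: continuousM; [exact: ac|exact: ac|exact: bc|exact: bc].
exists (fun t => F t - atan (b t / a t)) => t ht.
have at0 := he t (ltW ht).
have dF : is_derive t 1 F (h t) by apply: hF; move: ht; rewrite ltr_norml; lra.
have dz (s : R) : is_derive s 1 (fun=> z0) 0 by exact: is_derive_cst.
have da : is_derive t 1 a (y t + l t * b t).
  have := is_derive_dot (cd t) (dz t) => hd; apply: is_derive_eq hd _.
  rewrite dotDl dotZl -om_dot /y /b om_cmul_i.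
  have -> : dot (c t) 0 = 0 by rewrite -[0 in LHS](scale0r 0) dotZr mul0r.
  by rewrite addr0.
have db : is_derive t 1 b (x t - l t * a t).
  have := is_derive_om (cd t) (dz t) => hd; apply: is_derive_eq hd _.
  rewrite omDl omZl /x /a.
  have -> : om (c t) 0 = 0 by rewrite -[0 in LHS](scale0r 0) omZr mul0r.
  have -> : om (cmul 'i (c t)) z0 = - dot (c t) z0 by rewrite /om /dot /cmul !sum3 /= !mxE; ring.
  by rewrite addr0 mulrN.
have dV : is_derive t 1 (fun s => b s / a s) (((x t - l t * a t) * a t - b t * (y t + l t * b t)) / a t ^+ 2).
  have dai : is_derive t 1 (fun s => (a s)^-1) (- (a t)^-2 * (y t + l t * b t)).
    exact: (@is_deriveV _ a t _ 1 (lt0r_neq0 at0) da).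
  apply: is_derive_eq; rewrite /GRing.scale /=; field; exact: lt0r_neq0.
have dA : is_derive t 1 (fun s => atan (b s / a s)) ((1 + (b t / a t) ^+ 2)^-1 *
    (((x t - l t * a t) * a t - b t * (y t + l t * b t)) / a t ^+ 2)).
  exact: (is_derive1_comp (is_derive1_atan _) dV).
have := is_deriveB dF dA => hd; apply: is_derive_eq hd _.
have nt := n0 t (ltW ht); have nt' := lt0r_neq0 at0.
rewrite /h; field.
by rewrite nt' /=; move: nt; rewrite -!expr2.
Qed.

(** Any differentiable lift of gamma solves the equation of [Xfun] up to a vertical
    term; rotating it by an antiderivative of the vertical speed removes this term. *)
Lemma lift_curve (gamma : R -> CP2 R) z : integral_curve H gamma ->
  z \in @sphere R -> hproj z = gamma 0 ->
  exists c : R -> C3 R, [/\ c 0 = z, solves (Xfun H) c &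
    forall t, 0 <= t <= 1 -> hproj (c t) = gamma t].
Proof.
move=> [c0 hc0] zS zg.
have cS t : c0 t \in @sphere R by case: (hc0 t).
pose e t := 'D_1 c0 t - Xfun H t (c0 t).
pose l t := - (om (e t) (c0 t) / 2).
have eE t : e t = l t *: cmul 'i (c0 t).
  apply: tangent_kernel => // w zw.
  have [_ _ _ [_ h]] := hc0 t.
  rewrite /e omDl omNl (Xfun_lift Hs t w (cS t)) zw mulr0 addr0 -omega_stdE h ?subrr //.
  by apply/tangent_sphereE.
have cd t : is_derive t 1 c0 (Xfun H t (c0 t) + l t *: cmul 'i (c0 t)).
  have [_ _ d _] := hc0 t; apply: DeriveDef => //.
  by rewrite -eE /e addrC subrK.
have [k hk] := glue_antiderivative (fun t0 _ => gauge_local cS cd t0).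
have [u u1 hu] : exists2 u : R[i], `|u| = 1 & z = cmul u (c0 0).
  have /hproj_eq : hproj (c0 0) = hproj z by rewrite zg; case: (hc0 0).
  move=> /(_ (cS 0) zS)[u u1 hu]; exists u => //; apply: C3_eq => j; by rewrite hu zcoord_cmul.
pose c t := cmul (cis (k 0 - k t)) (cmul u (c0 t)).
have cisN1 a : `|cis a : R[i]| = 1 by apply/norm1_sqn; exact: cos2Dsin2.
exists c; split.
- by rewrite /c subrr cis0 cmul1.
- move=> t t01; split; first by rewrite /c !sphere_cmul.
  have dk := hk t t01.
  have dk' : is_derive t 1 (fun s => k 0 - k s) (- l t).
    by have := is_deriveB (is_derive_cst (k 0) t 1) dk; rewrite sub0r.
  have := is_derive_cmul_cis dk' (is_derive_cmul u (cd t)) => h; apply: is_derive_eq h _.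
  have [C rX] := regular_Xfun Hs.
  have X1 := (rX.2 t t01 _ (cS t)).2 u u1.
  have uS : cmul u (c0 t) \in @sphere R by rewrite sphere_cmul.
  have X2 := (rX.2 t t01 _ uS).2 _ (cisN1 (k 0 - k t)).
  rewrite /c X2 X1 !cmulD !cmulZ -!cmulM.
  have -> : 'i%C * cis (k 0 - k t) * u = cis (k 0 - k t) * u * 'i%C by ring.
  have Z (v1 v2 : C3 R) (a : R) : v1 + a *: v2 + - a *: v2 = v1.
    by rewrite -addrA -scalerDl subrr scale0r addr0.
  exact: Z.
move=> t t01; rewrite /c hproj_cmul //; last first.
  by apply: sphere_neq0; rewrite sphere_cmul.
by rewrite hproj_cmul //; [case: (hc0 t)|exact: sphere_neq0].
Qed.

End CurveLift.

(** * Coordinates on the lifted tori *)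

Section Torus.
Variable R : realType.
Implicit Types (P Q v w z : C3 R) (y : R).
Local Notation normc := ComplexField.Normc.normc.
Local Notation ReC := complex.Re.
Local Notation ImC := complex.Im.

Lemma normc_ge0 (a : R[i]) : 0 <= normc a.
Proof. by case: a => x y; exact: sqrtr_ge0. Qed.
Lemma sqr_normc_sqn (a : R[i]) : normc a ^+ 2 = sqn a.
Proof. by case: a => x y; rewrite /sqn /= sqr_sqrtr // addr_ge0 ?sqr_ge0. Qed.
Lemma normcD (a b : R[i]) : normc (a + b) <= normc a + normc b.
Proof. exact: le_normcD. Qed.
Lemma normcB (a b : R[i]) : normc (a - b) <= normc a + normc b.
Proof. by apply: le_trans (normcD _ _) _; rewrite normcN. Qed.
Lemma normcR (x : R) : normc x%:C = `|x|.
Proof. by rewrite /= expr0n addr0 sqrtr_sqr. Qed.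
Lemma normcM (a b : R[i]) : normc (a * b) = normc a * normc b.
Proof. exact: ComplexField.Normc.normcM. Qed.
Lemma normc_i : normc ('i%C : R[i]) = 1.
Proof. by rewrite /= expr0n expr1n add0r sqrtr1. Qed.
Lemma Im_le_normc (a : R[i]) : `|ImC a| <= normc a.
Proof. by case: a => x y /=; rewrite -sqrtr_sqr ler_wsqrtr // lerDr sqr_ge0. Qed.
Lemma normc_le_ReIm (a : R[i]) : normc a <= `|ReC a| + `|ImC a|.
Proof.
rewrite {1}(complexE a); apply: le_trans (normcD _ _) _.
by rewrite normcM normc_i mul1r !normcR.
Qed.

Lemma ImD (a b : R[i]) : ImC (a + b) = ImC a + ImC b.
Proof. by case: a b => ? ? []. Qed.
Lemma ImB (a b : R[i]) : ImC (a - b) = ImC a - ImC b.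
Proof. by case: a b => ? ? []. Qed.

Lemma normc_zcoord v j : normc (zcoord v j) <= 2 * `|v|.
Proof.
apply: le_trans (normc_le_ReIm _) _; rewrite /= mulrDl mul1r.
by apply: lerD; [exact: coord1_le|exact: coord2_le].
Qed.

Lemma norm_le_zcoord v (M : R) : 0 <= M -> (forall j, normc (zcoord v j) <= M) -> `|v| <= M.
Proof.
move=> M0 h; apply: norm_le_coord => // j; apply: le_trans (h j).
  exact: (Re_le_normc (zcoord v j)).
exact: (Im_le_normc (zcoord v j)).
Qed.

Definition mkC3 (a b c : R[i]) : C3 R :=
  let f (j : 'I_3) := if j == 0 then a else if j == 1 then b else c in
  (\row_j ReC (f j), \row_j ImC (f j)).

Lemma zcoord_mkC3 a b c j :
  zcoord (mkC3 a b c) j = if j == 0 then a else if j == 1 then b else c.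
Proof. by rewrite /zcoord /= !mxE; case: (if _ then _ else _). Qed.
Lemma zcoord_mkC30 a b c : zcoord (mkC3 a b c) 0 = a.
Proof. by rewrite zcoord_mkC3. Qed.
Lemma zcoord_mkC31 a b c : zcoord (mkC3 a b c) 1 = b.
Proof. by rewrite zcoord_mkC3. Qed.
Lemma zcoord_mkC32 a b c : zcoord (mkC3 a b c) 2 = c.
Proof. by rewrite zcoord_mkC3. Qed.
Definition zmkE := (zcoord_mkC30, zcoord_mkC31, zcoord_mkC32).

Lemma I3P (j : 'I_3) : [\/ j = 0, j = 1 | j = 2].
Proof.
case: j => [[|[|[|k]]] hk] //.
- by apply: Or31; apply: val_inj.
- by apply: Or32; apply: val_inj.
- by apply: Or33; apply: val_inj.
Qed.

Lemma C3_eq3 v w : zcoord v 0 = zcoord w 0 -> zcoord v 1 = zcoord w 1 ->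
  zcoord v 2 = zcoord w 2 -> v = w.
Proof. by move=> h0 h1 h2; apply: C3_eq => j; case: (I3P j) => ->. Qed.

(** The preimage of L(x, y) in the sphere when x + 2 y = 1. *)
Definition torus y z := [/\ z \in @sphere R,
  `|\sum_j zcoord z j ^+ 2| = (4 * Num.sqrt (y * (1 - y)))%:C &
  ImC (conjc (zcoord z 1) * zcoord z 2) = 0].

Lemma torus_cmul y z (a : R[i]) : `|a| = 1 -> torus y z -> torus y (cmul a z).
Proof.
move=> a1 [zS q1 i1]; split; first by rewrite sphere_cmul.
  have -> : \sum_j zcoord (cmul a z) j ^+ 2 = a ^+ 2 * \sum_j zcoord z j ^+ 2.
    by rewrite mulr_sumr; apply: eq_bigr => j _; rewrite zcoord_cmul exprMn.
  by rewrite normrM normrX a1 expr1n mul1r.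
rewrite !zcoord_cmul; have a2 := (norm1_sqn a).1 a1.
move: i1; case: a {a1} a2 => a b; case: (zcoord z 1) => c d; case: (zcoord z 2) => e f.
rewrite /sqn /= => a2 i1.
have -> : (a * c - b * d) * (a * f + b * e) + - (a * d + b * c) * (a * e - b * f) =
  (a ^+ 2 + b ^+ 2) * (c * f + - d * e) by ring.
by rewrite i1 mulr0.
Qed.

Lemma L_torus_hproj x y z : x + 2 * y = 1 -> z \in @sphere R ->
  L_torus x y (hproj z) <-> torus y z.
Proof.
move=> xy zS; have xy0 : x + 2 * y - 1 = 0 by rewrite xy subrr.
split=> [[w [wS q1 i1] hw]|[_ q1 i1]].
  have [u u1 hu] := (hproj_eq wS zS).1 hw.
  have -> : z = cmul u w by apply: C3_eq => j; rewrite zcoord_cmul.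
  by apply: torus_cmul => //; split=> //; rewrite -xy0.
by exists z => //; split=> //; rewrite xy0.
Qed.

(** On the torus (z_1, z_2) is a complex multiple of a real unit vector, determined up
    to sign; (mom 1, mom 2) / (1 - 2 y) is a choice of this vector that is polynomial in
    z. This direction and the arguments of the numbers u and v below are coordinates. *)
Definition mom (j : 'I_3) z : R := z.1 ord0 0 * z.2 ord0 j - z.2 ord0 0 * z.1 ord0 j.
Definition dirC y z : R := mom 1 z / (1 - 2 * y).
Definition dirS y z : R := mom 2 z / (1 - 2 * y).
Definition zeta y z : R[i] := zcoord z 1 * (dirC y z)%:C + zcoord z 2 * (dirS y z)%:C.
Definition ucoord y z : R[i] := zcoord z 0 + 'i%C * zeta y z.
Definition vcoord y z : R[i] := zcoord z 0 - 'i%C * zeta y z.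

(** In the coordinates u and v the quadric is u v = z_0 ^ 2 + z_1 ^ 2 + z_2 ^ 2, so that
    the equations of the torus prescribe |u| |v| and |u| ^ 2 + |v| ^ 2; the order of the
    two moduli reflects the sign chosen for the direction. *)
Lemma torus_coordP y z : 0 < y -> y < 1 / 2 -> torus y z ->
  [/\ dirC y z ^+ 2 + dirS y z ^+ 2 = 1,
      zcoord z 1 = zeta y z * (dirC y z)%:C, zcoord z 2 = zeta y z * (dirS y z)%:C,
      sqn (ucoord y z) = 4 * y & sqn (vcoord y z) = 4 * (1 - y)].
Proof.
move=> y0 y2 [zS q1 i1].
have x0 : 0 < 1 - 2 * y by lra.
move: zS; rewrite sphereE => /eqP zz.
have q2 : sqn (\sum_j zcoord z j ^+ 2) = 16 * (y * (1 - y)).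
  move: q1; rewrite normc_def => /complexI /(congr1 (fun r : R => r ^+ 2)).
  rewrite exprMn !sqr_sqrtr; first by rewrite /sqn => ->; ring.
    by rewrite mulr_ge0 //; lra.
  by rewrite addr_ge0 ?sqr_ge0.
move: zz q2 i1; rewrite /dot /ucoord /vcoord /zeta /dirC /dirS /mom !sum3 /zcoord.
set a0 := z.1 ord0 0; set a1 := z.1 ord0 1; set a2 := z.1 ord0 2.
set b0 := z.2 ord0 0; set b1 := z.2 ord0 1; set b2 := z.2 ord0 2.
set m1 := a0 * b1 - b0 * a1; set m2 := a0 * b2 - b0 * a2.
rewrite /sqn /= => zz q2 i1.
have m12 : m1 ^+ 2 + m2 ^+ 2 = (1 - 2 * y) ^+ 2.
  have I : (a0 * a0 + b0 * b0 + (a1 * a1 + b1 * b1) + (a2 * a2 + b2 * b2)) ^+ 2 =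
    ((a0 * a0 - b0 * b0 + (a1 * a1 - b1 * b1) + (a2 * a2 - b2 * b2)) ^+ 2 +
     (a0 * b0 + b0 * a0 + (a1 * b1 + b1 * a1) + (a2 * b2 + b2 * a2)) ^+ 2) +
    4 * (m1 ^+ 2 + m2 ^+ 2 + (a1 * b2 + - b1 * a2) ^+ 2) by rewrite /m1 /m2; ring.
  rewrite zz q2 i1 expr0n addr0 in I.
  have -> : m1 ^+ 2 + m2 ^+ 2 = (2 ^+ 2 - 16 * (y * (1 - y))) / 4 by rewrite I; field.
  by field.
have x0' := lt0r_neq0 x0.
have k1 : a1 * m2 = a2 * m1.
  have : a1 * m2 - a2 * m1 = a0 * (a1 * b2 + - b1 * a2) by rewrite /m1 /m2; ring.
  by rewrite i1 mulr0 => /eqP; rewrite subr_eq0 => /eqP.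
have k2 : b1 * m2 = b2 * m1.
  have : b1 * m2 - b2 * m1 = b0 * (a1 * b2 + - b1 * a2) by rewrite /m1 /m2; ring.
  by rewrite i1 mulr0 => /eqP; rewrite subr_eq0 => /eqP.
have E1 : a1 * (m1 ^+ 2 + m2 ^+ 2) = (a1 * m1 + a2 * m2) * m1.
  by rewrite mulrDr [m2 ^+ 2]expr2 mulrA k1; ring.
have E2 : a2 * (m1 ^+ 2 + m2 ^+ 2) = (a1 * m1 + a2 * m2) * m2.
  by rewrite mulrDr [m1 ^+ 2]expr2 mulrA -k1; ring.
have E3 : b1 * (m1 ^+ 2 + m2 ^+ 2) = (b1 * m1 + b2 * m2) * m1.
  by rewrite mulrDr [m2 ^+ 2]expr2 mulrA k2; ring.
have E4 : b2 * (m1 ^+ 2 + m2 ^+ 2) = (b1 * m1 + b2 * m2) * m2.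
  by rewrite mulrDr [m1 ^+ 2]expr2 mulrA -k2; ring.
set x := 1 - 2 * y in x0 x0' m12 *.
rewrite m12 in E1 E2 E3 E4.
pose s := (a1 * m1 + a2 * m2) / x; pose r := (b1 * m1 + b2 * m2) / x.
have F1 : a1 = s * (m1 / x) by rewrite /s mulrACA -E1 -invfM -expr2 mulfK // expf_neq0.
have F2 : a2 = s * (m2 / x) by rewrite /s mulrACA -E2 -invfM -expr2 mulfK // expf_neq0.
have F3 : b1 = r * (m1 / x) by rewrite /r mulrACA -E3 -invfM -expr2 mulfK // expf_neq0.
have F4 : b2 = r * (m2 / x) by rewrite /r mulrACA -E4 -invfM -expr2 mulfK // expf_neq0.
have cs1 : (m1 / x) ^+ 2 + (m2 / x) ^+ 2 = 1.
  by rewrite !expr_div_n -mulrDl m12 divff // expf_neq0.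
have sE : s = a1 * (m1 / x) + a2 * (m2 / x) by rewrite /s mulrDl !mulrA.
have rE : r = b1 * (m1 / x) + b2 * (m2 / x) by rewrite /r mulrDl !mulrA.
have sr : s ^+ 2 + r ^+ 2 = a1 ^+ 2 + b1 ^+ 2 + (a2 ^+ 2 + b2 ^+ 2).
  have g1 : a1 ^+ 2 = s ^+ 2 * (m1 / x) ^+ 2 by rewrite -exprMn -F1.
  have g2 : a2 ^+ 2 = s ^+ 2 * (m2 / x) ^+ 2 by rewrite -exprMn -F2.
  have g3 : b1 ^+ 2 = r ^+ 2 * (m1 / x) ^+ 2 by rewrite -exprMn -F3.
  have g4 : b2 ^+ 2 = r ^+ 2 * (m2 / x) ^+ 2 by rewrite -exprMn -F4.
  rewrite g1 g2 g3 g4 -[LHS]mulr1 -cs1; clear; ring.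
have cr : a0 * r - b0 * s = x.
  have -> : a0 * r - b0 * s = (m1 ^+ 2 + m2 ^+ 2) / x by rewrite /r /s /m1 /m2; ring.
  by rewrite m12 expr2 mulfK.
split=> //.
- apply: complex_eq; rewrite /= !mulr0 ?mul0r ?subr0 ?addr0 ?add0r -?sE -?rE //.
- apply: complex_eq; rewrite /= !mulr0 ?mul0r ?subr0 ?addr0 ?add0r -?sE -?rE //.
- have T (X Y : R) : X = a0 - r -> Y = b0 + s -> X ^+ 2 + Y ^+ 2 = 4 * y.
    move=> -> ->.
    have -> : (a0 - r) ^+ 2 + (b0 + s) ^+ 2 =
      a0 ^+ 2 + b0 ^+ 2 + (s ^+ 2 + r ^+ 2) - 2 * (a0 * r - b0 * s) by ring.
    rewrite cr sr; move: zz; rewrite /x !expr2; clear; lra.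
  by apply: T; rewrite ?sE ?rE /=; ring.
- have T (X Y : R) : X = a0 + r -> Y = b0 - s -> X ^+ 2 + Y ^+ 2 = 4 * (1 - y).
    move=> -> ->.
    have -> : (a0 + r) ^+ 2 + (b0 - s) ^+ 2 =
      a0 ^+ 2 + b0 ^+ 2 + (s ^+ 2 + r ^+ 2) + 2 * (a0 * r - b0 * s) by ring.
    rewrite cr sr; move: zz; rewrite /x !expr2; clear; lra.
  by apply: T; rewrite ?sE ?rE /=; ring.
Qed.

Lemma mom_lipschitz j z w : z \in @sphere R -> w \in @sphere R ->
  `|mom j w - mom j z| <= 8 * `|w - z|.
Proof.
move=> zS wS; have nz := sphere_norm_le zS; have nw := sphere_norm_le wS.
have B (a b c d : R) : `|a| <= 2 -> `|b| <= `|w - z| -> `|c| <= 2 -> `|d| <= `|w - z| ->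
  `|a * b + c * d| <= 4 * `|w - z|.
  move=> ha hb hc hd; apply: le_trans (ler_normD _ _) _; rewrite !normrM.
  have : `|a| * `|b| <= 2 * `|w - z| by apply: ler_pM.
  have : `|c| * `|d| <= 2 * `|w - z| by apply: ler_pM.
  lra.
have -> : mom j w - mom j z =
  (w.1 ord0 0 * (w - z).2 ord0 j + z.2 ord0 j * (w - z).1 ord0 0)
  + (- w.2 ord0 0 * (w - z).1 ord0 j + - z.1 ord0 j * (w - z).2 ord0 0).
  by rewrite /mom /= !mxE; ring.
have h1 : `|w.1 ord0 0| <= 2 by apply: le_trans (coord1_le _ _) _.
have h2 : `|z.2 ord0 j| <= 2 by apply: le_trans (coord2_le _ _) _.
have h3 : `|- w.2 ord0 0| <= 2 by rewrite normrN; apply: le_trans (coord2_le _ _) _.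
have h4 : `|- z.1 ord0 j| <= 2 by rewrite normrN; apply: le_trans (coord1_le _ _) _.
have b1 := B _ _ _ _ h1 (coord2_le (w - z) j) h2 (coord1_le (w - z) 0).
have b2 := B _ _ _ _ h3 (coord1_le (w - z) j) h4 (coord2_le (w - z) 0).
apply: le_trans (ler_normD _ _) _; apply: le_trans (lerD b1 b2) _; lra.
Qed.

Lemma normc_zcoord_sphere z j : z \in @sphere R -> normc (zcoord z j) <= 4.
Proof.
move=> /sphere_norm_le h; apply: le_trans (normc_zcoord _ _) _.
by apply: le_trans (_ : 2 * 2 <= _); [rewrite ler_pM2l|lra].
Qed.

Lemma torus_sphere y z : torus y z -> z \in @sphere R. Proof. by case. Qed.

Lemma sqr_le1 (a b : R) : a ^+ 2 + b ^+ 2 = 1 -> `|a| <= 1.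
Proof.
move=> h; rewrite -(@ler_pXn2r _ 2) ?nnegrE // expr1n -normrX ger0_norm ?sqr_ge0 //.
by rewrite -h lerDl sqr_ge0.
Qed.

Lemma normc_sq_le (a : R[i]) (b : R) : 0 <= b -> b ^+ 2 <= sqn a -> b <= normc a.
Proof. by move=> b0; rewrite -sqr_normc_sqn ler_pXn2r ?nnegrE ?normc_ge0. Qed.

Lemma normc_sq_ge (a : R[i]) (b : R) : 0 <= b -> sqn a <= b ^+ 2 -> normc a <= b.
Proof. by move=> b0; rewrite -sqr_normc_sqn ler_pXn2r ?nnegrE ?normc_ge0. Qed.

Lemma ucoord_ge y z : 0 < y -> y < 1 / 2 -> torus y z -> 2 * y <= normc (ucoord y z).
Proof.
move=> y0 y2 zt; have [_ _ _ hu _] := torus_coordP y0 y2 zt.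
apply: normc_sq_le; first lra.
by rewrite hu; have : y * y <= y * 1 by [rewrite ler_pM2l //; lra]; rewrite exprMn expr2; lra.
Qed.

Lemma vcoord_ge y z : 0 < y -> y < 1 / 2 -> torus y z -> 1 <= normc (vcoord y z).
Proof.
move=> y0 y2 zt; have [_ _ _ _ hv] := torus_coordP y0 y2 zt.
by apply: normc_sq_le => //; rewrite hv; lra.
Qed.

Lemma sqn_zeta_coord y z : 0 < y -> y < 1 / 2 -> torus y z ->
  sqn (zcoord z 0) + sqn (zeta y z) = 2.
Proof.
move=> y0 y2 zt; have [cs h1 h2 _ _] := torus_coordP y0 y2 zt.
have : dot z z = 2 by apply/eqP; rewrite -sphereE; case: zt.
rewrite dot_sqn h1 h2 !sqnM -addrA -mulrDr.
have -> : sqn (dirC y z)%:C + sqn (dirS y z)%:C = 1 by rewrite -cs /sqn /= !expr0n !addr0.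
by rewrite mulr1.
Qed.

Lemma sqn_uvcoord (a b : R[i]) : sqn (a + 'i%C * b) - sqn (a - 'i%C * b) =
  4 * (complex.Im a * complex.Re b - complex.Re a * complex.Im b).
Proof. by case: a b => a1 a2 [b1 b2]; rewrite /sqn /=; ring. Qed.

Lemma zeta_ge y z : 0 < y -> y < 1 / 2 -> torus y z -> (1 - 2 * y) / 2 <= normc (zeta y z).
Proof.
move=> y0 y2 zt; have [_ _ _ hu hv] := torus_coordP y0 y2 zt.
have s2 := sqn_zeta_coord y0 y2 zt.
have := sqn_uvcoord (zcoord z 0) (zeta y z); rewrite -/(ucoord y z) -/(vcoord y z) hu hv.
move: s2; set b := zeta y z; case: (zcoord z 0) => a1 a2; case: b => b1 b2.
rewrite /sqn /= => s2 h.
apply: (@normc_sq_le (b1 +i* b2)); first lra.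
rewrite /sqn /=.
have h2 : a1 * b2 - a2 * b1 = 1 - 2 * y by lra.
have : (1 - 2 * y) ^+ 2 <= 2 * (b1 ^+ 2 + b2 ^+ 2).
  rewrite -h2.
  have e : (a1 ^+ 2 + a2 ^+ 2) * (b1 ^+ 2 + b2 ^+ 2) = (a1 * b2 - a2 * b1) ^+ 2 + (a1 * b1 + a2 * b2) ^+ 2 by ring.
  have e' : (a1 ^+ 2 + a2 ^+ 2) * (b1 ^+ 2 + b2 ^+ 2) <= 2 * (b1 ^+ 2 + b2 ^+ 2).
    by rewrite ler_wpM2r ?addr_ge0 ?sqr_ge0 // -s2 lerDl addr_ge0 ?sqr_ge0.
  have := sqr_ge0 (a1 * b1 + a2 * b2); lra.
have -> : ((1 - 2 * y) / 2) ^+ 2 = (1 - 2 * y) ^+ 2 / 4 by field.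
have := sqr_ge0 (1 - 2 * y); have := sqr_ge0 b1; have := sqr_ge0 b2; clear; lra.
Qed.

Lemma zeta_le y z : 0 < y -> y < 1 / 2 -> torus y z -> normc (zeta y z) <= 2.
Proof.
move=> y0 y2 zt; have s2 := sqn_zeta_coord y0 y2 zt.
apply: normc_sq_ge => //; have := sqn_ge0 (zcoord z 0); lra.
Qed.

Lemma normcV_sub1 (a b : R[i]) (m c : R) : 0 < m -> m <= normc a -> normc (b - a) <= c ->
  normc (b / a - 1) <= c / m.
Proof.
move=> m0 ma h.
have a0 : a != 0 by rewrite -normc_gt0; apply: lt_le_trans ma.
have -> : b / a - 1 = (b - a) / a by rewrite mulrBl divff.
have e : normc ((b - a) / a) * normc a = normc (b - a) by rewrite -normcM divfK.
rewrite ler_pdivlMr //; apply: le_trans h; rewrite -e ler_wpM2l ?normc_ge0 //.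
Qed.

Record torus_close y (c : R) P Q : Prop := TorusClose {
  close_dirC : `|dirC y Q - dirC y P| <= c;
  close_dirS : `|dirS y Q - dirS y P| <= c;
  close_u : normc (ucoord y Q / ucoord y P - 1) <= c;
  close_v : normc (vcoord y Q / vcoord y P - 1) <= c;
  close_zeta : normc (zeta y Q / zeta y P - 1) <= c }.

Lemma torus_lipschitz y : 0 < y -> y < 1 / 2 -> exists2 c, 0 < c &
  forall P Q, torus y P -> torus y Q -> torus_close y (c * `|Q - P|) P Q.
Proof.
move=> y0 y2; have x0 : 0 < 1 - 2 * y by lra.
pose c1 := 8 / (1 - 2 * y); pose c2 := 4 + 8 * c1; pose c3 := 2 + c2.
have c10 : 0 < c1 by rewrite divr_gt0.
have c20 : 0 < c2 by rewrite /c2; lra.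
have c30 : 0 < c3 by rewrite /c3; lra.
pose c := c1 + c3 / (2 * y) + c3 + c2 / ((1 - 2 * y) / 2).
have p1 : 0 < c3 / (2 * y) by rewrite divr_gt0 // mulr_gt0.
have p2 : 0 < c2 / ((1 - 2 * y) / 2) by rewrite !divr_gt0.
have c0 : 0 < c by rewrite /c; clear - c10 c30 p1 p2; lra.
exists c => //.
move=> P Q Pt Qt; have PS := torus_sphere Pt; have QS := torus_sphere Qt.
have D0 : 0 <= `|Q - P| by [].
have hC : `|dirC y Q - dirC y P| <= c1 * `|Q - P|.
  rewrite /dirC -mulrBl normrM normfV (gtr0_norm x0) /c1 mulrAC ler_pM2r ?invr_gt0 //.
  exact: mom_lipschitz.
have hS : `|dirS y Q - dirS y P| <= c1 * `|Q - P|.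
  rewrite /dirS -mulrBl normrM normfV (gtr0_norm x0) /c1 mulrAC ler_pM2r ?invr_gt0 //.
  exact: mom_lipschitz.
have [csQ _ _ _ _] := torus_coordP y0 y2 Qt.
have CQ := sqr_le1 csQ; have SQ : `|dirS y Q| <= 1 by apply: (@sqr_le1 _ (dirC y Q)); rewrite addrC.
have hz : normc (zeta y Q - zeta y P) <= c2 * `|Q - P|.
  have -> : zeta y Q - zeta y P =
    (zcoord (Q - P) 1 * (dirC y Q)%:C + zcoord P 1 * (dirC y Q - dirC y P)%:C) +
    (zcoord (Q - P) 2 * (dirS y Q)%:C + zcoord P 2 * (dirS y Q - dirS y P)%:C).
    by rewrite /zeta !zcoordB !rmorphB /=; ring.
  have T (j : 'I_3) (a b : R) : `|a| <= 1 -> `|b| <= c1 * `|Q - P| ->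
     normc (zcoord (Q - P) j * a%:C + zcoord P j * b%:C) <= 2 * `|Q - P| + 4 * (c1 * `|Q - P|).
    move=> ha hb; apply: le_trans (normcD _ _) _; rewrite !normcM !normcR.
    apply: lerD; last by apply: ler_pM => //; rewrite ?normc_ge0 ?normc_zcoord_sphere.
    rewrite -[leRHS]mulr1; apply: ler_pM => //; rewrite ?normc_ge0 ?normc_zcoord //.
  apply: le_trans (normcD _ _) _; apply: le_trans (lerD (T 1 _ _ CQ hC) (T 2 _ _ SQ hS)) _.
  by rewrite /c2; clear; lra.
have h0 : normc (zcoord Q 0 - zcoord P 0) <= 2 * `|Q - P| by rewrite -zcoordB normc_zcoord.
have hiz : normc ('i%C * zeta y Q - 'i%C * zeta y P) <= c2 * `|Q - P|.
  by rewrite -mulrBr normcM normc_i mul1r.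
have hu : normc (ucoord y Q - ucoord y P) <= c3 * `|Q - P|.
  rewrite /ucoord opprD addrACA; apply: le_trans (normcD _ _) _.
  by rewrite /c3 mulrDl lerD.
have hv : normc (vcoord y Q - vcoord y P) <= c3 * `|Q - P|.
  have -> : vcoord y Q - vcoord y P =
    (zcoord Q 0 - zcoord P 0) - ('i%C * zeta y Q - 'i%C * zeta y P) by rewrite /vcoord; ring.
  by apply: le_trans (normcB _ _) _; rewrite /c3 mulrDl lerD.
have W (r a : R) : 0 < a -> a <= c -> r <= a * `|Q - P| -> r <= c * `|Q - P|.
  by move=> a0 ac h; apply: le_trans h _; rewrite ler_wpM2r.
have y20 : 0 < 2 * y by rewrite mulr_gt0.
have x20 : 0 < (1 - 2 * y) / 2 by rewrite divr_gt0.
split.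
- by apply: W hC; rewrite // /c; clear - c10 c30 p1 p2; lra.
- by apply: W hS; rewrite // /c; clear - c10 c30 p1 p2; lra.
- apply: (W _ (c3 / (2 * y))) => //; first by rewrite /c; clear - c10 c30 p1 p2; lra.
  by rewrite mulrAC; apply: normcV_sub1 => //; exact: ucoord_ge.
- apply: (W _ c3) => //; first by rewrite /c; clear - c10 c30 p1 p2; lra.
  by rewrite -[leRHS]divr1; apply: normcV_sub1 => //; exact: vcoord_ge y0 y2 _.
- apply: (W _ (c2 / ((1 - 2 * y) / 2))) => //; first by rewrite /c; clear - c10 c30 p1 p2; lra.
  by rewrite mulrAC; apply: normcV_sub1 => //; exact: zeta_ge.
Qed.

(** The determinant of a frame made of z and two tangent vectors of the torus has
    the argument of [phase], up to sign. *)
Definition phase y z : R[i] := ucoord y z * vcoord y z * zeta y z.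

(** [rcos] and [rsin] are the cosine and the sine of the angle between the directions
    of P and Q. *)
Definition rcos y P Q : R := dirC y P * dirC y Q + dirS y P * dirS y Q.
Definition rsin y P Q : R := dirC y P * dirS y Q - dirS y P * dirC y Q.
Definition slope y P Q : R[i] :=
  (zcoord P 0 * zeta y Q * (rcos y P Q)%:C - zeta y P * zcoord Q 0)
  / (ucoord y P * vcoord y P).

Lemma coord_neq0 y z : 0 < y -> y < 1 / 2 -> torus y z ->
  [/\ ucoord y z != 0, vcoord y z != 0 & zeta y z != 0].
Proof.
move=> y0 y2 zt; split; rewrite -normc_gt0.
- by apply: lt_le_trans (ucoord_ge y0 y2 zt); lra.
- by apply: lt_le_trans (vcoord_ge y0 y2 zt).
- by apply: lt_le_trans (zeta_ge y0 y2 zt); lra.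
Qed.

Lemma phase_neq0 y z : 0 < y -> y < 1 / 2 -> torus y z -> phase y z != 0.
Proof. by move=> y0 y2 zt; have [? ? ?] := coord_neq0 y0 y2 zt; rewrite !mulf_neq0. Qed.

(** In the basis of R^2 formed by the direction of P and its normal, the determinant
    only involves the angles from P to Q1 and Q2. *)
Lemma det3_phase y P Q1 Q2 : 0 < y -> y < 1 / 2 -> torus y P -> torus y Q1 -> torus y Q2 ->
  det3 P Q1 Q2 / phase y P =
    zeta y Q2 / zeta y P * (rsin y P Q2)%:C * slope y P Q1
    - zeta y Q1 / zeta y P * (rsin y P Q1)%:C * slope y P Q2.
Proof.
move=> y0 y2 Pt Q1t Q2t.
have [cs p1 p2 _ _] := torus_coordP y0 y2 Pt.
have [_ q1 q2 _ _] := torus_coordP y0 y2 Q1t.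
have [_ r1 r2 _ _] := torus_coordP y0 y2 Q2t.
have [u0 v0 z0] := coord_neq0 y0 y2 Pt.
apply: (canLR (mulfK (phase_neq0 y0 y2 Pt))).
have E (a b c d e f g h k : R[i]) : a != 0 -> b != 0 -> c != 0 ->
  (d / c * e * (f / (a * b)) - g / c * h * (k / (a * b))) * (a * b * c) =
   d * e * f - g * h * k.
  by move=> a0 b0 c0; field; rewrite a0 b0.
rewrite /phase /slope E // /det3 p1 p2 q1 q2 r1 r2.
have RC (p q r s : R) : (p * q + r * s)%:C = p%:C * q%:C + r%:C * s%:C :> R[i].
  by rewrite rmorphD !rmorphM.
have RB (p q r s : R) : (p * q - r * s)%:C = p%:C * q%:C - r%:C * s%:C :> R[i].
  by rewrite rmorphB !rmorphM.
rewrite /rcos /rsin !RC !RB.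
have cs' : (dirC y P)%:C * (dirC y P)%:C + (dirS y P)%:C * (dirS y P)%:C = 1 :> R[i].
  by rewrite -RC -!expr2 cs.
have G (a a1 a2 z z1 z2 C S C1 S1 C2 S2 : R[i]) : C * C + S * S = 1 ->
  a * (z1 * C1 * (z2 * S2) - z1 * S1 * (z2 * C2)) -
  z * C * (a1 * (z2 * S2) - z1 * S1 * a2) + z * S * (a1 * (z2 * C2) - z1 * C1 * a2) =
  z2 * (C * S2 - S * C2) * (a * z1 * (C * C1 + S * S1) - z * a1)
  - z1 * (C * S1 - S * C1) * (a * z2 * (C * C2 + S * S2) - z * a2).
  move=> h; have -> : a * (z1 * C1 * (z2 * S2) - z1 * S1 * (z2 * C2)) =
    a * (z1 * C1 * (z2 * S2) - z1 * S1 * (z2 * C2)) * (C * C + S * S) by rewrite h mulr1.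
  by ring.
exact: G.
Qed.

(** The difference zeta_Q z_0 - zeta z_0Q is a multiple of u_Q v - u v_Q. *)
Lemma slopeE y P Q : 0 < y -> y < 1 / 2 -> torus y P -> torus y Q ->
  slope y P Q = (ucoord y Q / ucoord y P - vcoord y Q / vcoord y P) / (2 * 'i%C)
    + zcoord P 0 * zeta y Q * (rcos y P Q - 1)%:C / (ucoord y P * vcoord y P).
Proof.
move=> y0 y2 Pt Qt; have [u0 v0 _] := coord_neq0 y0 y2 Pt.
have i0 : 'i%C != 0 :> R[i] by rewrite -normc_gt0 normc_i.
have -> : (ucoord y Q / ucoord y P - vcoord y Q / vcoord y P) / (2 * 'i%C) =
  (zcoord P 0 * zeta y Q - zeta y P * zcoord Q 0) / (ucoord y P * vcoord y P).
  have E : ucoord y Q * vcoord y P - vcoord y Q * ucoord y P =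
      2 * 'i%C * (zcoord P 0 * zeta y Q - zeta y P * zcoord Q 0).
    by rewrite /ucoord /vcoord; ring.
  have -> : zcoord P 0 * zeta y Q - zeta y P * zcoord Q 0 =
      (ucoord y Q * vcoord y P - vcoord y Q * ucoord y P) / (2 * 'i%C).
    by rewrite E; field.
  by field; rewrite u0 v0.
rewrite -mulrDl /slope; congr (_ / _); rewrite rmorphB /=; ring.
Qed.

Lemma Re_unit_sub1 (a : R[i]) : sqn a = 1 -> 1 - ReC a = normc (a - 1) ^+ 2 / 2.
Proof. by rewrite sqr_normc_sqn; case: a => p q; rewrite /sqn /= => h; rewrite sqrrB; lra. Qed.

Lemma sqn_div (a b : R[i]) : b != 0 -> sqn a = sqn b -> sqn (a / b) = 1.
Proof.
move=> b0 h; have : sqn (a / b) * sqn b = sqn b by rewrite -sqnM divfK.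
move=> /(congr1 (fun x => x / sqn b)); rewrite mulfK ?divff //;
  by rewrite -sqr_normc_sqn expf_neq0 // gt_eqF // normc_gt0.
Qed.

Lemma rcos_sub1 y P Q : 0 < y -> y < 1 / 2 -> torus y P -> torus y Q ->
  1 - rcos y P Q = ((dirC y Q - dirC y P) ^+ 2 + (dirS y Q - dirS y P) ^+ 2) / 2.
Proof.
move=> y0 y2 Pt Qt.
have [cs _ _ _ _] := torus_coordP y0 y2 Pt; have [cs' _ _ _ _] := torus_coordP y0 y2 Qt.
by rewrite /rcos !sqrrB; move: cs cs'; clear; lra.
Qed.

Lemma sqr_le_norm (a e : R) : `|a| <= e -> a ^+ 2 <= e ^+ 2.
Proof.
move=> h; have e0 : 0 <= e by apply: le_trans h.
by rewrite -[leLHS]ger0_norm ?sqr_ge0 // normrX ler_pXn2r ?nnegrE.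
Qed.

(** For unit numbers alpha and beta close to 1, the imaginary part of
    (alpha - beta) / 2i is a difference of two cosines, of second order. *)
Lemma slope_bound y : 0 < y -> y < 1 / 2 -> exists2 c, 0 < c &
  forall e P Q, 0 <= e -> e <= 1 -> torus y P -> torus y Q -> torus_close y e P Q ->
    [/\ `|rsin y P Q| <= c * e, normc (slope y P Q) <= c * e &
        `|ImC (slope y P Q)| <= c * e ^+ 2].
Proof.
move=> y0 y2; pose k := 4 / y.
have k0 : 0 < k by rewrite divr_gt0.
exists (2 + k); first by rewrite addr_gt0.
move=> e P Q e0 e1 Pt Qt [hC hS hu hv _].
have [cs _ _ uP vP] := torus_coordP y0 y2 Pt; have [cs' _ _ uQ vQ] := torus_coordP y0 y2 Qt.
have [u0 v0 z0] := coord_neq0 y0 y2 Pt.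
have CP := sqr_le1 cs; have SP : `|dirS y P| <= 1 by apply: (@sqr_le1 _ (dirC y P)); rewrite addrC.
have ee : e ^+ 2 <= e by rewrite expr2 ler_piMr.
have ke : k * e ^+ 2 <= k * e by rewrite ler_pM2l.
have sb : `|rsin y P Q| <= 2 * e.
  have -> : rsin y P Q = dirC y P * (dirS y Q - dirS y P) - dirS y P * (dirC y Q - dirC y P).
    by rewrite /rsin; ring.
  have T (p q r s : R) : `|p| <= 1 -> `|q| <= e -> `|r| <= 1 -> `|s| <= e ->
      `|p * q - r * s| <= 2 * e.
    move=> hp hq hr hs; apply: le_trans (ler_normB _ _) _; rewrite !normrM.
    have : `|p| * `|q| <= 1 * e by apply: ler_pM.
    have : `|r| * `|s| <= 1 * e by apply: ler_pM.
    clear; lra.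
  exact: T.
have kc : 0 <= k * e by rewrite mulr_ge0 // ltW.
rewrite (slopeE y0 y2 Pt Qt).
set al := ucoord y Q / _ in hu *; set be := vcoord y Q / _ in hv *.
have nal : sqn al = 1 by apply: sqn_div; rewrite // uP uQ.
have nbe : sqn be = 1 by apply: sqn_div; rewrite // vP vQ.
set Y := zcoord P 0 * _ * _ / _.
have Yb : normc Y <= k * e ^+ 2.
  have h1 : normc (zcoord P 0) <= 2.
    apply: normc_sq_ge => //; have := sqn_zeta_coord y0 y2 Pt.
    have := sqn_ge0 (zeta y P); clear; lra.
  have h2 := zeta_le y0 y2 Qt.
  have h3 : normc (rcos y P Q - 1)%:C <= e ^+ 2.
    rewrite normcR distrC (rcos_sub1 y0 y2 Pt Qt) ger0_norm; last first.
      by rewrite divr_ge0 // addr_ge0 ?sqr_ge0.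
    by have := sqr_le_norm hC; have := sqr_le_norm hS; clear; lra.
  have E : normc Y * (normc (ucoord y P) * normc (vcoord y P)) =
      normc (zcoord P 0) * normc (zeta y Q) * normc (rcos y P Q - 1)%:C.
    by rewrite -!normcM /Y divfK // mulf_neq0.
  have h4 : 2 * y <= normc (ucoord y P) * normc (vcoord y P).
    rewrite -[leLHS]mulr1; apply: ler_pM => //; first lra.
      exact: ucoord_ge.
    exact: vcoord_ge.
  have h5 : normc Y * (2 * y) <= 2 * 2 * e ^+ 2.
    apply: le_trans (_ : normc Y * (normc (ucoord y P) * normc (vcoord y P)) <= _).
      by rewrite ler_wpM2l ?normc_ge0.
    rewrite E; apply: ler_pM => //; rewrite ?mulr_ge0 ?normc_ge0 //.
    by apply: ler_pM => //; rewrite ?normc_ge0.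
  have y20 : 0 < 2 * y by rewrite mulr_gt0.
  rewrite -(ler_pM2r y20); apply: le_trans h5 _; rewrite /k.
  have -> : 4 / y * e ^+ 2 * (2 * y) = 8 * e ^+ 2 by field; rewrite gt_eqF.
  by have := sqr_ge0 e; clear; lra.
have aE : (al - be) / (2 * 'i%C) = - ('i%C / 2) * ((al - 1) - (be - 1)).
  apply: (canLR (mulfK _)).
    by rewrite mulf_neq0 ?pnatr_eq0 // -normc_gt0 normc_i.
  have i2 : 'i%C * 'i%C = -1 :> R[i] by rewrite -expr2 sqr_i.
  have -> : - ('i%C / 2) * (al - 1 - (be - 1)) * (2 * 'i%C) = - ('i%C * 'i%C) * (al - be) by field.
  by rewrite i2 opprK mul1r.
split.
- by apply: le_trans sb _; clear - kc; lra.
- apply: le_trans (normcD _ _) _; rewrite aE normcM.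
  have h1 : normc (- ('i%C / 2) : R[i]) = 1 / 2.
    have -> : 'i%C / 2 = 'i%C * (1 / 2)%:C :> R[i].
      by rewrite rmorphM fmorphV rmorph1 rmorph_nat mul1r.
    by rewrite normcN normcM normc_i normcR mul1r ger0_norm.
  have h2 := normcB (al - 1) (be - 1).
  rewrite h1; clear - h2 hu hv Yb ke e0; lra.
- rewrite ImD.
  have h1 : ImC ((al - be) / (2 * 'i%C)) = - (ReC al - ReC be) / 2.
    have -> : (al - be) / (2 * 'i%C) = - ('i%C * (1 / 2)%:C) * (al - be).
      rewrite aE rmorphM fmorphV rmorph1 rmorph_nat mul1r; ring.
    by case: (al) (be) => a1 a2 [b1 b2] /=; field.
  have h2 := Im_le_normc Y.
  apply: le_trans (ler_normD _ _) _; rewrite h1.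
  have h3 := Re_unit_sub1 nal; have h4 := Re_unit_sub1 nbe.
  have h5 := sqr_le_norm (_ : `|normc (al - 1)| <= e).
  rewrite (ger0_norm (normc_ge0 _)) in h5; have {}h5 := h5 hu.
  have h6 := sqr_le_norm (_ : `|normc (be - 1)| <= e).
  rewrite (ger0_norm (normc_ge0 _)) in h6; have {}h6 := h6 hv.
  have h7 : `|- (ReC al - ReC be) / 2| <= e ^+ 2.
    rewrite ler_norml; have := sqr_ge0 (normc (al - 1)); have := sqr_ge0 (normc (be - 1)).
    by clear - h3 h4 h5 h6; lra.
  have e2 := sqr_ge0 e; clear - h7 h2 Yb e2; lra.
Qed.

(** Every factor in [det3_phase] is real up to an error one order smaller than the
    bound on its size, while [det3_lower] bounds the modulus below by the order of the
    main term: the determinant is close to a nonzero real multiple of the phase. *)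
Lemma det3_phase_Re y K k : 0 < y -> y < 1 / 2 -> 0 < K -> 0 < k -> exists2 d1, 0 < d1 &
  forall d P Q1 Q2, 0 < d -> d <= d1 -> torus y P -> torus y Q1 -> torus y Q2 ->
    triple K k d P Q1 Q2 -> ReC (det3 P Q1 Q2 / phase y P) != 0.
Proof.
move=> y0 y2 K0 k0.
have [c1 c10 lip] := torus_lipschitz y0 y2; have [c2 c20 sl] := slope_bound y0 y2.
pose M := c1 * K.
have M0 : 0 < M by rewrite mulr_gt0.
(* Im <= C d ^ 3 and m d ^ 2 <= modulus: a zero real part is impossible for small d *)
pose C := 4 * c2 ^+ 2 * M ^+ 3.
have C0 : 0 < C by rewrite !mulr_gt0 ?exprn_gt0.
pose m := k / 32.
have m0 : 0 < m by rewrite divr_gt0.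
pose d1 := Num.min (k / (4 * K)) (Num.min M^-1 (m / (2 * C))).
have d10 : 0 < d1 by rewrite !lt_min invr_gt0 M0 !divr_gt0 // mulr_gt0.
exists d1 => // d P Q1 Q2 d0; rewrite !le_min => /andP[dk /andP[dM dm]] Pt Q1t Q2t tr.
have ph0 := phase_neq0 y0 y2 Pt.
have PS := torus_sphere Pt.
pose e := M * d.
have e0 : 0 <= e by rewrite mulr_ge0 // ltW.
have e1 : e <= 1 by rewrite /e mulrC -ler_pdivlMr // div1r.
have close Q : torus y Q -> `|Q - P| <= K * d -> torus_close y e P Q.
  move=> Qt h; have h' : c1 * `|Q - P| <= e by rewrite /e -mulrA ler_pM2l.
  have [t1 t2 t3 t4 t5] := lip P Q Pt Qt.
  by split; apply: le_trans h'.
have [[qp rp _ _ _] _] := tr.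
have cl1 := close _ Q1t qp; have cl2 := close _ Q2t rp.
have [r1 n1 i1] := sl e P Q1 e0 e1 Pt Q1t cl1; have [r2 n2 i2] := sl e P Q2 e0 e1 Pt Q2t cl2.
have T (a w : R[i]) (s : R) : normc (a - 1) <= e -> `|s| <= c2 * e -> normc w <= c2 * e ->
    `|ImC w| <= c2 * e ^+ 2 -> `|ImC (a * s%:C * w)| <= 2 * c2 ^+ 2 * e ^+ 3.
  move=> ha hs hw hi.
  have -> : a * s%:C * w = s%:C * ((a - 1) * w + w) by ring.
  rewrite ImM /= mul0r addr0 normrM ImD.
  have -> : 2 * c2 ^+ 2 * e ^+ 3 = c2 * e * (e * (c2 * e) + c2 * e ^+ 2) by ring.
  apply: ler_pM => //; apply: le_trans (ler_normD _ _) _; apply: lerD => //.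
  apply: le_trans (Im_le_normc _) _; rewrite normcM.
  by apply: ler_pM; rewrite ?normc_ge0.
have Imb : `|ImC (det3 P Q1 Q2 / phase y P)| <= C * d ^+ 3.
  rewrite (det3_phase y0 y2 Pt Q1t Q2t) ImB.
  apply: le_trans (ler_normB _ _) _.
  have b2 := T _ _ _ (close_zeta cl2) r2 n1 i1.
  have b1 := T _ _ _ (close_zeta cl1) r1 n2 i2.
  apply: le_trans (lerD b2 b1) _.
  by rewrite /C /e le_eqVlt; apply/orP; left; apply/eqP; clear; ring.
have low : m * d ^+ 2 <= normc (det3 P Q1 Q2 / phase y P).
  have h1 := det3_lower K0 k0 d0 dk PS tr.
  have [_ _ _ uP vP] := torus_coordP y0 y2 Pt.
  have zb : sqn (zeta y P) <= 2.
    have := sqn_zeta_coord y0 y2 Pt; have := sqn_ge0 (zcoord P 0); clear; lra.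
  apply: normc_sq_le; first by rewrite mulr_ge0 ?sqr_ge0 // ltW.
  have E : sqn (det3 P Q1 Q2 / phase y P) * sqn (phase y P) = sqn (det3 P Q1 Q2).
    by rewrite -sqnM divfK.
  have pb : sqn (phase y P) <= 32.
    rewrite /phase !sqnM uP vP.
    have yy : 0 <= 16 * (y * (1 - y)) <= 16.
      have := mulr_ge0 (ltW y0) (ltW y0); have : 0 < y * (1 - y) by rewrite mulr_gt0 //; lra.
      by rewrite mulrBr mulr1 => h1' h2'; apply/andP; split; lra.
    have /andP[yy0 yy1] := yy.
    have -> : 4 * y * (4 * (1 - y)) * sqn (zeta y P) = 16 * (y * (1 - y)) * sqn (zeta y P) by ring.
    rewrite (_ : 32 = 16 * 2 :> R); last by clear; ring.
    by apply: ler_pM; rewrite ?sqn_ge0.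
  have h2 : sqn (det3 P Q1 Q2) <= sqn (det3 P Q1 Q2 / phase y P) * 32.
    by rewrite -E ler_wpM2l ?sqn_ge0.
  have -> : (m * d ^+ 2) ^+ 2 = k ^+ 2 * d ^+ 4 / 1024 by rewrite /m; field.
  have h3 : 0 <= k ^+ 2 * d ^+ 4 by rewrite mulr_ge0 // exprn_ge0 // ltW.
  move: h1 h2 h3; move: (sqn (det3 P Q1 Q2)) (sqn (det3 P Q1 Q2 / phase y P)) => X Y.
  clear; lra.
apply/eqP => Re0.
have : normc (det3 P Q1 Q2 / phase y P) <= C * d ^+ 3.
  by apply: le_trans (normc_le_ReIm _) _; rewrite Re0 normr0 add0r.
move=> /(le_trans low).
rewrite (_ : C * d ^+ 3 = C * d * d ^+ 2); last by clear; ring.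
rewrite ler_pM2r ?exprn_gt0 // leNgt => /negP; apply.
apply: le_lt_trans (_ : C * (m / (2 * C)) < _); first by rewrite ler_pM2l.
have -> : C * (m / (2 * C)) = m / 2 by field; rewrite gt_eqF.
by rewrite ltr_pdivrMr // ltr_pMr // ltr1n.
Qed.

Definition imc (a b : R[i]) : R := ReC a * ImC b - ImC a * ReC b.

Lemma om_imc P Q : om P Q = imc (zcoord P 0) (zcoord Q 0) + imc (zcoord P 1) (zcoord Q 1)
  + imc (zcoord P 2) (zcoord Q 2).
Proof. by rewrite /om sum3. Qed.

Lemma imcM (a b : R[i]) : imc a (b * a) = sqn a * ImC b.
Proof. by case: a b => ? ? [? ?]; rewrite /imc /sqn /=; ring. Qed.
Lemma imcZ (a b : R[i]) (p q : R) : imc (a * p%:C) (b * q%:C) = p * q * imc a b.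
Proof. by case: a b => ? ? [? ?]; rewrite /imc /=; ring. Qed.
Lemma imc_uv (a b a' b' : R[i]) :
  imc (a + 'i%C * b) (a' + 'i%C * b') + imc (a - 'i%C * b) (a' - 'i%C * b') =
  2 * (imc a a' + imc b b').
Proof. by case: a b a' b' => ? ? [? ?] [? ?] [? ?]; rewrite /imc /=; ring. Qed.
Lemma imc_le (a b : R[i]) : `|imc a b| <= normc a * normc b.
Proof.
have -> : imc a b = ImC (conjc a * b) by case: a b => ? ? [? ?]; rewrite /imc /=; ring.
apply: le_trans (Im_le_normc _) _; rewrite normcM.
by case: a => a1 a2 /=; rewrite sqrrN.
Qed.

Lemma om_torus y P Q : 0 < y -> y < 1 / 2 -> torus y P -> torus y Q ->
  om P Q = 2 * (y * ImC (ucoord y Q / ucoord y P) + (1 - y) * ImC (vcoord y Q / vcoord y P))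
    + (rcos y P Q - 1) * imc (zeta y P) (zeta y Q).
Proof.
move=> y0 y2 Pt Qt.
have [_ p1 p2 uP vP] := torus_coordP y0 y2 Pt; have [_ q1 q2 _ _] := torus_coordP y0 y2 Qt.
have [u0 v0 _] := coord_neq0 y0 y2 Pt.
rewrite om_imc p1 p2 q1 q2 !imcZ.
have hu : imc (ucoord y P) (ucoord y Q) = 4 * y * ImC (ucoord y Q / ucoord y P).
  by rewrite -uP -imcM divfK.
have hv : imc (vcoord y P) (vcoord y Q) = 4 * (1 - y) * ImC (vcoord y Q / vcoord y P).
  by rewrite -vP -imcM divfK.
have := imc_uv (zcoord P 0) (zeta y P) (zcoord Q 0) (zeta y Q).
rewrite -/(ucoord y P) -/(vcoord y P) -/(ucoord y Q) -/(vcoord y Q) hu hv /rcos.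
move: (imc _ _) (imc _ _) (ImC _) (ImC _) => b a i2 i1.
have T (C S C' S' : R) : 4 * y * i1 + 4 * (1 - y) * i2 = 2 * (a + b) ->
  a + C * C' * b + S * S' * b =
    2 * (y * i1 + (1 - y) * i2) + (C * C' + S * S' - 1) * b.
  move=> h; have {}h : a + b = 2 * (y * i1 + (1 - y) * i2).
    rewrite (_ : 2 * (y * i1 + (1 - y) * i2) = (4 * y * i1 + 4 * (1 - y) * i2) / 2); last by field.
    by rewrite h; field.
  by rewrite -h; ring.
exact: T.
Qed.

(** Up to second order, om P Q is twice the value of the contact form y dA + (1 - y) dB
    on the displacement, where A and B are the arguments of u and v. *)
Lemma horizontal_bound y : 0 < y -> y < 1 / 2 -> exists2 c, 0 < c & forall P Q,
  torus y P -> torus y Q ->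
  `|y * ImC (ucoord y Q / ucoord y P) + (1 - y) * ImC (vcoord y Q / vcoord y P)|
    <= `|om P Q| + c * `|Q - P| ^+ 2.
Proof.
move=> y0 y2; have [c c0 lip] := torus_lipschitz y0 y2.
exists (4 * c ^+ 2); first by rewrite mulr_gt0 // exprn_gt0.
move=> P Q Pt Qt; have h := om_torus y0 y2 Pt Qt.
have [hC hS _ _ _] := lip P Q Pt Qt.
set e := c * `|Q - P| in hC hS.
have r1 : `|rcos y P Q - 1| <= e ^+ 2.
  rewrite distrC (rcos_sub1 y0 y2 Pt Qt) ger0_norm; last first.
    by rewrite divr_ge0 // addr_ge0 ?sqr_ge0.
  by have := sqr_le_norm hC; have := sqr_le_norm hS; clear; lra.
have i1 : `|imc (zeta y P) (zeta y Q)| <= 2 * 2.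
  apply: le_trans (imc_le _ _) _.
  by apply: ler_pM; rewrite ?normc_ge0 ?zeta_le.
have E : `|(rcos y P Q - 1) * imc (zeta y P) (zeta y Q)| <= e ^+ 2 * (2 * 2).
  by rewrite normrM; apply: ler_pM.
have -> : 4 * c ^+ 2 * `|Q - P| ^+ 2 = e ^+ 2 * (2 * 2) by rewrite /e; clear; ring.
move: h E; move: (_ * imc _ _) (y * _ + _) (e ^+ 2 * _) (om P Q) => X Y Z W -> hX.
have -> : Y = (2 * Y + X) / 2 - X / 2 by field.
apply: le_trans (ler_normB _ _) _; rewrite !normrM (_ : `|2^-1| = 2^-1 :> R); last by rewrite ger0_norm.
rewrite (_ : (2 * Y + X) / 2 - X / 2 = Y); last by field.
by have := normr_ge0 (2 * Y + X); have := normr_ge0 X; move: hX; clear; lra.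
Qed.

(** [basept] and [fibrept] are z_0 and zeta in terms of u and v. *)
Definition basept (u w : R[i]) : R[i] := (1 / 2)%:C * (u + w).
Definition fibrept (u w : R[i]) : R[i] := (0 +i* (- (1 / 2))) * (u - w).
Definition param (u w : R[i]) (C S : R) : C3 R :=
  mkC3 (basept u w) (fibrept u w * C%:C) (fibrept u w * S%:C).

Lemma sqn_base_fibre (u w : R[i]) :
  sqn (basept u w) + sqn (fibrept u w) = (sqn u + sqn w) / 2.
Proof.
by case: u w => a b [c d]; rewrite /sqn /basept /fibrept /=; field.
Qed.

Lemma imc_base_fibre (u w : R[i]) : imc (basept u w) (fibrept u w) = (sqn w - sqn u) / 4.
Proof. by case: u w => a b [c d]; rewrite /imc /sqn /basept /fibrept /=; field. Qed.

Lemma imc_base_fibreM (u w a b : R[i]) : imc (basept u w) (basept (u * a) (w * b)) +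
  imc (fibrept u w) (fibrept (u * a) (w * b)) = (sqn u * ImC a + sqn w * ImC b) / 2.
Proof.
case: u w a b => ? ? [? ?] [? ?] [? ?].
by rewrite /imc /sqn /basept /fibrept /=; field.
Qed.

Lemma param_torus y (u w : R[i]) C S : 0 < y -> y < 1 / 2 -> sqn u = 4 * y -> sqn w = 4 * (1 - y) ->
  C ^+ 2 + S ^+ 2 = 1 -> torus y (param u w C S).
Proof.
move=> y0 y2 hu hw cs.
have hC : sqn C%:C + sqn S%:C = 1 by rewrite -cs /sqn /= !expr0n !addr0.
split.
- rewrite sphereE dot_sqn !zmkE !(sqnM (fibrept u w)) -addrA -mulrDr hC mulr1 sqn_base_fibre hu hw.
  by apply/eqP; field.
- have -> : \sum_j zcoord (param u w C S) j ^+ 2 = u * w.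
    rewrite sum3 !zmkE !exprMn -addrA -mulrDr -!rmorphXn -rmorphD cs /= mulr1.
    by case: u w {hu hw} => a b [c d]; rewrite /basept /fibrept !expr2;
      apply: complex_eq; rewrite /=; field.
  rewrite normc_def; congr (_%:C).
  have -> : ReC (u * w) ^+ 2 + ImC (u * w) ^+ 2 = 4 ^+ 2 * (y * (1 - y)).
    by rewrite -/(sqn (u * w)) sqnM hu hw; ring.
  by rewrite sqrtrM ?sqr_ge0 // sqrtr_sqr ger0_norm.
- rewrite !zmkE; move: (fibrept u w) => z.
  by case: z => z1 z2 /=; ring.
Qed.

(** A rotation prescribed by its sine, so that linear relations between infinitesimal
    rotations hold exactly. *)
Definition unitc (a : R) : R[i] := Num.sqrt (1 - a ^+ 2) +i* a.

Lemma unitc_sub1 a : `|a| <= 1 -> 0 <= 1 - ReC (unitc a) <= a ^+ 2.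
Proof.
move=> a1; have a2 : a ^+ 2 <= 1 by have := sqr_le_norm a1; rewrite expr1n.
have c0 := sqrtr_ge0 (1 - a ^+ 2).
have c1 : Num.sqrt (1 - a ^+ 2) <= 1.
  by rewrite -[leRHS]sqrtr1 ler_wsqrtr // gerBl sqr_ge0.
have c2 : Num.sqrt (1 - a ^+ 2) ^+ 2 = 1 - a ^+ 2 by rewrite sqr_sqrtr // subr_ge0.
rewrite /unitc /=; apply/andP; split; first by rewrite subr_ge0.
have : Num.sqrt (1 - a ^+ 2) * Num.sqrt (1 - a ^+ 2) <= Num.sqrt (1 - a ^+ 2) * 1.
  by rewrite ler_wpM2l.
by rewrite mulr1 -expr2 c2; clear; lra.
Qed.

Lemma sqn_unitc a : `|a| <= 1 -> sqn (unitc a) = 1.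
Proof.
move=> a1; have a2 : a ^+ 2 <= 1 by have := sqr_le_norm a1; rewrite expr1n.
by rewrite /sqn /unitc /= sqr_sqrtr ?subr_ge0 // subrK.
Qed.

Lemma normc_unitc_sub1 (a d : R) : `|a| <= d -> d <= 1 -> normc (unitc a - 1) <= 2 * d.
Proof.
move=> ad d1; have a1 : `|a| <= 1 by apply: le_trans d1.
have /andP[h0 h1] := unitc_sub1 a1.
have d0 : 0 <= d by apply: le_trans ad.
apply: le_trans (normc_le_ReIm _) _.
have -> : ReC (unitc a - 1) = - (1 - ReC (unitc a)) by rewrite /=; ring.
have -> : ImC (unitc a - 1) = a by rewrite /= subr0.
rewrite normrN (ger0_norm h0).
have : d ^+ 2 <= d by rewrite expr2 ler_piMr.
have := sqr_le_norm ad; move: h1 ad; clear; lra.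
Qed.

Lemma sqr_half_sub (x e : R) : x ^+ 2 / 2 - e ^+ 2 <= (x + e) ^+ 2.
Proof.
have -> : (x + e) ^+ 2 = (x / 2 + e) ^+ 2 * 2 + x ^+ 2 / 2 - e ^+ 2 by field.
by have := sqr_ge0 (x / 2 + e); lra.
Qed.

Lemma sqn_half_sub (x e : R[i]) : sqn x / 2 - sqn e <= sqn (x + e).
Proof.
case: x e => a b [c d]; rewrite /sqn /=.
by have := sqr_half_sub a c; have := sqr_half_sub b d; lra.
Qed.

(** The second point moves u and v with sines (1 - y) d and - y d, in the kernel of
    the contact form, and the third one turns the direction by d: om p q and om p r
    then vanish exactly. *)
Lemma triple_param y : 0 < y -> y < 1 / 2 -> exists2 k, 0 < k &
  forall d (u w : R[i]), 0 < d -> d <= 1 / 2 -> sqn u = 4 * y -> sqn w = 4 * (1 - y) ->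
  triple 8 k d (param u w 1 0)
    (param (u * unitc ((1 - y) * d)) (w * unitc (- (y * d))) 1 0)
    (param u w (Num.sqrt (1 - d ^+ 2)) d).
Proof.
move=> y0 y2; have x0 : 0 < 1 - 2 * y by lra.
exists (y ^+ 2 * (1 - 2 * y) ^+ 2 / 16).
  by rewrite divr_gt0 // mulr_gt0 // exprn_gt0.
move=> d u w d0 d2 hu hw.
have pt : torus y (param u w 1 0) by apply: param_torus; rewrite // expr1n expr0n addr0.
set p := param u w 1 0 in pt *.
have d1 : d <= 1 by lra.
set al := unitc ((1 - y) * d); set be := unitc (- (y * d)).
have ad : `|(1 - y) * d| <= d.
  by rewrite ger0_norm; [rewrite ger_pMl //; lra|rewrite mulr_ge0 //; lra].
have bd : `|- (y * d)| <= d.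
  by rewrite normrN ger0_norm; [rewrite ger_pMl //; lra|rewrite mulr_ge0 //; lra].
have na : normc (al - 1) <= 2 * d by exact: normc_unitc_sub1.
have nb : normc (be - 1) <= 2 * d by exact: normc_unitc_sub1.
have dn : `|d| <= 1 by rewrite ger0_norm // ltW.
set C := Num.sqrt (1 - d ^+ 2).
have /andP[C0 C1] : 0 <= 1 - C <= d ^+ 2 := unitc_sub1 dn.
have nu : normc u <= 2 by apply: normc_sq_ge; rewrite // hu; lra.
have nw : normc w <= 2 by apply: normc_sq_ge; rewrite // hw; lra.
set q := param (u * al) _ 1 0; set r := param u w C d.
have dq0 : zcoord (q - p) 0 = basept (u * (al - 1)) (w * (be - 1)).
  by rewrite zcoordB !zmkE /basept; ring.
have dq1 : zcoord (q - p) 1 = fibrept (u * (al - 1)) (w * (be - 1)).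
  by rewrite zcoordB !zmkE /fibrept rmorph1; ring.
have dq2 : zcoord (q - p) 2 = 0 by rewrite zcoordB !zmkE rmorph0 !mulr0 subrr.
have dr0 : zcoord (r - p) 0 = 0 by rewrite zcoordB !zmkE subrr.
have dr1 : zcoord (r - p) 1 = fibrept u w * (C - 1)%:C.
  by rewrite zcoordB !zmkE rmorphB rmorph1 mulrBr.
have dr2 : zcoord (r - p) 2 = fibrept u w * d%:C by rewrite zcoordB !zmkE rmorph0 mulr0 subr0.
have nua : normc (u * (al - 1)) <= 4 * d.
  rewrite normcM (_ : 4 * d = 2 * (2 * d)); last by clear; ring.
  by apply: ler_pM; rewrite ?normc_ge0.
have nwb : normc (w * (be - 1)) <= 4 * d.
  rewrite normcM (_ : 4 * d = 2 * (2 * d)); last by clear; ring.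
  by apply: ler_pM; rewrite ?normc_ge0.
have nbase (a b : R[i]) (M : R) : normc a <= M -> normc b <= M -> normc (basept a b) <= M.
  move=> ha hb; rewrite /basept normcM normcR ger0_norm //; have := normcD a b; lra.
have nfib (a b : R[i]) (M : R) : normc a <= M -> normc b <= M -> normc (fibrept a b) <= M.
  move=> ha hb; rewrite /fibrept normcM.
  have -> : normc (0 +i* (- (1 / 2))) = 1 / 2 :> R.
    have -> : 0 +i* (- (1 / 2)) = 'i%C * (- (1 / 2))%:C :> R[i] by apply: complex_eq; rewrite /=; ring.
    by rewrite normcM normc_i normcR mul1r normrN ger0_norm.
  by have := normcB a b; lra.
have nz : normc (fibrept u w) <= 2 by exact: nfib.
have d40 : 0 <= 4 * d by rewrite mulr_ge0 // ltW.
have C1d : `|C - 1| <= d ^+ 2 by rewrite distrC ger0_norm.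
have dd : d ^+ 2 <= d by rewrite expr2 ler_piMr // ltW.
have zb : (1 - 2 * y) ^+ 2 / 4 <= sqn (fibrept u w).
  have h1 : imc (basept u w) (fibrept u w) = 1 - 2 * y.
    by rewrite imc_base_fibre hu hw; field.
  have h2 := imc_le (basept u w) (fibrept u w); rewrite h1 gtr0_norm // in h2.
  have h3 : normc (basept u w) <= 2 by exact: nbase.
  have h4 : 1 - 2 * y <= 2 * normc (fibrept u w).
    by apply: le_trans h2 _; rewrite ler_wpM2r ?normc_ge0.
  have h5 : `|1 - 2 * y| <= 2 * normc (fibrept u w) by rewrite gtr0_norm.
  have := sqr_le_norm h5; rewrite exprMn sqr_normc_sqn; clear; lra.
split; first split.
- apply: le_trans (_ : 4 * d <= _); last by rewrite ler_pM2r //; lra.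
  apply: norm_le_zcoord => // j; case: (I3P j) => ->; rewrite ?dq0 ?dq1 ?dq2.
  + exact: nbase.
  + exact: nfib.
  + by rewrite (_ : 0 = (0 : R)%:C) // normcR normr0.
- apply: le_trans (_ : 4 * d <= _); last by rewrite ler_pM2r //; lra.
  apply: norm_le_zcoord => // j; case: (I3P j) => ->; rewrite ?dr0 ?dr1 ?dr2.
  + by rewrite (_ : 0 = (0 : R)%:C) // normcR normr0.
  + rewrite normcM normcR (_ : 4 * d = 2 * (2 * d)); last by clear; ring.
    apply: ler_pM; rewrite ?normc_ge0 //; move: C1d dd d0; clear; lra.
  + rewrite normcM normcR (_ : 4 * d = 2 * (2 * d)); last by clear; ring.
    by apply: ler_pM; rewrite ?normc_ge0 // (gtr0_norm d0); move: d0; clear; lra.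
- rewrite -[om p q](addrK (om p p)) omvv subr0 addr0.
  have -> : om p q = 0.
    rewrite om_imc /p /q !zmkE !rmorph1 !rmorph0 !mulr0 !mulr1.
    have -> : imc (0 : R[i]) 0 = 0 by rewrite /imc /= !mul0r subrr.
    by rewrite addr0 imc_base_fibreM hu hw /=; ring.
  by rewrite normr0 mulr_ge0 // sqr_ge0.
- have -> : om p r = 0.
    rewrite om_imc /p /r !zmkE !imcZ.
    have T (a : R[i]) : imc a a = 0 by rewrite /imc mulrC subrr.
    by rewrite !T !mulr0 !addr0.
  by rewrite normr0 mulr_ge0 // sqr_ge0.
- rewrite om_imc dq0 dq1 dq2 dr0 dr1 dr2.
  have T (a : R[i]) : imc a 0 = 0 by rewrite /imc /= !mulr0 subrr.
  have T' (a : R[i]) : imc 0 a = 0 by rewrite /imc /= !mul0r subrr.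
  rewrite T T' add0r addr0; apply: le_trans (imc_le _ _) _.
  rewrite normcM normcR (_ : 8 * d ^+ 3 = 4 * d * (2 * d ^+ 2)); last by clear; ring.
  apply: ler_pM; rewrite ?mulr_ge0 ?normc_ge0 //; first exact: nfib.
  by apply: ler_pM; rewrite ?normc_ge0.
move=> l m n; rewrite /sqcomb dot_sqn /comb !zcoordD !zcoordZ dq0 dq1 dq2 dr0 dr1 dr2 !zmkE.
have c0 : 0%:C = 0 :> R[i] by [].
have c1 : 1%:C = 1 :> R[i] by [].
rewrite c0 c1 !mulr0 !addr0 !add0r mulr1.
set U := u * (l%:C + m%:C * (al - 1)); set V := w * (l%:C + m%:C * (be - 1)).
have -> : l%:C * basept u w + m%:C * basept (u * (al - 1)) (w * (be - 1)) = basept U V.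
  by rewrite /basept /U /V; ring.
have -> : l%:C * fibrept u w + m%:C * fibrept (u * (al - 1)) (w * (be - 1)) = fibrept U V.
  by rewrite /fibrept /U /V; ring.
set e := n%:C * (fibrept u w * (C - 1)%:C).
have h1 := sqn_half_sub (fibrept U V) e.
have h2 := sqn_base_fibre U V.
have sR (x : R) : sqn x%:C = x ^+ 2 by rewrite /sqn /= expr0n addr0.
have se : sqn e = n ^+ 2 * (sqn (fibrept u w) * (C - 1) ^+ 2) by rewrite /e !sqnM !sR.
have sX : sqn (n%:C * (fibrept u w * d%:C)) = n ^+ 2 * (sqn (fibrept u w) * d ^+ 2).
  by rewrite !sqnM !sR.
have sV : sqn V = 4 * (1 - y) * ((l - m * (1 - ReC be)) ^+ 2 + m ^+ 2 * (y * d) ^+ 2).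
  by rewrite /V sqnM hw; congr (_ * _); rewrite /sqn /be /unitc /=; ring.
have eb : 0 <= 1 - ReC be <= (y * d) ^+ 2.
  by have := @unitc_sub1 (- (y * d)) (le_trans bd d1); rewrite sqrrN.
have s0 := sqn_ge0 (basept U V); have sU := sqn_ge0 U.
rewrite se in h1; rewrite sX; move: h1 h2 s0 sU; rewrite sV.
move: (sqn (basept U V)) (sqn (fibrept U V)) (sqn (fibrept U V + e)) (sqn U) => XB XF XE XU.
move: zb eb C1d C0; clear - y0 y2 x0 d0 d2; move: (sqn (fibrept u w)) (1 - ReC be) => Z eps.
move=> zb /andP[eps0 eps1] C1d C0 h1 h2 s0 sU.
have sq4 (t : R) : 0 < t -> t <= 1 / 2 -> t ^+ 2 <= 1 / 4.
  move=> t0 t2; have t2' : `|t| <= 1 / 2 by rewrite gtr0_norm.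
  by apply: le_trans (sqr_le_norm t2') _; rewrite le_eqVlt; apply/orP; left; apply/eqP; field.
have dd := sq4 d d0 d2; have yy := sq4 y y0 (ltW y2).
have yd : (y * d) ^+ 2 <= 1 / 4 * 1.
  by rewrite exprMn; apply: ler_pM; rewrite ?sqr_ge0 //; lra.
have e2 : eps ^+ 2 <= (y * d) ^+ 2 / 4.
  rewrite expr2; apply: le_trans (_ : (y * d) ^+ 2 * (1 / 4) <= _); last by lra.
  by apply: ler_pM => //; lra.
have C2 : (C - 1) ^+ 2 <= d ^+ 2 / 4.
  apply: le_trans (sqr_le_norm C1d) _; rewrite [leLHS]expr2.
  apply: le_trans (_ : d ^+ 2 * (1 / 4) <= _); last by lra.
  by apply: ler_pM => //; rewrite sqr_ge0.
have Z0 : 0 <= Z by apply: le_trans zb; rewrite divr_ge0 // sqr_ge0.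
have hm := sqr_half_sub l (- (m * eps)); rewrite sqrrN exprMn in hm.
have m2 := sqr_ge0 m; have n2 := sqr_ge0 n; have l2 := sqr_ge0 l; have dd0 := sqr_ge0 d.
have y2' := sqr_ge0 y.
have me : m ^+ 2 * eps ^+ 2 <= m ^+ 2 * ((y * d) ^+ 2 / 4) by rewrite ler_wpM2l.
have nC : n ^+ 2 * (Z * (C - 1) ^+ 2) <= n ^+ 2 * (Z * (d ^+ 2 / 4)) by rewrite !ler_wpM2l.
have nZ : n ^+ 2 * ((1 - 2 * y) ^+ 2 / 4 * d ^+ 2) <= n ^+ 2 * (Z * d ^+ 2).
  by rewrite ler_wpM2l // ler_wpM2r.
set B := (l - m * eps) ^+ 2 + m ^+ 2 * (y * d) ^+ 2 in h2.
have B0 : 0 <= B.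
  by apply: addr_ge0; [exact: sqr_ge0|apply: mulr_ge0 => //; exact: sqr_ge0].
have hB : 2 * B <= 4 * (1 - y) * B by rewrite ler_wpM2r //; lra.
have q1 : (1 - 2 * y) ^+ 2 <= 1.
  have := @sqr_le_norm (1 - 2 * y) 1; rewrite expr1n gtr0_norm //; apply.
  by move: y0; clear; lra.
have q0 := sqr_ge0 (1 - 2 * y).
have k1 : y ^+ 2 * (1 - 2 * y) ^+ 2 <= 1 / 4 * 1 by apply: ler_pM.
have k2 : y ^+ 2 * (1 - 2 * y) ^+ 2 <= y ^+ 2 * 1 by apply: ler_wpM2l.
have k3 : y ^+ 2 * (1 - 2 * y) ^+ 2 <= 1 / 4 * (1 - 2 * y) ^+ 2 by apply: ler_wpM2r.
set k := y ^+ 2 * (1 - 2 * y) ^+ 2 in k1 k2 k3 *.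
have f1 : k * l ^+ 2 <= 1 / 4 * l ^+ 2 by apply: (ler_wpM2r l2); move: k1; rewrite mulr1.
have f2 : k * (d ^+ 2 * m ^+ 2) <= y ^+ 2 * (d ^+ 2 * m ^+ 2).
  by apply: (ler_wpM2r (mulr_ge0 dd0 m2)); move: k2; rewrite mulr1.
have f3 : k * (d ^+ 2 * n ^+ 2) <= 1 / 4 * (1 - 2 * y) ^+ 2 * (d ^+ 2 * n ^+ 2).
  exact: (ler_wpM2r (mulr_ge0 dd0 n2)).
have g0 : 0 <= y ^+ 2 * (d ^+ 2 * m ^+ 2) := mulr_ge0 y2' (mulr_ge0 dd0 m2).
have g1 : 0 <= (1 - 2 * y) ^+ 2 * (d ^+ 2 * n ^+ 2) := mulr_ge0 q0 (mulr_ge0 dd0 n2).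
have B1 : l ^+ 2 / 2 + y ^+ 2 * (d ^+ 2 * m ^+ 2) * (3 / 4) <= B.
  rewrite /B; have -> : m ^+ 2 * (y * d) ^+ 2 = y ^+ 2 * (d ^+ 2 * m ^+ 2) by ring.
  have E : m ^+ 2 * ((y * d) ^+ 2 / 4) = y ^+ 2 * (d ^+ 2 * m ^+ 2) / 4 by field.
  rewrite E in me; move: hm me; clear; lra.
have nE : n ^+ 2 * (Z * (d ^+ 2 / 4)) = n ^+ 2 * (Z * d ^+ 2) / 4 by field.
have nE' : n ^+ 2 * ((1 - 2 * y) ^+ 2 / 4 * d ^+ 2) = (1 - 2 * y) ^+ 2 * (d ^+ 2 * n ^+ 2) / 4 by field.
rewrite nE in nC; rewrite nE' in nZ.
have -> : k / 16 * (l ^+ 2 + d ^+ 2 * (m ^+ 2 + n ^+ 2)) =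
  (k * l ^+ 2 + k * (d ^+ 2 * m ^+ 2) + k * (d ^+ 2 * n ^+ 2)) / 16 by field.
rewrite -mulrA in f3.
have T (kl km kn l2' P Q N W B' F : R) : kl <= 1 / 4 * l2' -> km <= P -> kn <= 1 / 4 * Q ->
    0 <= P -> 0 <= Q -> l2' / 2 + P * (3 / 4) <= B' -> N <= W / 4 -> Q / 4 <= W ->
    2 * B' <= F -> XF / 2 - N <= XE -> XB + XF = (XU + F) / 2 -> 0 <= XB -> 0 <= XU -> 0 <= l2' ->
    (kl + km + kn) / 16 <= XB + XE + W.
  by clear; lra.
exact: (T _ _ _ _ _ _ _ _ _ _ f1 f2 f3 g0 g1 B1 nC nZ hB h1 h2 s0 sU l2).
Qed.

End Torus.

(** * Arguments along curves in a torus *)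

Section ArgumentLift.
Variable R : realType.
Implicit Types (P Q v w z : C3 R) (y : R).
Local Notation normc := ComplexField.Normc.normc.
Local Notation ReC := complex.Re.
Local Notation ImC := complex.Im.

Lemma mvt_all (f df : R -> R) (a b : R) : (forall x : R, is_derive x 1 f (df x)) ->
  exists2 c, `|c - a| <= `|b - a| & f b - f a = df c * (b - a).
Proof.
move=> d.
have cf : continuous f.
  by move=> x; apply: differentiable_continuous; apply/derivable1_diffP; have [] := d x.
have [ab|/ltW ba] := leP a b.
  have [x] := MVT_segment ab (fun x _ => d x) (continuous_subspaceT cf).
  rewrite in_itv /= => /andP[ax xb] e; exists x => //.
  by rewrite !ger0_norm ?subr_ge0 // lerD2r.
have [x] := MVT_segment ba (fun x _ => d x) (continuous_subspaceT cf).
rewrite in_itv /= => /andP[ax xb] e; exists x.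
  by rewrite !ler0_norm ?subr_le0 // lerN2 lerD2r.
by rewrite -opprB e -mulrN opprB.
Qed.

Lemma sin_lipschitz (a b : R) : `|sin b - sin a| <= `|b - a|.
Proof.
have [x _ ->] := mvt_all a b (@is_derive_sin R).
by rewrite normrM ler_piMl // cos_max.
Qed.

Lemma cos_lipschitz (a b : R) : `|cos b - cos a| <= `|b - a|.
Proof.
have [x _ ->] := mvt_all a b (@is_derive_cos R).
by rewrite normrM ler_piMl // normrN sin_max.
Qed.

Lemma cis_lipschitz (a b : R) : normc (cis b - cis a) <= 2 * `|b - a|.
Proof.
apply: le_trans (normc_le_ReIm _) _; rewrite /cis /=.
by have := sin_lipschitz a b; have := cos_lipschitz a b; lra.
Qed.

Lemma sin_sub_le (x : R) : `|sin x - x| <= x ^+ 2.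
Proof.
have d (t : R) : is_derive t 1 (fun t : R => sin t - t) (cos t - 1) by apply: is_derive_eq.
have [t tx] := mvt_all 0 x d; rewrite sin0 !subr0 => ->.
rewrite normrM -[leRHS]ger0_norm ?sqr_ge0 // normrX expr2 ler_wpM2r //.
by rewrite -[1](@cos0 R); apply: le_trans (cos_lipschitz _ _) _; move: tx; rewrite !subr0.
Qed.

Lemma sin_small_le (x : R) : `|x| <= 1 / 2 -> `|x| <= 2 * `|sin x|.
Proof.
move=> x1; have h := sin_sub_le x.
have : `|x| <= `|sin x| + `|sin x - x| by rewrite -{1}(subKr (sin x) x) ler_normB.
have : x ^+ 2 <= `|x| / 2.
  rewrite -[leLHS]ger0_norm ?sqr_ge0 // normrX expr2.
  by rewrite ler_wpM2l //; lra.
move: h; clear; lra.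
Qed.

Lemma is_derive_quadratic (f : R -> R) (s K : R) :
  (\forall s' \near s, `|f s' - f s| <= K * `|s' - s| ^+ 2) -> is_derive s 1 f 0.
Proof.
move=> h; apply/is_deriveE.
pose K' := Num.max K 1.
have K0 : 0 < K' by rewrite lt_max ltr01 orbT.
apply/cvgr0Pnorm_le => e e0.
have h' : \forall x \near (0 : R)^', `|f (x + s) - f s| <= K * `|x| ^+ 2.
  apply: nbhs_dnbhs; have /nbhs_ballP[r r0 hr] := h.
  apply/nbhs_ballP; exists r => // x; rewrite /ball /= sub0r normrN => xr.
  have := hr (x + s); rewrite /ball /= opprD addrCA subrr addr0 normrN addrK.
  exact.
near=> x.
have x0 : x != 0 by near: x; exact: nbhs_dnbhs_neq.
have nx : 0 < `|x| by rewrite normr_gt0.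
have xe : `|x| <= e / K'.
  near: x; apply: nbhs_dnbhs; apply/nbhs_ballP; exists (e / K') => /=; first exact: divr_gt0.
  by move=> x; rewrite /ball /= sub0r normrN => /ltW.
have hx : `|f (x + s) - f s| <= K * `|x| ^+ 2 by near: x.
rewrite normrZ /= scaler1 normfV ler_pdivrMl // mulrC.
apply: le_trans hx _; rewrite expr2 mulrA ler_pM2r //.
apply: le_trans (_ : K' * `|x| <= _); first by rewrite ler_wpM2r // le_max lexx.
by rewrite mulrC -ler_pdivlMr.
Unshelve. all: by end_near.
Qed.

Lemma ccont_lipschitz (f : R -> R[i]) (L : R) s :
  (forall s s', normc (f s' - f s) <= L * `|s' - s|) -> ccont f s.
Proof.
move=> h.
have K (g : R -> R) : (forall s', `|g s' - g s| <= L * `|s' - s|) -> {for s, continuous g}.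
  move=> hg; apply/cvgrPdist_le => e e0.
  pose L' := Num.max L 1; have L0 : 0 < L' by rewrite lt_max ltr01 orbT.
  near=> t; rewrite distrC; apply: le_trans (hg t) _.
  have ts : `|t - s| <= e / L'.
    near: t; apply/nbhs_ballP; exists (e / L') => /=; first exact: divr_gt0.
    by move=> t; rewrite /ball /= distrC => /ltW.
  apply: le_trans (_ : L' * `|t - s| <= _); first by rewrite ler_wpM2r // le_max lexx.
  by rewrite mulrC -ler_pdivlMr.
split; apply: K => s'; apply: le_trans (h s s').
  by have := Re_le_normc (f s' - f s); case: (f s') (f s) => ? ? [].
by have := Im_le_normc (f s' - f s); case: (f s') (f s) => ? ? [].
Unshelve. all: by end_near.
Qed.

Lemma is_arg_unit (a : R[i]) (x : R) : sqn a = 1 -> is_arg a x -> ImC a = sin x.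
Proof.
move=> a1 [r r0 e]; move: a1; rewrite e sqnM.
have -> : sqn (cis x) = 1 by rewrite /sqn /cis /= cos2Dsin2.
rewrite /sqn /= expr0n addr0 mulr1 => /eqP.
rewrite sqrf_eq1 => /orP[/eqP ->|/eqP r1]; first by rewrite mul0r addr0 mul1r.
by move: r0; rewrite r1 ltr0N1.
Qed.

(** By [horizontal_bound] the increments of y A + (1 - y) B are of second order, so
    that its derivative is zero. *)
Lemma lift_horizontal y (w : R -> C3 R) (L M : R) (A B : R -> R) : 0 < y -> y < 1 / 2 ->
  (forall s, torus y (w s)) -> (forall s s', `|w s' - w s| <= L * `|s' - s|) ->
  (forall s s', `|om (w s) (w s')| <= M * `|s' - s| ^+ 2) ->
  continuous A -> continuous B ->
  (forall s, 0 <= s <= 1 -> is_arg (ucoord y (w s) / ucoord y (w 0)) (A s)) ->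
  (forall s, 0 <= s <= 1 -> is_arg (vcoord y (w s) / vcoord y (w 0)) (B s)) ->
  y * (A 1 - A 0) + (1 - y) * (B 1 - B 0) = 0.
Proof.
move=> y0 y2 wt wL wom cA cB hA hB.
have [c c0 lip] := torus_lipschitz y0 y2; have [k k0 hor] := horizontal_bound y0 y2.
pose G s := y * A s + (1 - y) * B s.
have cG : continuous G.
  by move=> s; apply: cvgD; apply: cvgMr; [exact: cA|exact: cB].
have key (s s' : R) : 0 <= s <= 1 -> 0 <= s' <= 1 -> `|A s' - A s| <= 1 / 2 ->
    `|B s' - B s| <= 1 / 2 ->
    `|G s' - G s| <= (M + k * L ^+ 2 + 4 * (c * L) ^+ 2) * `|s' - s| ^+ 2.
  move=> s01 s01' sA sB.
  set h := `|s' - s|; have h0 : 0 <= h by exact: normr_ge0.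
  have [_ _ hu hv _] := lip _ _ (wt s) (wt s').
  have ch : c * `|w s' - w s| <= c * L * h by rewrite -mulrA ler_pM2l // wL.
  have [us vs _] := coord_neq0 y0 y2 (wt s); have [us0 vs0 _] := coord_neq0 y0 y2 (wt 0).
  have [_ _ _ qu qv] := torus_coordP y0 y2 (wt s); have [_ _ _ qu' qv'] := torus_coordP y0 y2 (wt s').
  have T (a b a0 : R[i]) (x x' : R) : a0 != 0 -> a != 0 -> sqn b = sqn a ->
      is_arg (a / a0) x -> is_arg (b / a0) x' -> `|x' - x| <= 1 / 2 ->
      normc (b / a - 1) <= c * `|w s' - w s| ->
      `|x' - x - ImC (b / a)| <= 4 * (c * L) ^+ 2 * h ^+ 2.
    move=> a00 an ab ax bx xx e.
    have E : is_arg (b / a) (x' - x).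
      have -> : b / a = b / a0 * (a / a0)^-1 by rewrite invf_div mulrA divfK.
      by apply: is_argM => //; exact: is_argV.
    have I := is_arg_unit (sqn_div an ab) E.
    have s1 : `|sin (x' - x)| <= c * L * h.
      rewrite -I; have -> : ImC (b / a) = ImC (b / a - 1) by rewrite ImB subr0.
      by apply: le_trans (Im_le_normc _) _; apply: le_trans e _.
    have s2 : `|x' - x| <= 2 * (c * L * h).
      by apply: le_trans (sin_small_le xx) _; rewrite ler_pM2l.
    rewrite I distrC; apply: le_trans (sin_sub_le _) _.
    by apply: le_trans (sqr_le_norm s2) _; rewrite le_eqVlt; apply/orP; left; apply/eqP; ring.
  have tA := T _ _ _ _ _ us0 us (etrans qu' (esym qu)) (hA s s01) (hA s' s01') sA hu.
  have tB := T _ _ _ _ _ vs0 vs (etrans qv' (esym qv)) (hB s s01) (hB s' s01') sB hv.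
  have hz := hor _ _ (wt s) (wt s').
  have h1 := wom s s'; rewrite -/h in h1.
  have h2 : k * `|w s' - w s| ^+ 2 <= k * L ^+ 2 * h ^+ 2.
    rewrite -mulrA -exprMn ler_pM2l // -[leLHS]ger0_norm ?sqr_ge0 // normrX normr_id.
    by apply: sqr_le_norm; rewrite normr_id wL.
  have -> : G s' - G s = (y * ImC (ucoord y (w s') / ucoord y (w s)) +
       (1 - y) * ImC (vcoord y (w s') / vcoord y (w s))) +
     (y * (A s' - A s - ImC (ucoord y (w s') / ucoord y (w s))) +
      (1 - y) * (B s' - B s - ImC (vcoord y (w s') / vcoord y (w s)))) by rewrite /G; ring.
  have y1 : 0 < 1 - y by lra.
  apply: le_trans (ler_normD _ _) _; apply: le_trans (lerD hz (ler_normD _ _)) _.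
  rewrite (normrM y) (normrM (1 - y)) (gtr0_norm y0) (gtr0_norm y1).
  have tA' := ler_wpM2l (ltW y0) tA; have tB' := ler_wpM2l (ltW y1) tB.
  apply: le_trans (lerD (lerD h1 h2) (lerD tA' tB')) _.
  by rewrite le_eqVlt; apply/orP; left; apply/eqP; ring.
have d0 (s : R) : s \in `]0, 1[%R -> is_derive s 1 G 0.
  rewrite in_itv /= => /andP[s0 s1]; apply: is_derive_quadratic.
  near=> s'; apply: key.
  - by rewrite !ltW.
  - have : s' \in `]0, 1[%R by near: s'; apply: near_in_itvoo; rewrite in_itv /= s0.
    by rewrite in_itv /= => /andP[? ?]; rewrite !ltW.
  - near: s'; have /cvgrPdist_le /(_ (1 / 2) ltac:(by [])) := cA s.
    by apply: filterS => s'; rewrite distrC.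
  - near: s'; have /cvgrPdist_le /(_ (1 / 2) ltac:(by [])) := cB s.
    by apply: filterS => s'; rewrite distrC.
have [x _] := MVT_segment ler01 d0 (continuous_subspaceT cG).
by rewrite mul0r => e; rewrite -[RHS]e /G; ring.
Unshelve. all: by end_near.
Qed.

Lemma dir_cmul y (a : R[i]) z : `|a| = 1 ->
  dirC y (cmul a z) = dirC y z /\ dirS y (cmul a z) = dirS y z.
Proof.
move=> /norm1_sqn a1.
have M j : mom j (cmul a z) = mom j z.
  have -> : mom j (cmul a z) = sqn a * mom j z by rewrite /mom /sqn /cmul /= !mxE; ring.
  by rewrite a1 mul1r.
by rewrite /dirC /dirS !M.
Qed.

Lemma uv_cmul y (a : R[i]) z : `|a| = 1 ->
  [/\ ucoord y (cmul a z) = a * ucoord y z, vcoord y (cmul a z) = a * vcoord y z &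
      phase y (cmul a z) = a ^+ 3 * phase y z].
Proof.
move=> a1; have [hC hS] := dir_cmul y z a1.
have hz : zeta y (cmul a z) = a * zeta y z by rewrite /zeta hC hS !zcoord_cmul; ring.
by split; rewrite ?/phase /ucoord /vcoord hz !zcoord_cmul; ring.
Qed.

Lemma zetaE y z : zeta y z = (ucoord y z - vcoord y z) / (2 * 'i%C).
Proof.
have i0 : 2 * 'i%C != 0 :> R[i] by rewrite mulf_neq0 ?pnatr_eq0 // -normc_gt0 normc_i.
by apply: (canRL (mulfK i0)); rewrite /ucoord /vcoord; ring.
Qed.

Lemma uv_gap y z : 0 < y -> y < 1 / 2 -> torus y z -> 0 < ReC (1 - ucoord y z / vcoord y z).
Proof.
move=> y0 y2 zt; have [_ v0 _] := coord_neq0 y0 y2 zt.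
have [_ _ _ hu hv] := torus_coordP y0 y2 zt.
have h : normc (ucoord y z / vcoord y z) < 1.
  have e : normc (ucoord y z / vcoord y z) * normc (vcoord y z) = normc (ucoord y z).
    by rewrite -normcM divfK.
  have v1 : 0 < normc (vcoord y z) by rewrite normc_gt0.
  rewrite -(ltr_pM2r v1) e mul1r.
  rewrite -(@ltr_pXn2r _ 2) ?nnegrE ?normc_ge0 // !sqr_normc_sqn hu hv; lra.
have h' := Re_le_normc (ucoord y z / vcoord y z).
have -> : ReC (1 - ucoord y z / vcoord y z) = 1 - ReC (ucoord y z / vcoord y z).
  by case: (ucoord y z / vcoord y z).
by have := ler_norm (ReC (ucoord y z / vcoord y z)); move: h h'; clear; lra.
Qed.

Lemma phase_ratio y z w : 0 < y -> y < 1 / 2 -> torus y z -> torus y w ->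
  phase y w / phase y z =
    ucoord y w / ucoord y z * (vcoord y w / vcoord y z) ^+ 2 *
    ((1 - ucoord y w / vcoord y w) * (1 - ucoord y z / vcoord y z)^-1).
Proof.
move=> y0 y2 zt wt.
have [u0 v0 z0] := coord_neq0 y0 y2 zt; have [u1 v1 z1] := coord_neq0 y0 y2 wt.
have i0 : 'i%C != 0 :> R[i] by rewrite -normc_gt0 normc_i.
move: z0 z1; rewrite /phase !zetaE.
move: (ucoord y z) (vcoord y z) (ucoord y w) (vcoord y w) u0 v0 u1 v1 => a b c d a0 b0 c0 d0.
rewrite !mulf_eq0 !negb_or => /andP[ab _] /andP[cd _].
have ba : b - a != 0 by rewrite subr_eq0 eq_sym -subr_eq0.
by field; rewrite ?c0 a0 b0 d0 i0 ab ba.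
Qed.

Lemma argN (a : R[i]) : arg (- a) = arg a.
Proof. by case: a => p q; rewrite /arg /= invrN mulrNN. Qed.

Lemma ReN (a : R[i]) : ReC (- a) = - ReC a.
Proof. by case: a. Qed.

Lemma is_arg_same_sign (a b : R[i]) : 0 < ReC a * ReC b -> is_arg (a / b) (arg a - arg b).
Proof.
move=> h; have [b0|b0|b0] := ltrgtP (ReC b) 0; last first.
- by move: h; rewrite b0 mulr0 ltxx.
- by apply: is_argM; [|apply: is_argV]; apply: is_arg_arg => //; rewrite -(pmulr_lgt0 _ b0).
have -> : a / b = (- a) / (- b) by rewrite invrN mulrNN.
rewrite -(argN a) -(argN b).
apply: is_argM; [|apply: is_argV]; apply: is_arg_arg; rewrite ReN oppr_gt0 //.
by rewrite -(nmulr_lgt0 _ b0).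
Qed.

Lemma ccontN f (s : R) : ccont f s -> ccont (fun s => - f s) s.
Proof.
move=> h; rewrite (_ : (fun s => _) = (fun s => (-1) * f s)); last first.
  by apply/funext => x; rewrite mulN1r.
exact: (ccontM (ccont_cst (-1) s) h).
Qed.

Lemma continuous_arg_neq0 f (s : R) : ccont f s -> ReC (f s) != 0 ->
  {for s, continuous (fun s => arg (f s))}.
Proof.
move=> cf; rewrite neq_lt => /orP[h|h]; last exact: continuous_arg.
rewrite (_ : (fun s => _) = (fun s => arg (- f s))); last by apply/funext => x; rewrite argN.
by apply: continuous_arg; [exact: ccontN|rewrite ReN oppr_gt0].
Qed.

Lemma Re_same_sign (f : R -> R[i]) : (forall s, ccont f s) -> (forall s, ReC (f s) != 0) ->
  forall s, 0 < ReC (f s) * ReC (f 0).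
Proof.
move=> cf f0 s; rewrite ltNge; apply/negP => h.
pose g (x : R) := ReC (f x) * ReC (f 0).
have cg : continuous g by move=> x; apply: cvgMl; exact: (cf x).1.
have {}h : g s <= 0 := h.
have g0 : 0 <= g 0 by rewrite /g -expr2 sqr_ge0.
have Z (x : R) : g x != 0 by rewrite /g mulf_neq0.
have [s0|/ltW s0] := leP s 0.
  have [||x _ /eqP] := @IVT _ g s 0 0 s0; first exact: continuous_subspaceT.
    by rewrite ge_min le_max g0 h orbT.
  by rewrite (negPf (Z x)).
have [||x _ /eqP] := @IVT _ g 0 s 0 s0; first exact: continuous_subspaceT.
  by rewrite ge_min le_max g0 h orbT.
by rewrite (negPf (Z x)).
Qed.

(** The phase is a constant multiple of u v ^ 2 (1 - u / v). As |u| < |v|, the factor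
    1 - u / v stays in the right half plane, so that its argument returns to its initial
    value when u and v are multiplied by the same number; so does the argument of the
    quotient of D by the phase, whose real part never vanishes. *)
Lemma phase_lift y (w : R -> C3 R) (D : R -> R[i]) (A B : R -> R) (a : R[i]) :
  0 < y -> y < 1 / 2 -> (forall s, torus y (w s)) ->
  (forall s, ccont (fun s => ucoord y (w s)) s) -> (forall s, ccont (fun s => vcoord y (w s)) s) ->
  (forall s, ccont D s) -> (forall s, ReC (D s / phase y (w s)) != 0) ->
  continuous A -> continuous B ->
  (forall s, 0 <= s <= 1 -> is_arg (ucoord y (w s) / ucoord y (w 0)) (A s)) ->
  (forall s, 0 <= s <= 1 -> is_arg (vcoord y (w s) / vcoord y (w 0)) (B s)) ->
  `|a| = 1 -> w 1 = cmul a (w 0) -> D 1 = a ^+ 3 * D 0 ->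
  exists th : R -> R, [/\ continuous th,
    forall s, 0 <= s <= 1 -> is_arg (D s / D 0) (th s) &
    th 1 - th 0 = (A 1 - A 0) + 2 * (B 1 - B 0)].
Proof.
move=> y0 y2 wt cu cv cD D0 cA cB hA hB a1 w1 D1.
have nz s := coord_neq0 y0 y2 (wt s).
have v0 s : vcoord y (w s) != 0 by have [] := nz s.
have u0 s : ucoord y (w s) != 0 by have [] := nz s.
have z0 s : zeta y (w s) != 0 by have [] := nz s.
have p0 s : phase y (w s) != 0 by exact: phase_neq0.
pose h s := 1 - ucoord y (w s) / vcoord y (w s).
have ch s : ccont h s.
  apply: ccontD; first exact: ccont_cst.
  by apply: ccontN; apply: ccontM; [exact: cu|apply: ccontV; [exact: v0|exact: cv]].
have h0 s : 0 < ReC (h s) by exact: uv_gap.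
pose r s := D s / phase y (w s).
have cr s : ccont r s.
  apply: ccontM; first exact: cD.
  apply: (ccontV (p0 s)); apply: ccontM; first by apply: ccontM; [exact: cu|exact: cv].
  rewrite (_ : (fun s => _) = (fun s => (ucoord y (w s) + - vcoord y (w s)) * (2 * 'i%C)^-1)).
    apply: ccontM; last exact: ccont_cst.
    by apply: ccontD; [exact: cu|apply: ccontN; exact: cv].
  by apply/funext => x; rewrite zetaE.
pose th s := A s + (B s + B s) + (arg (h s) - arg (h 0)) + (arg (r s) - arg (r 0)).
exists th; split.
- move=> s; apply: cvgD; last first.
    by apply: cvgD; [exact: (continuous_arg_neq0 (cr s) (D0 s))|exact: cvg_cst].
  apply: cvgD; last by apply: cvgD; [exact: (continuous_arg (ch s) (h0 s))|exact: cvg_cst].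
  by apply: cvgD; [exact: cA|apply: cvgD; exact: cB].
- move=> s s01.
  have -> : D s / D 0 = ucoord y (w s) / ucoord y (w 0) *
      (vcoord y (w s) / vcoord y (w 0) * (vcoord y (w s) / vcoord y (w 0))) *
      (h s * (h 0)^-1) * (r s / r 0).
    rewrite -expr2 -(phase_ratio y0 y2 (wt 0) (wt s)) /r.
    have D00 : D 0 != 0 by apply: contra (D0 0) => /eqP ->; rewrite mul0r.
    by field; rewrite !p0 D00.
  apply: is_argM; last by apply: is_arg_same_sign; exact: Re_same_sign.
  apply: is_argM; last by apply: is_arg_same_sign; rewrite mulr_gt0.
  by apply: is_argM; [exact: hA|apply: is_argM; exact: hB].
have [hu hv hp] := uv_cmul y (w 0) a1; rewrite -w1 in hu hv hp.
have a0 : a != 0 by rewrite -normr_gt0 a1.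
have -> : th 1 - th 0 = A 1 - A 0 + 2 * (B 1 - B 0) + (arg (h 1) - arg (h 0)) +
  (arg (r 1) - arg (r 0)) by rewrite /th; ring.
have -> : h 1 = h 0 by rewrite /h hu hv -mulf_div divff // mul1r.
have -> : r 1 = r 0 by rewrite /r hp D1 -mulf_div divff ?expf_neq0 // mul1r.
by rewrite !subrr !addr0.
Qed.

End ArgumentLift.

(** * Families of solution curves *)

Section SolutionFamilies.
Variable R : realType.
Implicit Types (P Q v w z : C3 R) (y : R).
Local Notation normc := ComplexField.Normc.normc.
Local Notation ReC := complex.Re.
Local Notation ImC := complex.Im.

Lemma det3_lipschitz p q r p' q' r' (e : R) : p \in @sphere R -> q \in @sphere R ->
  r \in @sphere R -> p' \in @sphere R -> q' \in @sphere R -> r' \in @sphere R ->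
  `|p' - p| <= e -> `|q' - q| <= e -> `|r' - r| <= e ->
  normc (det3 p' q' r' - det3 p q r) <= 576 * e.
Proof.
move=> pS qS rS p'S q'S r'S hp hq hr.
have e0 : 0 <= e by apply: le_trans hp.
have T (a b c a' b' c' : R[i]) : normc a <= 4 -> normc b <= 4 -> normc b' <= 4 ->
    normc c' <= 4 -> normc (a' - a) <= 2 * e ->
    normc (b' - b) <= 2 * e -> normc (c' - c) <= 2 * e ->
    normc (a' * b' * c' - a * b * c) <= 96 * e.
  move=> na nb nb' nc' da db dc.
  have -> : a' * b' * c' - a * b * c =
     (a' - a) * (b' * c') + ((b' - b) * (a * c') + (c' - c) * (a * b)) by ring.
  have S (x d1 d2 : R[i]) : normc x <= 2 * e -> normc d1 <= 4 -> normc d2 <= 4 ->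
     normc (x * (d1 * d2)) <= 2 * e * (4 * 4).
    move=> hx h1 h2; rewrite !normcM; apply: ler_pM; rewrite ?mulr_ge0 ?normc_ge0 //.
    by apply: ler_pM; rewrite ?normc_ge0.
  apply: le_trans (normcD _ _) _.
  apply: le_trans (lerD (S _ _ _ da nb' nc') (normcD _ _)) _.
  apply: le_trans (lerD (lexx _) (lerD (S _ _ _ db na nc') (S _ _ _ dc na nb))) _.
  by clear; lra.
have N x j : x \in @sphere R -> normc (zcoord x j) <= 4 by exact: normc_zcoord_sphere.
have Df x x' j : `|x' - x| <= e -> normc (zcoord x' j - zcoord x j) <= 2 * e.
  by move=> h; rewrite -zcoordB; apply: le_trans (normc_zcoord _ _) _; rewrite ler_pM2l.
have M i j k : normc (zcoord p' i * zcoord q' j * zcoord r' k -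
    zcoord p i * zcoord q j * zcoord r k) <= 96 * e by apply: T; auto.
have -> : det3 p' q' r' - det3 p q r =
  ((zcoord p' 0 * zcoord q' 1 * zcoord r' 2 - zcoord p 0 * zcoord q 1 * zcoord r 2) -
  (zcoord p' 0 * zcoord q' 2 * zcoord r' 1 - zcoord p 0 * zcoord q 2 * zcoord r 1)) -
  ((zcoord p' 1 * zcoord q' 0 * zcoord r' 2 - zcoord p 1 * zcoord q 0 * zcoord r 2) -
  (zcoord p' 1 * zcoord q' 2 * zcoord r' 0 - zcoord p 1 * zcoord q 2 * zcoord r 0)) +
  ((zcoord p' 2 * zcoord q' 0 * zcoord r' 1 - zcoord p 2 * zcoord q 0 * zcoord r 1) -
  (zcoord p' 2 * zcoord q' 1 * zcoord r' 0 - zcoord p 2 * zcoord q 1 * zcoord r 0)).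
  by rewrite /det3; ring.
have B2 (a b : R[i]) : normc a <= 96 * e -> normc b <= 96 * e -> normc (a - b) <= 192 * e.
  by move=> ha hb; apply: le_trans (normcB _ _) _; move: ha hb; clear; lra.
have b1 := B2 _ _ (M 0 1 2) (M 0 2 1).
have b2 := B2 _ _ (M 1 0 2) (M 1 2 0).
have b3 := B2 _ _ (M 2 0 1) (M 2 1 0).
apply: le_trans (normcD _ _) _; apply: le_trans (lerD (normcB _ _) b3) _.
by apply: le_trans (lerD (lerD b1 b2) (lexx _)) _; clear; lra.
Qed.

Lemma param_cmul (a u w : R[i]) C S : cmul a (param u w C S) = param (a * u) (a * w) C S.
Proof.
by apply: C3_eq3; rewrite zcoord_cmul !zmkE /basept /fibrept; ring.
Qed.

Lemma param_lipschitz (u w u' w' : R[i]) C S e : C ^+ 2 + S ^+ 2 = 1 ->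
  normc (u' - u) <= e -> normc (w' - w) <= e ->
  `|param u' w' C S - param u w C S| <= e.
Proof.
move=> cs hu hw; have e0 : 0 <= e by apply: le_trans hu; exact: normc_ge0.
have C1 := sqr_le1 cs; have S1 : `|S| <= 1 by apply: (@sqr_le1 _ _ C); rewrite addrC.
have hf : normc (fibrept u' w' - fibrept u w) <= e.
  have -> : fibrept u' w' - fibrept u w = 'i%C * (- (1 / 2))%:C * ((u' - u) - (w' - w)).
    have -> : 'i%C * (- (1 / 2))%:C = 0 +i* (- (1 / 2)) :> R[i] by apply: complex_eq; rewrite /=; ring.
    by rewrite /fibrept; ring.
  rewrite !normcM normc_i normcR normrN ger0_norm // mul1r.
  by have := normcB (u' - u) (w' - w); move: hu hw; clear; lra.
apply: norm_le_zcoord => // j; case: (I3P j) => ->; rewrite zcoordB !zmkE.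
- have -> : basept u' w' - basept u w = (1 / 2)%:C * ((u' - u) + (w' - w)) by rewrite /basept; ring.
  rewrite normcM normcR ger0_norm //.
  by have := normcD (u' - u) (w' - w); move: hu hw; clear; lra.
- by rewrite -mulrBl normcM normcR -[leRHS]mulr1; apply: ler_pM; rewrite ?normc_ge0.
- by rewrite -mulrBl normcM normcR -[leRHS]mulr1; apply: ler_pM; rewrite ?normc_ge0.
Qed.

Lemma om_param (u w a b : R[i]) :
  om (param u w 1 0) (param (u * a) (w * b) 1 0) = (sqn u * ImC a + sqn w * ImC b) / 2.
Proof.
rewrite om_imc !zmkE !imcZ -imc_base_fibreM.
by rewrite mulr1 mul1r mulr0 mul0r addr0.
Qed.

Lemma uvcoord_param y (u w : R[i]) : 0 < y -> y < 1 / 2 -> sqn u = 4 * y -> sqn w = 4 * (1 - y) ->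
  ucoord y (param u w 1 0) = u /\ vcoord y (param u w 1 0) = w.
Proof.
move=> y0 y2 hu hw.
have x0 : 1 - 2 * y != 0 by rewrite gt_eqF //; lra.
have momE j z : mom j z = imc (zcoord z 0) (zcoord z j) by [].
have one (a b : R[i]) : imc a (b * 1%:C) = imc a b by rewrite -[b * _]mulr1 !mulr1.
have nul (a b : R[i]) : imc a (b * 0%:C) = 0.
  by have := imcZ a b 1 0; rewrite mulr1 => ->; rewrite mulr0 mul0r.
have hC : dirC y (param u w 1 0) = 1.
  rewrite /dirC momE !zmkE one imc_base_fibre hu hw.
  by rewrite (_ : (4 * (1 - y) - 4 * y) / 4 = 1 - 2 * y) ?divff //; field.
have hS : dirS y (param u w 1 0) = 0 by rewrite /dirS momE !zmkE nul mul0r.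
have hz : zeta y (param u w 1 0) = fibrept u w.
  by rewrite /zeta hC hS !zmkE !mulr1 [_%:C](_ : _ = 0) // !mulr0 addr0.
rewrite /ucoord /vcoord hz !zmkE /basept /fibrept.
case: u w {hu hw hC hS hz} => a b [c d].
by split; apply: complex_eq; rewrite /=; field.
Qed.

Lemma uv_lipschitz y : 0 < y -> y < 1 / 2 -> exists2 c, 0 < c &
  forall P Q, torus y P -> torus y Q ->
    normc (ucoord y Q - ucoord y P) <= c * `|Q - P| /\
    normc (vcoord y Q - vcoord y P) <= c * `|Q - P|.
Proof.
move=> y0 y2; have [c c0 lip] := torus_lipschitz y0 y2.
exists (c * 2); first by rewrite mulr_gt0.
move=> P Q Pt Qt; have [_ _ hu hv _] := lip P Q Pt Qt.
have [u0 v0 _] := coord_neq0 y0 y2 Pt; have [_ _ _ qu qv] := torus_coordP y0 y2 Pt.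
have T (a b : R[i]) : a != 0 -> sqn a <= 2 ^+ 2 -> normc (b / a - 1) <= c * `|Q - P| ->
   normc (b - a) <= c * 2 * `|Q - P|.
  move=> a0 sa h; have -> : b - a = (b / a - 1) * a by field.
  rewrite normcM mulrAC; apply: ler_pM; rewrite ?normc_ge0 //.
  by apply: normc_sq_ge.
by split; apply: T; rewrite ?qu ?qv //; lra.
Qed.

Lemma solves_ccont (X : R -> C3 R -> C3 R) c j t :
  solves X c -> 0 <= t <= 1 -> ccont (fun s => zcoord (c s) j) t.
Proof.
move=> sc t01; have [_ d] := sc t t01.
by split; apply: differentiable_continuous; apply/derivable1_diffP;
  [have [] := is_derive_coord1 j d|have [] := is_derive_coord2 j d].
Qed.

Lemma solves_cmul (X : R -> C3 R -> C3 R) C c (a : R[i]) : regular X C -> `|a| = 1 -> solves X c ->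
  solves X (fun t => cmul a (c t)).
Proof.
move=> Xr a1 sc t t01; have [cS d] := sc t t01; split; first by rewrite sphere_cmul.
by have [_ /(_ a a1) ->] := Xr.2 t t01 _ cS; exact: is_derive_cmul.
Qed.

Lemma solves_uniq (X : R -> C3 R -> C3 R) C c c' t : regular X C -> solves X c -> solves X c' -> c 0 = c' 0 ->
  0 <= t <= 1 -> c' t = c t.
Proof.
move=> Xr sc sc' e t01; have := flow_lipschitz Xr sc sc' t01.
by rewrite e subrr normr0 mulr0 normr_le0 subr_eq0 => /eqP.
Qed.

End SolutionFamilies.

(** * The horizontal loop *)

Section HorizontalLoop.
Variable R : realType.
Implicit Types (P Q v w z : C3 R) (y : R).
Local Notation normc := ComplexField.Normc.normc.
Local Notation ReC := complex.Re.
Local Notation ImC := complex.Im.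

Definition carries (X : R -> C3 R -> C3 R) y y' := forall z, torus y z ->
  exists c, [/\ c 0 = z, solves X c & torus y' (c 1)].

(** Along the loop u makes 1 - y turns and v makes - y turns. It is horizontal since
    y (1 - y) - (1 - y) y = 0, and it closes up in the projective plane with holonomy
    cis (- 2 pi y). *)
Definition loopu y (s : R) : R[i] := (2 * Num.sqrt y)%:C * cis (2 * pi * (1 - y) * s).
Definition loopv y (s : R) : R[i] := (2 * Num.sqrt (1 - y))%:C * cis (- (2 * pi * y * s)).

Lemma sqn_real_cis (r t : R) : sqn (r%:C * cis t) = r ^+ 2.
Proof.
rewrite sqnM (_ : sqn (cis t) = 1); last by rewrite /sqn /cis /= cos2Dsin2.
by rewrite /sqn /= expr0n addr0 mulr1.
Qed.

Lemma sqn_loopu y s : 0 < y -> sqn (loopu y s) = 4 * y.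
Proof. by move=> y0; rewrite sqn_real_cis exprMn sqr_sqrtr ?ltW //; ring. Qed.
Lemma sqn_loopv y s : y < 1 / 2 -> sqn (loopv y s) = 4 * (1 - y).
Proof. by move=> y2; rewrite sqn_real_cis exprMn sqr_sqrtr; [ring|lra]. Qed.

Lemma loop_lipschitz y (s s' : R) : 0 < y -> y < 1 / 2 ->
  normc (loopu y s' - loopu y s) <= 8 * pi * `|s' - s| /\
  normc (loopv y s' - loopv y s) <= 8 * pi * `|s' - s|.
Proof.
move=> y0 y2; have p0 := @pi_gt0 R.
have T (r : R) (x x' : R) : 0 <= r -> r ^+ 2 <= 1 -> `|x' - x| <= 2 * pi * `|s' - s| ->
  normc ((2 * r)%:C * cis x' - (2 * r)%:C * cis x) <= 8 * pi * `|s' - s|.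
  move=> r0 r1 h; rewrite -mulrBr normcM normcR.
  have r1' : r <= 1 by rewrite -(@ler_pXn2r _ 2) ?nnegrE // expr1n.
  rewrite ger0_norm ?mulr_ge0 //.
  have h2 : normc (cis x' - cis x) <= 4 * pi * `|s' - s|.
    by apply: le_trans (cis_lipschitz _ _) _; move: h; clear; lra.
  rewrite (_ : 8 * pi * `|s' - s| = 2 * (4 * pi * `|s' - s|)); last by ring.
  by apply: ler_pM; rewrite ?normc_ge0 ?mulr_ge0 //; lra.
have pk (k : R) : 0 < k -> k < 1 -> forall x : R, `|2 * pi * k * x| <= 2 * pi * `|x|.
  move=> k0 k1 x; have k0' := ltW k0; have p0' := ltW p0.
  by rewrite normrM ger0_norm ?mulr_ge0 // ler_wpM2r // ler_piMr ?mulr_ge0 // ltW.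
split; apply: T.
- exact: sqrtr_ge0.
- by rewrite sqr_sqrtr; lra.
- by rewrite -mulrBr; apply: pk; lra.
- exact: sqrtr_ge0.
- by rewrite sqr_sqrtr; lra.
- by rewrite -opprD normrN -mulrBr; apply: pk; lra.
Qed.

Lemma cis_2pi : cis (2 * pi) = 1 :> R[i].
Proof.
rewrite (_ : 2 * pi = pi + pi); last by ring.
by rewrite cisD /cis cospi sinpi; apply: complex_eq; rewrite /=; ring.
Qed.

Lemma loop_closes y : loopu y 1 = cis (- (2 * pi * y)) * loopu y 0 /\
  loopv y 1 = cis (- (2 * pi * y)) * loopv y 0.
Proof.
have e : cis (2 * pi * (1 - y)) = cis (- (2 * pi * y)) :> R[i].
  have -> : 2 * pi * (1 - y) = 2 * pi - 2 * pi * y by ring.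
  by rewrite cisD cis_2pi mul1r.
by rewrite /loopu /loopv !mulr1 !mulr0 oppr0 cis0 mulr1 e; split; ring.
Qed.

Lemma om_loop y (s s' : R) : 0 < y -> y < 1 / 2 ->
  `|om (param (loopu y s) (loopv y s) 1 0) (param (loopu y s') (loopv y s') 1 0)|
    <= 16 * pi ^+ 2 * `|s' - s| ^+ 2.
Proof.
move=> y0 y2; have p0 := @pi_gt0 R.
set a := 2 * pi * (1 - y) * (s' - s); set b := - (2 * pi * y * (s' - s)).
have -> : loopu y s' = loopu y s * cis a.
  by rewrite /loopu -[RHS]mulrA -cisD; congr (_ * cis _); rewrite /a; ring.
have -> : loopv y s' = loopv y s * cis b.
  by rewrite /loopv -[RHS]mulrA -cisD; congr (_ * cis _); rewrite /b; ring.
rewrite om_param sqn_loopu // sqn_loopv //= .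
have -> : (4 * y * sin a + 4 * (1 - y) * sin b) / 2 =
   2 * y * (sin a - a) + 2 * (1 - y) * (sin b - b) by rewrite /a /b; field.
have ka : `|a| <= 2 * pi * `|s' - s|.
  rewrite /a normrM ger0_norm ?mulr_ge0 //; try lra.
  by rewrite ler_wpM2r // ler_piMr ?mulr_ge0 //; lra.
have kb : `|b| <= 2 * pi * `|s' - s|.
  rewrite /b normrN normrM ger0_norm ?mulr_ge0 //; try lra.
  by rewrite ler_wpM2r // ler_piMr ?mulr_ge0 //; lra.
have ha := le_trans (sin_sub_le a) (sqr_le_norm ka).
have hb := le_trans (sin_sub_le b) (sqr_le_norm kb).
have S (k x : R) : 0 < k -> k < 1 -> `|x| <= (2 * pi * `|s' - s|) ^+ 2 ->
   `|2 * k * x| <= 2 * (2 * pi * `|s' - s|) ^+ 2.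
  move=> k0 k1 hx; rewrite normrM; apply: ler_pM => //.
  by rewrite ger0_norm ?mulr_ge0 //; lra.
apply: le_trans (ler_normD _ _) _.
have y1 : 0 < 1 - y by lra.
apply: le_trans (lerD (S _ _ y0 _ ha) (S _ _ y1 _ hb)) _; lra.
Qed.

(** The hypotheses say dA = 2 pi (a - y) and dB = 2 pi (b - y) with a and b integers;
    then the relations hold with n = a - b, because a + 2 b = 1. *)
Lemma integer_relation y y' (dA dB : R) :
  (exists a : int, dA + 2 * pi * y = a%:~R * (2 * pi)) ->
  (exists b : int, dB + 2 * pi * y = b%:~R * (2 * pi)) ->
  y' * dA + (1 - y') * dB = 0 -> dA + 2 * dB = 2 * pi * (1 - 3 * y) ->
  exists n b : int, y = n%:~R * y' + b%:~R /\ 1 - 3 * y = n%:~R * (1 - 3 * y').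
Proof.
move=> [a ha] [b hb] h1 h2.
have p0 : 2 * pi != 0 :> R by rewrite mulf_neq0 ?gt_eqF // pi_gt0.
have eA : dA = 2 * pi * (a%:~R - y) by rewrite mulrBr -[2 * pi * a%:~R]mulrC -ha; ring.
have eB : dB = 2 * pi * (b%:~R - y) by rewrite mulrBr -[2 * pi * b%:~R]mulrC -hb; ring.
rewrite eA eB in h1 h2.
have k1 : y' * (a%:~R - y) + (1 - y') * (b%:~R - y) = 0.
  by apply: (mulfI p0); rewrite mulr0 -[RHS]h1; ring.
have k2 : (a%:~R - y) + 2 * (b%:~R - y) = 1 - 3 * y by apply: (mulfI p0); rewrite -[RHS]h2; ring.
exists (a - b), b; rewrite rmorphB /=.
have e1 : y = (a%:~R - b%:~R) * y' + b%:~R.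
  by apply/eqP; rewrite -subr_eq0 -[X in _ == X]oppr0 -k1; apply/eqP; ring.
split=> //.
have e2 : a%:~R + 2 * b%:~R = 1 :> R by move: k2; clear; lra.
have -> : 1 - 3 * y = (a%:~R + 2 * b%:~R) - 3 * ((a%:~R - b%:~R) * y' + b%:~R) by rewrite e2 -e1.
by ring.
Qed.

End HorizontalLoop.

(** * Invariance of the holonomy and of the phase *)

Section RotationNumbers.
Variable R : realType.
Implicit Types (P Q v w z : C3 R) (y : R).
Local Notation normc := ComplexField.Normc.normc.
Local Notation ReC := complex.Re.
Local Notation ImC := complex.Im.

(** The image of the horizontal loop is again horizontal and has the same holonomy
    [a], so that the total variations dA and dB of its arguments are 2 pi times
    integers minus y, linked by y' dA + (1 - y') dB = 0. Carrying along the triples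
    based on the loop gives a nonvanishing homotopy D of determinants, whence
    dA + 2 dB = 2 pi (1 - 3 y). *)
Lemma rotation_numbers (X : R -> C3 R -> C3 R) (C y y' : R) : regular X C ->
  0 < y -> y < 1 / 2 -> 0 < y' -> y' < 1 / 2 -> carries X y y' ->
  exists n b : int, y = n%:~R * y' + b%:~R /\ 1 - 3 * y = n%:~R * (1 - 3 * y').
Proof.
move=> Xr y0 y2 y0' y2' hX; have pi0 := @pi_gt0 R.
have [F HF] : exists F : C3 R -> R -> C3 R, forall z, torus y z ->
    [/\ F z 0 = z, solves X (F z) & torus y' (F z 1)].
  have ex z : exists c, torus y z -> [/\ c 0 = z, solves X c & torus y' (c 1)].
    have [zt|zt] := pselect (torus y z); last by exists (fun=> z).
    by have [c hc] := hX z zt; exists c.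
  by have [F HF] := choice ex; exists F.
have C0 := Xr.1; have M0 : 0 < flow_factor C by apply: lt_le_trans (flow_factor_ge1 Xr).
have [k k0 tr0] := triple_param y0 y2.
have K80 : 0 < 8 :> R by [].
have [K' [k' [d1 [K0' k0' d10 trF]]]] := triple_flow Xr K80 k0.
have [d2 d20 Re1] := det3_phase_Re y0' y2' K0' k0'.
have [d3 d30 Re0] := det3_phase_Re y0 y2 K80 k0.
pose d := Num.min (Num.min d1 d2) (Num.min d3 (Num.min (1 / 2) (k' / (4 * K')))).
have h20 : 0 < 1 / 2 :> R by [].
have kK0 : 0 < k' / (4 * K') by rewrite divr_gt0 // mulr_gt0.
have d0 : 0 < d by rewrite !lt_min d10 d20 d30 h20 kK0.
have : d <= d by [].
rewrite {2}/d !le_min => /andP[/andP[dd1 dd2] /andP[dd3 /andP[dh dk]]].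
clearbody d.
set al := unitc ((1 - y) * d); set be := unitc (- (y * d)); set Cd := Num.sqrt (1 - d ^+ 2).
have dn : `|d| <= 1 by rewrite gtr0_norm //; lra.
have al1 : sqn al = 1.
  apply: sqn_unitc; rewrite gtr0_norm ?mulr_gt0 //; last lra.
  by rewrite -[leRHS]mulr1; apply: ler_pM; lra.
have be1 : sqn be = 1.
  apply: sqn_unitc; rewrite normrN gtr0_norm ?mulr_gt0 //.
  by rewrite -[leRHS]mulr1; apply: ler_pM; lra.
have Cd1 : Cd ^+ 2 + d ^+ 2 = 1 by have := sqn_unitc dn; rewrite /sqn /unitc /=.
have c10 : 1 ^+ 2 + 0 ^+ 2 = 1 :> R by rewrite expr1n expr0n addr0.
pose p (s : R) := param (loopu y s) (loopv y s) 1 0.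
pose q (s : R) := param (loopu y s * al) (loopv y s * be) 1 0.
pose r (s : R) := param (loopu y s) (loopv y s) Cd d.
have pt s : torus y (p s) by apply: param_torus => //; rewrite ?sqn_loopu ?sqn_loopv.
have qt s : torus y (q s).
  by apply: param_torus => //; rewrite sqnM ?al1 ?be1 mulr1 ?sqn_loopu ?sqn_loopv.
have rt s : torus y (r s) by apply: param_torus => //; rewrite ?sqn_loopu ?sqn_loopv.
have tr s : triple 8 k d (p s) (q s) (r s).
  by apply: tr0 => //; rewrite ?sqn_loopu ?sqn_loopv.
pose L := 8 * pi : R.
have L0 : 0 < L by rewrite mulr_gt0.
have lipc (u u' a : R[i]) (e : R) : sqn a = 1 -> normc (u' - u) <= e -> normc (u' * a - u * a) <= e.
  move=> a1 h; rewrite -mulrBl normcM (_ : normc a = 1) ?mulr1 //.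
  have := sqr_normc_sqn a; rewrite a1 => /eqP; rewrite sqrf_eq1 => /orP[/eqP //|/eqP e1].
  by have := normc_ge0 a; rewrite e1 lerNr oppr0 leNgt ltr01.
have pL (s s' : R) : `|p s' - p s| <= L * `|s' - s|.
  by have [hu hv] := loop_lipschitz s s' y0 y2; apply: param_lipschitz.
have qL (s s' : R) : `|q s' - q s| <= L * `|s' - s|.
  by have [hu hv] := loop_lipschitz s s' y0 y2; apply: param_lipschitz => //; exact: lipc.
have rL (s s' : R) : `|r s' - r s| <= L * `|s' - s|.
  by have [hu hv] := loop_lipschitz s s' y0 y2; apply: param_lipschitz.
have F0 z : torus y z -> F z 0 = z by move=> /HF[].
have Fs z : torus y z -> solves X (F z) by move=> /HF[].
have F1 z : torus y z -> torus y' (F z 1) by move=> /HF[].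
have FL z z' (e t : R) : torus y z -> torus y z' -> `|z' - z| <= e -> 0 <= t <= 1 ->
    `|F z' t - F z t| <= flow_factor C * e.
  move=> zt zt' h t01; apply: le_trans (flow_lipschitz Xr (Fs _ zt) (Fs _ zt') t01) _.
  by rewrite !F0 // ler_pM2l.
pose a : R[i] := cis (- (2 * pi * y)).
have a1 : `|a| = 1 by apply/norm1_sqn; rewrite /sqn /a /cis /= cos2Dsin2.
have Fa z t : torus y z -> 0 <= t <= 1 -> F (cmul a z) t = cmul a (F z t).
  move=> zt t01; have azt := torus_cmul a1 zt.
  by apply: (solves_uniq Xr (solves_cmul Xr a1 (Fs _ zt)) (Fs _ azt)) => //; rewrite !F0.
have [lu lv] := loop_closes y; rewrite -/a in lu lv.
have p1 : p 1 = cmul a (p 0) by rewrite /p param_cmul lu lv.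
have q1 : q 1 = cmul a (q 0) by rewrite /q param_cmul lu lv !mulrA.
have r1 : r 1 = cmul a (r 0) by rewrite /r param_cmul lu lv.
(* t is the time of the flow and s the parameter of the loop *)
pose D (t s : R) := det3 (F (p s) t) (F (q s) t) (F (r s) t).
have FS z (t : R) : torus y z -> 0 <= t <= 1 -> F z t \in @sphere R.
  by move=> zt t01; have [] := Fs z zt t t01.
have D1 t : 0 <= t <= 1 -> D t 1 = a ^+ 3 * D t 0.
  by move=> t01; rewrite /D p1 q1 r1 !Fa // det3_cmul.
have Dt t s : 0 <= t <= 1 -> triple K' k' d (F (p s) t) (F (q s) t) (F (r s) t).
  move=> t01; apply: (trF d d0 dd1 (F (p s)) (F (q s)) (F (r s))) => //; try exact: Fs.
  by rewrite !F0.
have Dlip t s s' : 0 <= t <= 1 -> normc (D t s' - D t s) <= 576 * (flow_factor C * L) * `|s' - s|.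
  move=> t01; rewrite -mulrA -(mulrA (flow_factor C)).
  by apply: det3_lipschitz; rewrite ?FS //; apply: FL.
have Dlow t s : 0 <= t <= 1 -> k' * d ^+ 2 / 5 <= normc (D t s).
  move=> t01; have h := det3_lower K0' k0' d0 dk (FS _ _ (pt s) t01) (Dt t s t01).
  apply: normc_sq_le; first by rewrite divr_ge0 // mulr_ge0 ?sqr_ge0 // ltW.
  have -> : (k' * d ^+ 2 / 5) ^+ 2 = k' ^+ 2 * d ^+ 4 / 25 by field.
  rewrite -/(D t s) in h.
  have := sqn_ge0 (D t s); move: h; move: (sqn _) (k' ^+ 2 * _) => A B; clear; lra.
pose m := k' * d ^+ 2 / 5; have m0 : 0 < m by rewrite divr_gt0 // mulr_gt0 // exprn_gt0.
pose LD := 576 * (flow_factor C * L); have LD0 : 0 < LD.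
  by apply: mulr_gt0; [rewrite ltr0n|exact: mulr_gt0].
have Dslow t : 0 <= t <= 1 -> slow (D t) (m / (2 * LD)).
  by move=> t01; apply: slow_lipschitz => //; [move=> s; exact: Dlow|move=> s s'; exact: Dlip].
have eta0 : 0 < m / (2 * LD) by rewrite divr_gt0 // mulr_gt0.
have Dcs t s : 0 <= t <= 1 -> ccont (D t) s.
  by move=> t01; apply: (@ccont_lipschitz _ _ LD) => x x'; exact: Dlip.
have Dct t s : 0 <= t <= 1 -> ccont (D^~ s) t.
  move=> t01; have cz z j : torus y z -> ccont (fun t => zcoord (F z t) j) t.
    by move=> zt; exact: solves_ccont (Fs z zt) t01.
  rewrite /D /det3; apply: ccontD; first apply: ccontD.
  - by apply: ccontM; [exact: cz|apply: ccontD; [|apply: ccontN]; apply: ccontM; exact: cz].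
  - by apply: ccontN; apply: ccontM; [exact: cz|apply: ccontD; [|apply: ccontN]; apply: ccontM; exact: cz].
  - by apply: ccontM; [exact: cz|apply: ccontD; [|apply: ccontN]; apply: ccontM; exact: cz].
have z01 : 0 <= (0 : R) <= 1 by rewrite lexx ler01.
have o01 : 0 <= (1 : R) <= 1 by rewrite lexx ler01.
have LC y1 (w : R -> C3 R) (Lw : R) : 0 < y1 -> y1 < 1 / 2 -> 0 < Lw ->
    (forall s, torus y1 (w s)) ->
    (forall s s' : R, `|w s' - w s| <= Lw * `|s' - s|) -> exists2 c, 0 < c &
    (forall s s' : R, normc (ucoord y1 (w s') - ucoord y1 (w s)) <= c * `|s' - s|) /\
    (forall s s' : R, normc (vcoord y1 (w s') - vcoord y1 (w s)) <= c * `|s' - s|).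
  move=> y10 y12 Lw0 wt wL; have [c c0 lip] := uv_lipschitz y10 y12.
  exists (c * Lw); first by rewrite mulr_gt0.
  by split=> s s'; have [hu hv] := lip _ _ (wt s) (wt s');
    apply: le_trans _ (_ : c * (Lw * `|s' - s|) <= _); rewrite ?mulrA //;
    [apply: le_trans hu _|apply: le_trans hv _]; rewrite -mulrA ler_pM2l.
have [th0 [cth0 ath0 eth0]] : exists th : R -> R, [/\ continuous th,
    forall s, 0 <= s <= 1 -> is_arg (D 0 s / D 0 0) (th s) &
    th 1 - th 0 = 2 * pi * (1 - 3 * y)].
  have [c c0 [hu hv]] := LC y p L y0 y2 L0 pt pL.
  have uvp s : ucoord y (p s) = loopu y s /\ vcoord y (p s) = loopv y s.
    by apply: uvcoord_param; rewrite ?sqn_loopu ?sqn_loopv.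
  have cl (x : R) : continuous (fun s : R => x * s) by move=> s; apply: cvgMr; exact: cvg_id.
  pose A (s : R) := 2 * pi * (1 - y) * s; pose B (s : R) := - (2 * pi * y) * s.
  have quot (r0 : R) (x : R) : 0 < r0 -> is_arg (r0%:C * cis x / (r0%:C * cis 0)) x.
    move=> r00; exists 1 => //; rewrite cis0 mulr1 mulrAC divff ?mul1r ?rmorph1 ?mul1r //.
    by rewrite (_ : 0 = 0%:C) // (inj_eq (@complexI R)) gt_eqF.
  have [|||||||||||th [cth ath eth]] := @phase_lift _ y p (D 0) A B a y0 y2 pt.
  - by move=> s; exact: ccont_lipschitz hu.
  - by move=> s; exact: ccont_lipschitz hv.
  - by move=> s; exact: Dcs.
  - move=> s; rewrite /D !F0 //; apply: (Re0 d) => //.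
  - exact: cl.
  - exact: cl.
  - move=> s s01; have [-> _] := uvp s; have [-> _] := uvp 0.
    by rewrite /loopu !mulr0; apply: quot; rewrite mulr_gt0 // sqrtr_gt0.
  - move=> s s01; have [_ ->] := uvp s; have [_ ->] := uvp 0.
    rewrite /loopv !mulr0 oppr0 /B mulNr; apply: quot.
    by rewrite mulr_gt0 // sqrtr_gt0; lra.
  - exact: a1.
  - exact: p1.
  - exact: D1.
  by exists th; split=> //; rewrite eth /A /B; ring.
pose w (s : R) := F (p s) 1.
have wt s : torus y' (w s) by exact: F1.
have wL (s s' : R) : `|w s' - w s| <= flow_factor C * L * `|s' - s|.
  by rewrite -mulrA; apply: FL.
have MLO : 0 < flow_factor C * L by rewrite mulr_gt0.
have [c c0 [hu hv]] := LC y' w _ y0' y2' MLO wt wL.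
have [A cA hA] : exists2 th : R -> R, continuous th & forall s, 0 <= s <= 1 ->
    is_arg (ucoord y' (w s) / ucoord y' (w 0)) (th s).
  apply: (@ex_lift _ (fun s => ucoord y' (w s)) (2 * y' / (2 * c))).
  - by rewrite divr_gt0 // mulr_gt0.
  - apply: slow_lipschitz => //; first by rewrite mulr_gt0.
    by move=> s; exact: ucoord_ge.
  - by move=> s; exact: ccont_lipschitz hu.
have [B cB hB] : exists2 th : R -> R, continuous th & forall s, 0 <= s <= 1 ->
    is_arg (vcoord y' (w s) / vcoord y' (w 0)) (th s).
  apply: (@ex_lift _ (fun s => vcoord y' (w s)) (1 / (2 * c))).
  - by rewrite divr_gt0 // mulr_gt0.
  - by apply: slow_lipschitz => // s; exact: (vcoord_ge y0' y2').
  - by move=> s; exact: ccont_lipschitz hv.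
have w1 : w 1 = cmul a (w 0) by rewrite /w p1 Fa.
have [|||||||||||th1 [cth1 ath1 eth1]] := @phase_lift _ y' w (D 1) A B a y0' y2' wt.
- by move=> s; exact: ccont_lipschitz hu.
- by move=> s; exact: ccont_lipschitz hv.
- by move=> s; exact: Dcs.
- by move=> s; exact: (Re1 d _ _ _ d0 dd2 (F1 _ (pt s)) (F1 _ (qt s)) (F1 _ (rt s)) (Dt 1 s o01)).
- exact: cA.
- exact: cB.
- exact: hA.
- exact: hB.
- exact: a1.
- exact: w1.
- exact: D1.
have wind := winding_homotopy eta0 Dslow Dcs Dct D1 cth0 cth1 ath0 ath1.
have hor : y' * (A 1 - A 0) + (1 - y') * (B 1 - B 0) = 0.
  apply: (@lift_horizontal _ y' w (flow_factor C * L) (12 * C * flow_factor C ^+ 2 * L ^+ 2 + 16 * pi ^+ 2)) => //.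
  move=> s s'; have h := flow_om Xr (Fs _ (pt s)) (Fs _ (pt s')) o01; rewrite !F0 // in h.
  rewrite -(subrK (om (p s) (p s')) (om (w s) _)); apply: le_trans (ler_normD _ _) _.
  rewrite [leRHS]mulrDl; apply: lerD; last exact: om_loop.
  have cpos : 0 <= 12 * C * flow_factor C ^+ 2
    by apply: mulr_ge0; [apply: mulr_ge0 => //; exact: ltW|exact: sqr_ge0].
  apply: le_trans h _; rewrite -(mulrA (12 * C * flow_factor C ^+ 2) (L ^+ 2)); apply: (ler_wpM2l cpos).
  rewrite -exprMn -[leLHS]ger0_norm ?sqr_ge0 // normrX normr_id.
  by apply: sqr_le_norm; rewrite normr_id; exact: pL.
have [ua va _] := uv_cmul y' (w 0) a1; rewrite -w1 in ua va.
have per (f f0 : R[i]) (x x0 : R) : f0 != 0 -> f = a * f0 -> is_arg (f / f0) x ->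
    is_arg (f0 / f0) x0 -> exists n : int, x - x0 + 2 * pi * y = n%:~R * (2 * pi).
  move=> f00 -> h; rewrite divff // => h0.
  have [n hn] := is_arg_uniq h0 (@is_arg1 R).
  rewrite mulfK // in h; have [n' hn'] := is_arg_uniq h (is_arg_cis (- (2 * pi * y))).
  exists (n' - n); rewrite rmorphB /= mulrBl -hn -hn'; ring.
have [u0 v0 _] := coord_neq0 y0' y2' (wt 0).
apply: (integer_relation (dA := A 1 - A 0) (dB := B 1 - B 0)) => //.
- exact: per _ _ _ _ u0 ua (hA 1 o01) (hA 0 z01).
- exact: per _ _ _ _ v0 va (hB 1 o01) (hB 0 z01).
- by rewrite -eth1 -wind.
Qed.

End RotationNumbers.

(** * Rigidity of the tori *)

Section Rigidity.
Variable R : realType.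
Implicit Types (X : R -> C3 R -> C3 R) (z w : C3 R) (x y : R).

Definition reversed X (t : R) z : C3 R := - X (1 - t) z.

Lemma regular_reversed X C : regular X C -> regular (reversed X) C.
Proof.
move=> [C0 Xr]; split=> // t t01 p pS.
have t01' : 0 <= 1 - t <= 1 by move: t01; lra.
have [[A [Ab Asp Ap Aq]] Xe] := Xr (1 - t) t01' p pS.
split; last by move=> a a1; rewrite /reversed Xe //; apply: C3_eq => j;
  rewrite -scaleN1r -[in RHS]scaleN1r cmulZ.
exists (\- A : {linear C3 R -> C3 R}); split=> /=.
- by move=> v; rewrite normrN.
- by move=> v w; rewrite omNl omNr -opprD Asp oppr0.
- by rewrite /reversed Ap.
- move=> q qS; rewrite /reversed -!opprD normrN; exact: Aq.
Qed.

Lemma solves_reversed X c : solves X c -> solves (reversed X) (fun t => c (1 - t)).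
Proof.
move=> sc t t01; have t01' : 0 <= 1 - t <= 1 by move: t01; lra.
have [cS d] := sc _ t01'; split=> //; rewrite /reversed.
have dl : is_derive t 1 (fun t : R => 1 - t) (-1) by apply: is_derive_eq; rewrite /GRing.scale /=; ring.
apply: is_derive_C3 => j.
- have dj := is_derive_coord1 j d.
  have := @is_derive1_comp _ (fun s : R => (c s).1 ord0 j) (fun t : R => 1 - t) t _ _ dj dl.
  by move=> h; apply: is_derive_eq h _; rewrite mxE /GRing.scale /=; ring.
- have dj := is_derive_coord2 j d.
  have := @is_derive1_comp _ (fun s : R => (c s).2 ord0 j) (fun t : R => 1 - t) t _ _ dj dl.
  by move=> h; apply: is_derive_eq h _; rewrite mxE /GRing.scale /=; ring.
Qed.

Lemma interior_Delta_W x y : interior (@Delta_W R) (x, y) -> 0 < x /\ 0 < y.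
Proof.
rewrite /interior => /nbhs_ballP[r r0 h].
have r2 : 0 < r / 2 by rewrite divr_gt0.
have rr : r / 2 < r by rewrite ltr_pdivrMr // ltr_pMr // ltr1n.
have [h1 _] : Delta_W (x - r / 2, y).
  apply: h; split; rewrite /ball /=; last by rewrite subrr normr0.
  by rewrite opprB addrC subrK gtr0_norm.
have [_ h2] : Delta_W (x, y - r / 2).
  apply: h; split; rewrite /ball /=; first by rewrite subrr normr0.
  by rewrite opprB addrC subrK gtr0_norm.
by split; move: h1 h2 => /= /andP[h1 _] /andP[h2 _]; [apply: lt_le_trans r2 _|apply: lt_le_trans r2 _];
  rewrite -subr_ge0.
Qed.

(** The inverse direction needs a solution ending at a given point w: a solution that
    ends on the circle of w is rotated so as to end at w. *)
Lemma isotopic_carries x y x' y' : x + 2 * y = 1 -> x' + 2 * y' = 1 ->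
  hamiltonian_isotopic (L_torus x y) (L_torus x' y') ->
  exists X C, [/\ regular X C, carries X y y' & carries (reversed X) y' y].
Proof.
move=> h1 h1' [psi [H [phi [Hs flow ->]]] img].
have [C Xr] := regular_Xfun Hs.
have o01 : 0 <= (1 : R) <= 1 by rewrite lexx ler01.
have lift z : z \in @sphere R -> exists c, [/\ c 0 = z, solves (Xfun H) c &
    hproj (c 1) = phi 1 (hproj z)].
  move=> zS; have [p0 ic] := flow (hproj z).
  by have [c [c0 sc hc]] := lift_curve Hs ic zS (esym p0); exists c; split=> //; exact: hc.
exists (Xfun H), C; split=> // [z zt|w wt].
  have [zS _ _] := zt; have [c [c0 sc c1]] := lift z zS; exists c; split=> //.
  have [c1S _] := sc 1 o01; apply/(L_torus_hproj h1' c1S); rewrite c1 -img.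
  by exists (hproj z) => //; apply/(L_torus_hproj h1 zS).
have [wS _ _] := wt.
have : L_torus x' y' (hproj w) by apply/(L_torus_hproj h1' wS).
rewrite -img => -[p [z [zS q1 i1] <-] pw].
have zt : torus y z by apply/(L_torus_hproj h1 zS); exists z.
have [c [c0 sc c1]] := lift z zS; have [c1S _] := sc 1 o01.
have [u u1 hu] := (hproj_eq c1S wS).1 (etrans c1 pw).
exists (fun t => cmul u (c (1 - t))); split.
- by rewrite subr0; apply: C3_eq => j; rewrite zcoord_cmul hu.
- exact: solves_reversed (solves_cmul Xr u1 sc).
- by rewrite subrr c0; exact: torus_cmul.
Qed.

(** If 1 - 3 y is not zero then n m = 1, and comparing the first two equations gives
    n + 3 b = 1; the only such n is 1. *)
Lemma torus_rigidity (y y' : R) (n m b : int) :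
  y = n%:~R * y' + b%:~R -> 1 - 3 * y = n%:~R * (1 - 3 * y') ->
  1 - 3 * y' = m%:~R * (1 - 3 * y) -> y = y'.
Proof.
move=> e1 e2 e3.
have [y3|y3] := eqVneq (1 - 3 * y) 0.
  by move: e3; rewrite y3 mulr0; move: y3; clear; lra.
have nm : n * m = 1.
  apply: (@intr_inj R); rewrite rmorphM /=; apply: (mulIf y3); rewrite mul1r -mulrA -e3 -e2 //.
have nb : n + 3 * b = 1.
  apply: (@intr_inj R); rewrite rmorphD rmorphM /=; move: e1 e2; clear.
  move: (n%:~R : R) (b%:~R : R) => N B -> ; lra.
have n1 : n = 1.
  have /eqP : (absz n * absz m = 1)%N by rewrite -abszM nm.
  by rewrite muln_eq1 => /andP[/eqP n1 _]; lia.
have b0 : b = 0 by lia.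
by rewrite e1 n1 b0 mul1r addr0.
Qed.

End Rigidity.

Theorem corollary1p3 (R : realType) (x y x' y' : R)
  (hxy : interior (@Delta_W R) (x, y)) (hxy' : interior (@Delta_W R) (x', y'))
  (h1 : x + 2 * y = 1) (h1' : x' + 2 * y' = 1)
  (hiso : hamiltonian_isotopic (L_torus x y) (L_torus x' y')) :
  (x, y) = (x', y').
Proof.
have [x0 y0] := interior_Delta_W hxy; have [x0' y0'] := interior_Delta_W hxy'.
have y2 : y < 1 / 2 by lra.
have y2' : y' < 1 / 2 by lra.
have [X [C [Xr fwd bwd]]] := isotopic_carries h1 h1' hiso.
have [n [b [e1 e2]]] := rotation_numbers Xr y0 y2 y0' y2' fwd.
have [m [b' [_ e3]]] := rotation_numbers (regular_reversed Xr) y0' y2' y0 y2 bwd.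
have yy := torus_rigidity e1 e2 e3.
by congr (_, _) => //; lra.
Qed.
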